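(* Let $a:\mathbb{R}^d_+\to\mathbb{R}^d$ be continuously differentiable with bounded derivative, and let $\varphi_t(x)$, $t\ge0$, $x\in\mathbb{R}^d_+$, be the solution of the reflected stochastic differential equation $$d\varphi_t(x)=a(\varphi_t(x))\,dt+dw(t)+n\,L(dt,x),\quad t\ge0,\qquad \varphi_0(x)=x,\quad \varphi_t(x)\in\mathbb{R}^d_+ .$$ Then for all $t\ge0$ and $x\in\mathbb{R}^{d-1}\times(0,\infty)$, with probability 1, $$\nabla\varphi_t(x)=\begin{cases}\mathcal{E}_{0t}(x), & t<\sigma(x),\\ \mathcal{E}_{\tau(t,x)\,t}(x)\,P\left(\prod_{(\sigma_k(x),\tau_k(x))\subset[0,t]}\bigl(P\,\mathcal{E}_{\sigma_k(x)\tau_k(x)}(x)\,P\bigr)\right)\mathcal{E}_{0\,\sigma(x)}(x), & t\ge\sigma(x).\end{cases}$$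
   Context: $\mathbb{R}^d_+=\mathbb{R}^{d-1}\times[0,\infty)$, $\partial\mathbb{R}^d_+=\mathbb{R}^{d-1}\times\{0\}$, $n=(0,\dots,0,1)$ and $w$ is a Wiener process in $\mathbb{R}^d$. A solution of the reflected equation is a pair $(\varphi,L)$ satisfying the equation (in integral form) where $L(t,x)$ is continuous and non-decreasing in $t$, $L(0,x)=0$, and $\int_0^t\mathbf{1}_{\varphi_s(x)\in\partial\mathbb{R}^d_+}L(ds,x)=L(t,x)$ for all $t\ge0$. Under the assumptions on $a$, for every $\omega$ there is a unique solution, and it is continuous in $(t,x)$. $\nabla\varphi_t(x)$ is the Fréchet derivative of $y\mapsto\varphi_t(y)$ at $x$; for each fixed $t\ge 0$ and $x\in\mathbb{R}^{d-1}\times(0,\infty)$ it is known to exist with probability 1. $E$ is the $d\times d$ identity matrix and $P=\mathrm{diag}(1,\dots,1,0)$. $\sigma(x)=\inf\{t\ge0:\varphi_t(x)\in\partial\mathbb{R}^d_+\}$ and $\tau(t,x)=\sup\{s\in[0,t]:\varphi_s(x)\in\partial\mathbb{R}^d_+\}$. The $(\sigma_k(x),\tau_k(x))$ are the disjoint open intervals (connected components) with $\bigcup_k(\sigma_k(x),\tau_k(x))=\{t>\sigma(x):\varphi_t(x)\notin\partial\mathbb{R}^d_+\}$, linearly ordered from left to right on the line. $\mathcal{E}_{st}(x)$ is the solution of $\frac{\partial}{\partial t}\mathcal{E}_{st}(x)=\nabla a(\varphi_t(x))\,\mathcal{E}_{st}(x)$ for $t\ge s$, with $\mathcal{E}_{ss}(x)=E$.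 Ordered products: for a finite index set, $\prod$ is the matrix product with factors of greater index on the left; an empty product is $E$. For a countable linearly ordered index set $K$, $\prod_{k\in K}A_k$ converges and equals $U$ if for every $\varepsilon>0$ there is a finite $L_0\subset K$ such that for every finite $L$ with $L_0\subset L\subset K$ one has $\|\prod_{k\in L}A_k-U\|<\varepsilon$ (operator norm). The product in the claim is understood in this sense. *)

(* Defs.v *)
From HB Require Import structures.
From mathcomp Require Import all_boot all_order all_algebra finmap.
From mathcomp Require Import all_classical all_reals all_analysis.

Set Implicit Arguments.
Unset Strict Implicit.
Unset Printing Implicit Defensive.

Import Order.TTheory GRing.Theory Num.Theory.
Import numFieldNormedType.Exports.

Local Open Scope classical_set_scope.
Local Open Scope ring_scope.

(* The space dimension is d.+1; points are column vectors, so that matrices act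
   on the left, and [ord_max] is the index of the last coordinate. *)

Section HalfSpace.
Context {R : realType} {d : nat}.

Definition halfspace : set 'cV[R]_d.+1 := [set x | 0 <= x ord_max 0].
Definition halfspace_bd : set 'cV[R]_d.+1 := [set x | x ord_max 0 = 0].
Definition halfspace_int : set 'cV[R]_d.+1 := [set x | 0 < x ord_max 0].

Definition normal_vec : 'cV[R]_d.+1 := delta_mx ord_max 0.

(* diag(1, ..., 1, 0) *)
Definition tangent_proj : 'M[R]_d.+1 :=
  diag_mx (\row_(j < d.+1) (j != ord_max)%:R).

End HalfSpace.

Section OperatorNorm.
Context {R : realType} {n : nat}.

(* The library norm on matrices is the maximum norm of the entries. *)
Definition norm2 (v : 'cV[R]_n) : R := Num.sqrt (\sum_i v i 0 ^+ 2).

Definition opnorm (A : 'M[R]_n) : R :=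
  sup [set norm2 (A *m v) | v in [set v | norm2 v <= 1]].

End OperatorNorm.

(* Fréchet derivative relative to D, one-sided at the boundary points of D;
   df is meant to be linear.  On the closed half-space and on [s, +oo[ it is
   unique, and at interior points of D it is the usual derivative. *)
Definition is_diff_in {R : realType} {V W : normedModType R}
    (D : set V) (f : V -> W) (x : V) (df : V -> W) : Prop :=
  forall e : R, 0 < e ->
    \forall y \near within D (nbhs x),
      `|f y - f x - df (y - x)| <= e * `|y - x|.

(* a is continuously differentiable on the closed half-space with bounded
   derivative Da. *)
Definition C1_bounded {R : realType} {d : nat}
    (a : 'cV[R]_d.+1 -> 'cV[R]_d.+1) (Da : 'cV[R]_d.+1 -> 'M[R]_d.+1) : Prop :=
  [/\ forall x, halfspace x -> is_diff_in halfspace a x (mulmx (Da x)),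
      {within halfspace, continuous Da}
    & exists C : R, forall x, halfspace x -> opnorm (Da x) <= C].

Section Wiener.
Context {disp : measure_display} {Omega : measurableType disp} {R : realType}.
Variable Pr : probability Omega R.

(* Taking some B i to be the whole line gives the product rule for every
   subfamily. *)
Definition mutually_independent (I : finType) (X : I -> Omega -> R) : Prop :=
  forall B : I -> set R, (forall i, measurable (B i)) ->
    Pr (\bigcap_(i in [set: I]) X i @^-1` B i) =
    (\prod_(i : I) Pr (X i @^-1` B i))%E.

(* Standard Wiener process in dimension n, with every path continuous.  The
   independence clause covers both the independence of the increments and the
   independence of the coordinates; [normal_prob] takes the standard
   deviation. *)
Record wiener (n : nat) (w : R -> Omega -> 'cV[R]_n) : Prop := {
  wiener0 : forall omega, w 0 omega = 0 ;
  wiener_continuous : forall omega,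
    {within `[0, +oo[%classic, continuous (w ^~ omega)} ;
  wiener_measurable : forall (t : R) (i : 'I_n), 0 <= t ->
    measurable_fun [set: Omega] (fun omega => w t omega i 0) ;
  wiener_independent : forall (m : nat) (u : nat -> R),
    0 <= u 0%N -> (forall k, (k < m)%N -> u k < u k.+1) ->
    mutually_independent (fun (ki : 'I_m * 'I_n) omega =>
      w (u ki.1.+1) omega ki.2 0 - w (u ki.1) omega ki.2 0) ;
  wiener_gaussian : forall (s t : R) (i : 'I_n), 0 <= s -> s < t ->
    forall B : set R, measurable B ->
      Pr ((fun omega => w t omega i 0 - w s omega i 0) @^-1` B) =
      normal_prob 0 (Num.sqrt (t - s)) B
}.

End Wiener.

Section Paths.
Context {R : realType} {d : nat}.
Implicit Types (p : R -> 'cV[R]_d.+1) (t : R).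

(* Stieltjes integral over [0, t] of the indicator of {s | p s on the boundary}
   with respect to l(ds).  A [cumulative] function lives on the whole line, so
   l is extended by its value l 0 on the left of 0; such an F exists, and is
   unique, as soon as l is continuous and non-decreasing on [0, +oo[. *)
Definition increases_on_boundary p (l : R -> R) : Prop :=
  exists F : cumulative R R, (forall s, F s = l (Num.max s 0)) /\
    forall t, 0 <= t ->
      (\int[lebesgue_stieltjes_measure F]_(s in `[0%R, t])
         (\1_[set r | halfspace_bd (p r)] s)%:E = (l t)%:E)%E.

(* (p, l) solves the reflected equation started at x and driven by the path w.
   Continuity of p makes the drift integral meaningful. *)
Record reflected_solution (a : 'cV[R]_d.+1 -> 'cV[R]_d.+1)
    (w : R -> 'cV[R]_d.+1) (x : 'cV[R]_d.+1) p (l : R -> R) : Prop := {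
  refl_halfspace : forall t, 0 <= t -> halfspace (p t) ;
  refl_continuous : {within `[0, +oo[%classic, continuous p} ;
  refl_equation : forall t (i : 'I_d.+1), 0 <= t ->
    p t i 0 = x i 0
      + \int[lebesgue_measure]_(s in `[0, t]) (a (p s) i 0)
      + w t i 0 + normal_vec i 0 * l t ;
  refl_local0 : l 0 = 0 ;
  refl_local_continuous : {within `[0, +oo[%classic, continuous l} ;
  refl_local_nondecreasing : forall s t, 0 <= s -> s <= t -> l s <= l t ;
  refl_local_support : increases_on_boundary p l
}.

(* E s t is the solution, for t >= s, of the linear equation along p. *)
Definition linearized_solution (Da : 'cV[R]_d.+1 -> 'M[R]_d.+1) p
    (E : R -> R -> 'M[R]_d.+1) : Prop :=
  forall s, 0 <= s -> E s s = 1%:M /\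
    forall t, s <= t ->
      is_diff_in `[s, +oo[%classic (E s) t
        (fun h : R => h *: (Da (p t) *m E s t)).

(* +oo if the boundary is never reached *)
Definition hitting_time p : \bar R :=
  ereal_inf [set s%:E | s in [set s : R | 0 <= s /\ halfspace_bd (p s)]].

Definition last_hitting_time p t : R :=
  sup [set s : R | s \in `[0, t] /\ halfspace_bd (p s)].

Definition excursion_set p : set R :=
  [set s | (hitting_time p < s%:E)%E /\ ~ halfspace_bd (p s)].

(* The excursion intervals ]k.1, k.2[ contained in [0, t]. *)
Definition excursions p t : set (R * R) :=
  [set k | `]k.1, k.2[%classic `<=` `[0, t]%classic /\
     exists2 s, excursion_set p s &
       connected_component (excursion_set p) s = `]k.1, k.2[%classic].

(* Left-to-right order; it is linear on disjoint non-empty intervals. *)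
Definition left_of : rel (R * R) := fun k k' => k.1 <= k'.1.

End Paths.

(* The product of the A k over the linearly ordered (by le) set K, factors of
   greater index on the left, converges and equals U. *)
Definition ordered_prod_cvg {R : realType} {n : nat} {I : choiceType}
    (le : rel I) (K : set I) (A : I -> 'M[R]_n.+1) (U : 'M[R]_n.+1) : Prop :=
  forall e : R, 0 < e ->
    exists2 L0 : {fset I}, [set` L0] `<=` K &
      forall L : {fset I}, (L0 `<=` L)%fset -> [set` L] `<=` K ->
        opnorm (\prod_(k <- rev (sort le L)) A k - U) < e.

(* Main.v *)
(* Let psi = phi(y) - phi(x) for y near x.  On an excursion psi solves, up to o(|y - x|), the
   linearized equation.  The local time acts on the normal coordinate only, so that
   P psi is Lipschitz in time with constant O(|y - x|); hence it can be tracked up to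
   eta |y - x| over finitely many excursions which fill [sigma, tau] up to length
   eta, the time spent at the boundary being null.  The normal coordinate of psi is
   small just after the left end of an excursion because the local time of x was
   still increasing just before that end, which forces the nearby solution y to be
   reflected at almost the same time.

   The exceptional events are null for the following reasons.  At a zero of the
   normal coordinate the noise has grown at most linearly since any earlier time;
   for a Wiener process this has probability 0 at a fixed time, and by Fubini the
   zero set is Lebesgue-null.  For rational p < q close together, it has probability
   0 that the path is off the boundary at p and touches it in [p, q] without any
   increase of the local time: comparing two outcomes in this event, the normal
   increment of the noise over [p, p + delta] is determined up to O(delta) by
   increments independent of it, while its density is O(delta^(-1/2)). *)

Require Import Defs.
From HB Require Import structures.
From mathcomp Require Import all_boot all_order all_algebra finmap.
From mathcomp Require Import all_classical all_reals all_analysis.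
From mathcomp Require Import measurable_realfun ring lra zify.
Import Order.TTheory GRing.Theory Num.Theory.
Import numFieldNormedType.Exports.
Local Open Scope classical_set_scope.
Local Open Scope ring_scope.

Set Implicit Arguments.
Unset Strict Implicit.
Unset Printing Implicit Defensive.

(** * Norms and mean value inequalities *)

(** The exceptional set may depend on [t] and [x], but not on the nearby starting point [y]. All
    probability therefore concerns the single path from [x]; solutions from [x] and [y] are compared
    outcome by outcome, by deterministic estimates valid near [x].

    The hypotheses give no measurability of [phi] or [L] in the outcome, let alone adaptedness, so
    neither conditioning on the past nor a Markov property is at hand. Events about the path are
    enclosed in measurable sets of small probability, built from finitely many increments of the
    noise, and independence is used between those increments only.

    The reflection map is Lipschitz in the supremum norm, so Gronwall bounds are stated with running
    suprema. First-order expansions hold only strictly inside excursions; near a zero they stop at a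
    distance [eta], chosen before [y], and the remaining stretch costs [O(eta) * |y - x|]. At a
    fixed [t] the path is almost surely off the boundary, so the last excursion has positive length;
    this is what gives the full displacement at [t] and not merely its tangential part. *)

Lemma ler_mx_entry (R : realType) m n (A : 'M[R]_(m, n)) i j : `|A i j| <= `|A|.
Proof.
rewrite [leRHS]mx_normrE.
exact: (@le_bigmax _ _ _ 0 (fun ij : 'I_m * 'I_n => `|A ij.1 ij.2|) (i, j)).
Qed.

Lemma mx_norm_le (R : realType) m n (A : 'M[R]_(m, n)) c :
  0 <= c -> (forall i j, `|A i j| <= c) -> `|A| <= c.
Proof.
by move=> c0 Ac; rewrite [leLHS]mx_normrE; apply/bigmax_leP; split=> // -[].
Qed.

(** The library norm is the largest entry, and an entry of the product is a sum of [n] terms. This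
    norm is not submultiplicative, so the factor travels through the later constants as
    [d.+1%:R]. *)
Lemma norm_mulmx (R : realType) m n p (A : 'M[R]_(m, n)) (B : 'M[R]_(n, p)) :
  `|A *m B| <= n%:R * `|A| * `|B|.
Proof.
apply: mx_norm_le => [|i j]; first by rewrite !mulr_ge0.
rewrite mxE (le_trans (ler_norm_sum _ _ _))//.
rewrite (@le_trans _ _ (\sum_(k < n) `|A| * `|B|))//; last first.
  by rewrite sumr_const card_ord -[X in X <= _]mulr_natl mulrA.
apply: ler_sum => k _; rewrite normrM.
by apply: ler_pM => //; exact: ler_mx_entry.
Qed.

Section MeanValue.
Context {R : realType}.
Implicit Types (f g : R -> R) (a b : R).

(** The mean value theorem for [g - f]. Derivatives are asked for in the open interval only, because
    the drift and the linear flow are differentiated only after their starting time; continuity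
    takes care of the end points. *)
Lemma le_increment f g df dg a b : a <= b ->
  {within `[a, b], continuous f} -> {within `[a, b], continuous g} ->
  (forall x, x \in `]a, b[ -> is_derive x 1 f (df x)) ->
  (forall x, x \in `]a, b[ -> is_derive x 1 g (dg x)) ->
  (forall x, x \in `]a, b[ -> df x <= dg x) ->
  f b - f a <= g b - g a.
Proof.
move=> ab cf cg df' dg' fg; rewrite le_eqVlt in ab.
case/orP: ab => [/eqP ->|ab]; first by rewrite !subrr.
have [||c cab] := @MVT _ (g \- f) (dg \- df) a b ab.
- by move=> x xab; apply: is_deriveB; [exact: dg'|exact: df'].
- by move=> x; apply: cvgB; [exact: cg|exact: cf].
have : 0 <= (dg \- df) c * (b - a).
  by rewrite mulr_ge0 ?subr_ge0 ?fg// ltW.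
by move=> + E; rewrite -E /=; lra.
Qed.

Lemma norm_increment_le f g df dg a b : a <= b ->
  {within `[a, b], continuous f} -> {within `[a, b], continuous g} ->
  (forall x, x \in `]a, b[ -> is_derive x 1 f (df x)) ->
  (forall x, x \in `]a, b[ -> is_derive x 1 g (dg x)) ->
  (forall x, x \in `]a, b[ -> `|df x| <= dg x) ->
  `|f b - f a| <= g b - g a.
Proof.
move=> ab cf cg df' dg' fg; rewrite ler_norml; apply/andP; split.
  have := @le_increment (fun x => - f x) g (fun x => - df x) dg a b ab.
  move=> /(_ _ cg _ dg' _); rewrite opprK lerNl => H.
  have {H} : - f b + f a <= g b - g a.
    apply: H.
    - by move=> x; apply: cvgN; exact: cf.
    - by move=> x xab; apply: is_deriveN; exact: df'.
    - by move=> x xab; have := fg x xab; rewrite ler_norml => /andP[+ _]; lra.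
  by lra.
apply: (le_increment ab cf cg df' dg') => x xab.
by have := fg x xab; rewrite ler_norml => /andP[].
Qed.

Lemma norm_increment_le_cst f df a b c : a <= b ->
  {within `[a, b], continuous f} ->
  (forall x, x \in `]a, b[ -> is_derive x 1 f (df x)) ->
  (forall x, x \in `]a, b[ -> `|df x| <= c) ->
  `|f b - f a| <= c * (b - a).
Proof.
move=> ab cf df' fc.
have := @norm_increment_le f (fun x => c * x) df (fun=> c) a b ab cf.
rewrite -mulrBr; apply => //.
- by apply: continuous_subspaceT => x; apply: cvgM; [exact: cvg_cst|exact: cvg_id].
- by move=> x _; apply: is_derive_eq; rewrite /GRing.scale/= mulr1.
Qed.

Lemma is_derive_expRM (l x : R) a :
  is_derive x 1 (fun s => expR (l * (s - a))) (l * expR (l * (x - a))).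
Proof.
apply: is_derive_eq; rewrite /GRing.scale/=; ring.
Qed.

End MeanValue.

(* A weighted supremum replaces the usual integration of Gronwall's inequality. *)
Lemma weighted_sup_bound (R : realType) (g : R -> R) (a b k l : R) : a <= b ->
  0 <= k -> 0 <= l ->
  (exists M, forall s, a <= s <= b -> g s <= M) ->
  (forall s, a <= s <= b -> 0 <= g s) ->
  (forall N, 0 <= N -> (forall s, a <= s <= b -> g s <= N * expR (l * (s - a))) ->
    forall s, a <= s <= b -> g s <= k + N / 2 * expR (l * (s - a))) ->
  forall s, a <= s <= b -> g s <= 2 * k * expR (l * (s - a)).
Proof.
move=> ab k0 l0 [M gM] g0 H.
have e1 s : a <= s <= b -> 1 <= expR (l * (s - a)).
  move=> /andP[as_ _]; rewrite -expR0 ler_expR mulr_ge0// subr_ge0//.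
set A := [set g s * expR (- (l * (s - a))) | s in [set s | a <= s <= b]].
have ubM : ubound A `|M|.
  move=> _ [s /= sab <-]; rewrite expRN -/(_ / _).
  rewrite ler_pdivrMr ?expR_gt0//.
  rewrite (le_trans (gM _ sab))// (le_trans (ler_norm _))// ler_peMr//.
  exact: e1.
have hsA : has_sup A.
  by split; [exists (g a * expR (- (l * (a - a)))), a => //=; rewrite lexx|exists `|M|].
set N := sup A.
have gN s : a <= s <= b -> g s <= N * expR (l * (s - a)).
  move=> sab; rewrite -ler_pdivrMr ?expR_gt0// -expRN.
  by apply: sup_upper_bound => //; exists s.
have aab : a <= a <= b by rewrite lexx.
have N0 : 0 <= N.
  have := gN a aab; rewrite subrr mulr0 expR0 mulr1; apply: le_trans; exact: g0.
(* The hypothesis improves the optimal bound [N] itself; as [N] is finite, the resulting inequality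
   can be solved for it. *)
have Nk : N <= k + N / 2.
  apply: ge_sup => [|_ [s /= sab <-]]; first by case: hsA.
  rewrite expRN -/(_ / _) ler_pdivrMr ?expR_gt0//.
  rewrite (le_trans (H N N0 gN s sab))// mulrDl lerD2r ler_peMr//.
  exact: e1.
move=> s sab; apply: le_trans (gN s sab) _.
rewrite ler_wpM2r ?expR_ge0//; lra.
Qed.

Section EpsilonDelta.
Context {R : realType}.

Lemma within_continuous_eps (f : R -> R) (A : set R) :
  (forall s, A s -> forall e : R, 0 < e -> \forall r \near s, A r -> `|f r - f s| <= e) ->
  {within A, continuous f}.
Proof.
move=> H; apply/subspace_continuousP => s As.
apply/cvgrPdist_le => e e0; have := H s As e e0.
by apply: filterS => r /= Hr Ar; rewrite distrC; exact: Hr.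
Qed.

Lemma is_derive_eps (f : R -> R) (s df : R) :
  (forall e : R, 0 < e -> \forall r \near s, `|f r - f s - (r - s) * df| <= e * `|r - s|) ->
  is_derive s 1 f df.
Proof.
move=> H.
have C : h^-1 *: (f (h *: 1 + s) - f s) @[h --> 0^'] --> df.
  apply/cvgrPdist_le => e e0; have /nbhs0P Hn := H e e0.
  rewrite /dnbhs near_withinE; near=> h => hn0.
  have : `|f (s + h) - f s - (s + h - s) * df| <= e * `|s + h - s|.
    by near: h; exact: Hn.
  rewrite /GRing.scale /= mulr1 (addrC s) addrK => Hh.
  have -> : df - h^-1 * (f (h + s) - f s) = - (h^-1 * (f (h + s) - f s - h * df)).
    by rewrite [in RHS]mulrBr mulKf// opprB.
  rewrite normrN normrM normrV ?unitfE// ler_pdivrMl ?normr_gt0// [leRHS]mulrC.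
  exact: Hh.
apply: DeriveDef; first by apply/cvg_ex; exists df.
exact: cvg_lim C.
Unshelve. all: by end_near.
Qed.

End EpsilonDelta.

Section LinearEntries.
Context {R : pzRingType} {m n : nat}.
Implicit Types A B : 'M[R]_(m, n).

Lemma addmxE A B i j : (A + B) i j = A i j + B i j. Proof. by rewrite mxE. Qed.

Lemma oppmxE A i j : (- A) i j = - A i j. Proof. by rewrite mxE. Qed.

Lemma scalemxE k A i j : (k *: A) i j = k * A i j. Proof. by rewrite mxE. Qed.

Definition linmxE := (addmxE, oppmxE, scalemxE).

End LinearEntries.

Section OperatorNormBounds.
Context {R : realType} {n : nat}.
Implicit Types (A : 'M[R]_n) (v : 'cV[R]_n).

Lemma norm_le_norm2 v : `|v| <= norm2 v.
Proof.
apply: mx_norm_le => [|i j]; first exact: sqrtr_ge0.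
rewrite ord1 -sqrtr_sqr ler_sqrt ?sumr_ge0// => [|k _]; last exact: sqr_ge0.
by rewrite (bigD1 i)//= lerDl sumr_ge0// => k _; exact: sqr_ge0.
Qed.

Lemma norm2_le_norm v : norm2 v <= Num.sqrt n%:R * `|v|.
Proof.
rewrite -[X in _ * X](ger0_norm (normr_ge0 v)) -sqrtr_sqr -sqrtrM// ler_sqrt//.
  rewrite (@le_trans _ _ (\sum_(i < n) `|v| ^+ 2))//; last first.
    by rewrite sumr_const card_ord mulr_natl.
  apply: ler_sum => i _; rewrite -real_normK ?num_real//.
  by rewrite lerXn2r// ?nnegrE// ler_mx_entry.
Qed.

Lemma opnorm_ubound A v : norm2 v <= 1 ->
  norm2 (A *m v) <= Num.sqrt n%:R * n%:R * `|A|.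
Proof.
move=> v1; apply: le_trans (norm2_le_norm _) _.
rewrite -mulrA ler_wpM2l ?sqrtr_ge0// (le_trans (norm_mulmx _ _))//.
rewrite ler_piMr ?mulr_ge0//; exact: le_trans (norm_le_norm2 _) v1.
Qed.

Lemma opnorm_le_norm A : opnorm A <= Num.sqrt n%:R * n%:R * `|A|.
Proof.
apply: ge_sup.
  exists (norm2 (A *m 0)), 0 => //=.
  by rewrite /norm2 big1 ?sqrtr0// => i _; rewrite mxE expr0n.
by move=> _ [v /= v1 <-]; exact: opnorm_ubound.
Qed.

Lemma norm2_mulmx_le_opnorm A v : norm2 v <= 1 -> norm2 (A *m v) <= opnorm A.
Proof.
move=> v1; apply: sup_upper_bound; last by exists v.
split; first by exists (norm2 (A *m v)), v.
exists (Num.sqrt n%:R * n%:R * `|A|) => _ [u /= u1 <-]; exact: opnorm_ubound.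
Qed.

Lemma norm_le_opnorm A : `|A| <= opnorm A.
Proof.
have norm20 : @norm2 R n 0 = 0.
  by rewrite /norm2 big1 ?sqrtr0// => i _; rewrite mxE expr0n.
apply: mx_norm_le => [|i j].
  have := @norm2_mulmx_le_opnorm A 0; rewrite norm20 ler01 => /(_ isT).
  exact: le_trans (sqrtr_ge0 _).
apply: le_trans (norm2_mulmx_le_opnorm A (v := delta_mx j 0) _); last first.
  rewrite /norm2 (bigD1 j)//= big1 => [|k kj]; rewrite mxE ?eqxx ?(negbTE kj)/=.
    by rewrite expr1n addr0 sqrtr1.
  by rewrite expr0n.
apply: le_trans (norm_le_norm2 _); apply: le_trans (ler_mx_entry _ i 0).
by rewrite -colE mxE.
Qed.

End OperatorNormBounds.

Section HalfSpaceC1.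
Context {R : realType} {d : nat}.
Implicit Types (a : 'cV[R]_d.+1 -> 'cV[R]_d.+1) (Da : 'cV[R]_d.+1 -> 'M[R]_d.+1).

Lemma halfspace_segment (x z : 'cV[R]_d.+1) (th : R) : halfspace x -> halfspace z ->
  0 <= th <= 1 -> halfspace (x + th *: (z - x)).
Proof.
rewrite /halfspace /= !mxE => x0 z0 /andP[t0 t1].
rewrite mulrBr addrCA addrC.
by have := mulr_ge0 (_ : 0 <= 1 - th) x0; have := mulr_ge0 t0 z0; lra.
Qed.

(** Mean value inequality for [a - M] along the segment, which convexity keeps in the half-space.
    The matrix [M] is free: [M = 0] gives the Lipschitz bound, and the derivative at a point of the
    path gives the first-order remainder. *)
Lemma C1_remainder a Da (M : 'M[R]_d.+1) x z (c : R) : 0 <= c ->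
  (forall y, halfspace y -> is_diff_in halfspace a y (mulmx (Da y))) ->
  halfspace x -> halfspace z ->
  (forall th : R, 0 <= th <= 1 -> `|Da (x + th *: (z - x)) - M| <= c) ->
  `|a z - a x - M *m (z - x)| <= d.+1%:R * c * `|z - x|.
Proof.
move=> c0 aD hx hz.
have [v vE] : exists v, v = z - x by exists (z - x).
have seg (th : R) : 0 <= th <= 1 -> halfspace (x + th *: v).
  by rewrite vE; exact: halfspace_segment.
rewrite -vE => Dc.
apply: mx_norm_le => [|i j]; first by rewrite !mulr_ge0.
rewrite ord1 {j}.
pose f (th : R) := (a (x + th *: v) - M *m (x + th *: v)) i 0.
pose df (th : R) := ((Da (x + th *: v) - M) *m v) i 0.
have key (s : R) : 0 <= s <= 1 -> forall e : R, 0 < e -> \forall r \near s,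
    0 <= r <= 1 -> `|f r - f s - (r - s) * df s| <= e * `|r - s|.
  move=> s01 e e0.
  have e'0 : 0 < e / (`|v| + 1) by rewrite divr_gt0// ltr_wpDl.
  have := aD _ (seg s s01) _ e'0; rewrite near_withinE => H.
  have cv : (x + r *: v) @[r --> s] --> x + s *: v.
    by apply: cvgD; [exact: cvg_cst|apply: cvgZr_tmp; exact: cvg_id].
  have {}H : \forall r \near s, halfspace (x + r *: v) ->
      `|a (x + r *: v) - a (x + s *: v) -
        Da (x + s *: v) *m (x + r *: v - (x + s *: v))| <=
      e / (`|v| + 1) * `|x + r *: v - (x + s *: v)| by exact: cv _ H.
  apply: filterS H => r Hr r01.
  have := Hr (seg r r01).
  have -> : x + r *: v - (x + s *: v) = (r - s) *: v.
    by rewrite opprD addrACA subrr add0r scalerBl.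
  move=> {}Hr.
  have -> : f r - f s - (r - s) * df s =
     (a (x + r *: v) - a (x + s *: v) - Da (x + s *: v) *m ((r - s) *: v)) i 0.
    rewrite /f /df mulmxBl !mulmxDr -!scalemxAr !linmxE. ring.
  apply: le_trans (ler_mx_entry _ _ _) _; apply: le_trans Hr _.
  rewrite normrZ mulrACA; apply: ler_piMr; first by rewrite mulr_ge0// ltW.
  by rewrite mulrC ler_pdivrMr ?ltr_wpDl// mul1r lerDl.
have cf : {within `[0, 1], continuous f}.
  apply: within_continuous_eps => s /=; rewrite in_itv/= => s01 e e0.
  have H := key s s01 1 ltr01.
  have H2 : \forall r \near s, `|r - s| <= e / (1 + `|df s|).
    have : 0 < e / (1 + `|df s|) by rewrite divr_gt0// ltr_pwDl.
    move=> e1; near=> r; rewrite distrC; near: r.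
    exact: (@cvgr_dist_le _ _ _ _ _ id s cvg_id _ e1).
  near=> r; rewrite in_itv /= => r01.
  have h1 : `|f r - f s - (r - s) * df s| <= 1 * `|r - s|.
    by move: r01; near: r.
  have h2 : `|r - s| <= e / (1 + `|df s|) by near: r.
  rewrite ler_pdivlMr ?ltr_pwDl// in h2.
  have -> : f r - f s = (f r - f s - (r - s) * df s) + (r - s) * df s by ring.
  apply: le_trans (ler_normD _ _) _; rewrite normrM.
  by move: h1 h2; rewrite mul1r mulrDr mulr1; lra.
have dfP (s : R) : s \in `]0, 1[ -> is_derive s 1 f (df s).
  move=> s01; apply: is_derive_eps => e e0.
  have s01' : 0 <= s <= 1 by move: s01; rewrite in_itv/= => /andP[/ltW -> /ltW ->].
  have H := key s s01' e e0.
  have H2 : \forall r \near s, r \in `]0, 1[ by exact: near_in_itvoo.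
  near=> r.
  have : r \in `]0, 1[ by near: r.
  rewrite in_itv/= => /andP[/ltW r0 /ltW r1].
  have : 0 <= r <= 1 by rewrite r0.
  by near: r.
have := @norm_increment_le_cst R f df 0 1 (d.+1%:R * c * `|v|) ler01 cf dfP.
rewrite subr0 mulr1.
have -> : f 1 - f 0 = (a z - a x - M *m v) i 0.
  rewrite /f !scale0r !scale1r !addr0 vE [x + _]addrC subrK mulmxBr !linmxE; ring.
apply => s; rewrite in_itv/= => /andP[/ltW s0 /ltW s1].
apply: le_trans (ler_mx_entry _ _ _) _; apply: le_trans (norm_mulmx _ _) _.
by rewrite ler_wpM2r// ler_wpM2l// Dc// s0 s1.
Unshelve. all: by end_near.
Qed.

Lemma C1_bounded_lipschitz a Da : C1_bounded a Da ->
  exists2 K : R, 0 < K &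
    (forall x, halfspace x -> `|Da x| <= K) /\
    (forall x y, halfspace x -> halfspace y -> `|a x - a y| <= K * `|x - y|).
Proof.
move=> [aD _ [C DaC]].
have Db x : halfspace x -> `|Da x| <= `|C|.
  move=> hx; apply: le_trans (norm_le_opnorm _) _.
  by apply: le_trans (DaC x hx) (ler_norm _).
(* One constant serves both bounds; the summand 1 keeps it positive, as later divisions by [K]
   require. *)
exists (d.+1%:R * `|C| + 1) => [|]; first by rewrite ltr_wpDl// mulr_ge0.
split=> [x hx|x y hx hy].
  apply: le_trans (Db x hx) _; rewrite -[leLHS]mul1r.
  by rewrite (@le_trans _ _ (d.+1%:R * `|C|)) ?lerDl// ler_wpM2r// ler1n.
have := @C1_remainder a Da 0 y x `|C| (normr_ge0 _) aD hy hx.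
rewrite mul0mx subr0 => H.
apply: le_trans (H _) _ => [th th01|]; last first.
  by rewrite ler_wpM2r// lerDl.
by rewrite subr0 Db//; exact: halfspace_segment.
Qed.

End HalfSpaceC1.

(** * Deterministic reflected paths *)

Section Clamp.
Context {R : realType}.

(** Paths are continuous on [[0, +oo[] only. Freezing them at their value at 0 on the left gives
    functions continuous on the whole line, to which compactness and closedness arguments apply
    directly. *)
Lemma continuous_clamp (T : topologicalType) (f : R -> T) :
  {within `[0, +oo[, continuous f} -> continuous (fun s : R => f (Num.max s 0)).
Proof.
move=> /subspace_continuousP cf s.
have m0 : Num.max s 0 \in `[0, +oo[ by rewrite in_itv/= andbT le_max lexx orbT.
apply: cvg_comp (cf _ m0).
have cm : Num.max r 0 @[r --> s] --> Num.max s 0.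
  by apply: continuous_max; [exact: cvg_id|exact: cvg_cst].
move=> P HP.
have {}HP : \forall r \near s, `[0, +oo[%classic (Num.max r 0) -> P (Num.max r 0).
  exact: cm _ HP.
apply: filterS HP => r /=; apply.
by rewrite in_itv/= andbT le_max lexx orbT.
Qed.

Lemma last_zero_in (f : R -> R) (a b : R) : continuous f ->
  (exists2 r, a <= r <= b & f r = 0) ->
  exists r, [/\ a <= r <= b, f r = 0 & forall r', r < r' -> r' <= b -> f r' <> 0].
Proof.
move=> cf [r0 r0ab fr0].
set A := [set r | a <= r <= b] `&` f @^-1` [set 0].
have hA : has_sup A by split; [exists r0|exists b => r [/= /andP[]]].
have cA : closed A.
  apply: closedI; last by apply: preimage_closed => //; exact: closed_eq.
  have -> : [set r | a <= r <= b] = `[a, b]%classic by apply/seteqP; split=> r /=; rewrite in_itv.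
  exact: interval_closed.
have [sab fs] : A (sup A).
  by rewrite [X in X _](closure_id A).1//; apply: closure_sup; case: hA.
exists (sup A); split=> // r' sr' r'b fr'.
have : r' <= sup A.
  apply: sup_upper_bound => //; split=> //=.
  by case/andP: sab => h _; rewrite r'b (le_trans h)// ltW.
by rewrite leNgt sr'.
Qed.

Lemma first_zero_in (f : R -> R) (a b : R) : continuous f ->
  (exists2 r, a <= r <= b & f r = 0) ->
  exists r, [/\ a <= r <= b, f r = 0 & forall r', a <= r' -> r' < r -> f r' <> 0].
Proof.
move=> cf [r0 r0ab fr0].
have [||r [rab fr H]] := @last_zero_in (fun s : R => f (- s)) (- b) (- a).
- by move=> s; apply: continuous_comp; [exact: opp_continuous|exact: cf].
- by exists (- r0); [move: r0ab; lra|rewrite opprK].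
exists (- r); split=> // [|r' ar' r'r]; first by move: rab; lra.
by have := H (- r'); rewrite opprK; apply; lra.
Qed.

End Clamp.

(** The function [u] is not assumed to be an integral: [u s] is only bounded by [k] plus twice the
    oscillation of [J] over [[a, s]]. A reflected path offers no more, since its local time depends
    on the past through a running supremum. *)
Lemma gronwall (R : realType) n (u : R -> 'cV[R]_n) (J dJ : 'I_n -> R -> R)
    (a b K k e0 : R) : a <= b -> 0 < K -> 0 <= k -> 0 <= e0 ->
  (exists M, forall s, a <= s <= b -> `|u s| <= M) ->
  (forall i, {within `[a, b], continuous (J i)}) ->
  (forall i (s : R), s \in `]a, b[ -> is_derive s 1 (J i) (dJ i s)) ->
  (forall i (s : R), s \in `]a, b[ -> `|dJ i s| <= K * `|u s| + e0) ->
  (forall (s B : R), a <= s <= b -> 0 <= B ->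
    (forall (r : R) i, a <= r <= s -> `|J i r - J i a| <= B) -> `|u s| <= k + 2 * B) ->
  forall s, a <= s <= b -> `|u s| <= 2 * (k + 2 * (e0 * (b - a))) * expR (4 * K * (s - a)).
Proof.
move=> ab K0 k0 e00 bu cJ dJP dJb uJ.
have l0 : 0 <= 4 * K by rewrite mulr_ge0// ltW.
have ba : 0 <= e0 * (b - a) by rewrite mulr_ge0// subr_ge0.
apply: weighted_sup_bound => //; first by rewrite addr_ge0// mulr_ge0.
move=> N N0 uN s sab; set E := expR _.
have E1 (r : R) : a <= r <= b -> 1 <= expR (4 * K * (r - a)).
  by move=> /andP[ar rb]; rewrite -[leLHS]expR0 ler_expR mulr_ge0// subr_ge0.
(* The rate [4 * K] makes [N / 4] times the exponential a primitive of [K] times the assumed bound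
   on [u]; doubled, it is the [N / 2] that [weighted_sup_bound] asks for. *)
have : `|u s| <= k + 2 * (N / 4 * E + e0 * (b - a)); last by lra.
apply: uJ => // [|r i ras].
  by rewrite addr_ge0// mulr_ge0 ?expR_ge0// divr_ge0.
have rab : a <= r <= b by move: ras sab => /andP[-> rs] /andP[_]; exact: le_trans rs.
have [ar rb] := andP rab.
have sub x : x \in `]a, r[ -> x \in `]a, b[.
  by rewrite !in_itv/= => /andP[-> xr]; exact: lt_le_trans xr rb.
pose g x := N / 4 * expR (4 * K * (x - a)) + e0 * x.
pose dg x := N / 4 * (4 * K * expR (4 * K * (x - a))) + e0.
have gP (x : R) : is_derive x 1 g (dg x).
  have D := @is_derive_expRM R (4 * K) x a.
  by apply: is_derive_eq; rewrite /GRing.scale/= mulr1.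
have h1 : {within `[a, r], continuous (J i)}.
  by apply: continuous_subspaceW (cJ i) => x /=; rewrite !in_itv/= => /andP[-> xr]; exact: le_trans xr rb.
have h2 : {within `[a, r], continuous g}.
  apply: continuous_subspaceT => x; apply: differentiable_continuous.
  by apply/derivable1_diffP; have [] := gP x.
have h3 x : x \in `]a, r[ -> is_derive x 1 (J i) (dJ i x).
  by move=> xar; apply: dJP; exact: sub.
have h5 x : x \in `]a, r[ -> `|dJ i x| <= dg x.
  move=> xar; apply: le_trans (dJb _ _ (sub _ xar)) _; rewrite lerD2r.
  have xab : a <= x <= b by have := sub _ xar; rewrite in_itv/= => /andP[/ltW -> /ltW ->].
  have -> : N / 4 * (4 * K * expR (4 * K * (x - a))) = K * (N * expR (4 * K * (x - a))).
    by field.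
  by rewrite ler_wpM2l// ?uN// ltW.
have H := norm_increment_le ar h1 h2 h3 (fun x _ => gP x) h5.
apply: le_trans H _.
rewrite /g subrr mulr0 expR0 mulr1.
have N4 : 0 <= N / 4 by rewrite divr_ge0.
have : N / 4 * expR (4 * K * (r - a)) <= N / 4 * E.
  rewrite ler_wpM2l// ler_expR ler_wpM2l// lerD2r.
  by case/andP: ras.
have : e0 * (r - a) <= e0 * (b - a) by rewrite ler_wpM2l// lerD2r.
by lra.
Qed.

Section ReflectedPath.
Context {R : realType} {d : nat}.
Variables (a : 'cV[R]_d.+1 -> 'cV[R]_d.+1) (K : R).
Hypothesis K0 : 0 < K.
Hypothesis lip : forall x y, halfspace x -> halfspace y -> `|a x - a y| <= K * `|x - y|.

Definition drift (p : R -> 'cV[R]_d.+1) (i : 'I_d.+1) (s : R) : R :=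
  \int[lebesgue_measure]_(r in `[0, s]) (a (p r) i 0).

Variables (w : R -> 'cV[R]_d.+1) (x : 'cV[R]_d.+1) (p : R -> 'cV[R]_d.+1) (l : R -> R).
Hypothesis sol : reflected_solution a w x p l.

Let pos (s : R) := p (Num.max s 0).

Lemma clamped_path_continuous : continuous (fun s : R => p (Num.max s 0)).
Proof. exact: continuous_clamp (refl_continuous sol). Qed.

Lemma clamped_entry_continuous (i : 'I_d.+1) : continuous (fun s : R => p (Num.max s 0) i 0).
Proof.
move=> s; apply: (@continuous_comp _ _ _ pos (fun u : 'cV[R]_d.+1 => u i 0)).
  exact: clamped_path_continuous.
exact: coord_continuous.
Qed.

Lemma clamped_halfspace (s : R) : halfspace (pos s).
Proof. by apply: (refl_halfspace sol); rewrite le_max lexx orbT. Qed.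

Lemma clamped_drift_continuous (i : 'I_d.+1) : continuous (fun s : R => a (pos s) i 0).
Proof.
move=> s; apply/cvgrPdist_le => e e0.
have eK : 0 < e / K by rewrite divr_gt0.
have /cvgrPdist_le /(_ _ eK) := @clamped_path_continuous s.
apply: filterS => r; rewrite ler_pdivlMr// => H.
have := @ler_mx_entry R _ _ (a (pos s) - a (pos r)) i 0; rewrite !linmxE => /le_trans; apply.
apply: le_trans (lip (clamped_halfspace s) (clamped_halfspace r)) _.
by rewrite mulrC.
Qed.

Lemma driftE i (s : R) : drift p i s = \int[lebesgue_measure]_(r in `[0, s]) (a (pos r) i 0).
Proof.
apply: eq_Rintegral => r; rewrite inE/= in_itv/= => /andP[r0 _].
by rewrite /pos max_l.
Qed.

Lemma drift_integrable i (s : R) :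
  lebesgue_measure.-integrable `[0, s] (EFin \o (fun r => a (pos r) i 0)).
Proof.
apply: continuous_compact_integrable; first exact: segment_compact.
by apply: continuous_subspaceT; exact: clamped_drift_continuous.
Qed.

Lemma drift_continuous i (s t : R) : 0 <= s -> s <= t ->
  {within `[s, t], continuous (drift p i)}.
Proof.
move=> s0 st.
have -> : drift p i = (fun t => \int[lebesgue_measure]_(r in `[0, t]) (a (pos r) i 0)).
  by apply/funext => r; exact: driftE.
have := parameterized_integral_continuous (le_trans s0 st) (drift_integrable i t).
apply: continuous_subspaceW => r /=; rewrite !in_itv/= => /andP[sr ->].
by rewrite (le_trans s0 sr).
Qed.

Lemma drift_derive i (s : R) : 0 < s -> is_derive s 1 (drift p i) (a (p s) i 0).
Proof.
move=> s0.
have -> : drift p i = (fun t => \int[lebesgue_measure]_(r in `[0, t]) (a (pos r) i 0)).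
  by apply/funext => t; exact: driftE.
have ss : s < s + 1 by rewrite ltrDl.
have [] := @continuous_FTC1_closed R (fun r => a (pos r) i 0) 0 s (s + 1) ss
  (drift_integrable i (s + 1)) s0 (@clamped_drift_continuous i s).
rewrite derive1E /pos max_l ?ltW// => D <-.
Qed.

Lemma drift0 i : drift p i 0 = 0.
Proof. by rewrite /drift set_itv1 Rintegral_set1. Qed.

Lemma path_eq s i : 0 <= s ->
  p s i 0 = x i 0 + drift p i s + w s i 0 + (i == ord_max)%:R * l s.
Proof.
by move=> s0; rewrite (refl_equation sol i s0) /normal_vec mxE eqxx andbT.
Qed.

Lemma local_ge0 s : 0 <= s -> 0 <= l s.
Proof. by move=> s0; rewrite -(refl_local0 sol) (refl_local_nondecreasing sol). Qed.

Lemma normal_coord_ge0 s : 0 <= s -> 0 <= p s ord_max 0.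
Proof. exact: (refl_halfspace sol). Qed.

(** The support condition writes [l t] and [l s] as integrals of the same boundary indicator over
    [[0, t]] and [[0, s]]. The indicator vanishes on []s, t]], so after extension by 0 the two
    integrands coincide. *)
Lemma local_constant (s t : R) : 0 <= s -> s <= t ->
  (forall r, s < r -> r <= t -> p r ord_max 0 <> 0) -> l t = l s.
Proof.
move=> s0 st nz; have t0 := le_trans s0 st.
have [F [_ H]] := refl_local_support sol.
apply: EFin_inj; rewrite -(H t t0) -(H s s0) integral_mkcond [in RHS]integral_mkcond.
congr (integral _ _ _); apply/funext => r; rewrite !patchE.
have [/= r1|r1] := boolP (r \in _); have [r2|r2] := boolP (r \in _) => //=.
- move: r1 r2; rewrite !inE/= !in_itv/= => /andP[r0 rt]; rewrite notin_setE /= in_itv/= r0/=.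
  move=> /negP; rewrite -ltNge => sr.
  by rewrite indicE memNset//= => bd; exact: (nz r).
- move: r1; rewrite notin_setE/= in_itv/=.
  move: r2; rewrite inE/= in_itv/= => /andP[-> rs].
  by rewrite (le_trans rs st).
Qed.

(* The local time at [t] was gained at the last zero before [t]. *)
Lemma last_zero_or_constant (s t : R) : 0 <= s -> s <= t ->
  (exists r, [/\ s <= r <= t, p r ord_max 0 = 0, l r = l t &
    forall r', r < r' -> r' <= t -> p r' ord_max 0 <> 0]) \/
  (l t = l s /\ forall r, s <= r <= t -> p r ord_max 0 <> 0).
Proof.
move=> s0 st.
have [[r rst pr]|H] := pselect (exists2 r, s <= r <= t & p r ord_max 0 = 0).
  left; have pos_r r' : s <= r' -> pos r' = p r'.
    by move=> sr'; rewrite /pos max_l// (le_trans s0).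
  have [|r0 [r0st pr0 nz]] := @last_zero_in R (fun r => pos r ord_max 0) s t
    (@clamped_entry_continuous ord_max).
    by exists r => //; rewrite pos_r//; case/andP: rst.
  have [sr0 r0t] := andP r0st.
  have nz' r' : r0 < r' -> r' <= t -> p r' ord_max 0 <> 0.
    move=> h1 h2; rewrite -pos_r; first exact: nz.
    by rewrite (le_trans sr0)// ltW.
  exists r0; split=> //; first by rewrite -pos_r.
  by apply/esym/local_constant => //; exact: le_trans sr0.
have nz (r : R) : s <= r <= t -> p r ord_max 0 <> 0 by move=> h1 h2; apply: H; exists r.
right; split=> //; apply: local_constant => // r sr rt.
by apply: nz; rewrite ltW.
Qed.

End ReflectedPath.

(** * Comparison of two reflected solutions *)

Section CompareSolutions.
Context {R : realType} {d : nat}.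
Variables (a : 'cV[R]_d.+1 -> 'cV[R]_d.+1) (K : R).
Hypothesis K0 : 0 < K.
Hypothesis lip : forall x y, halfspace x -> halfspace y -> `|a x - a y| <= K * `|x - y|.

Lemma drift_increment_le w x p l (i : 'I_d.+1) (s t M : R) :
  reflected_solution a w x p l -> 0 <= s -> s <= t ->
  (forall r, s <= r <= t -> `|a (p r)| <= M) ->
  `|drift a p i t - drift a p i s| <= M * (t - s).
Proof.
move=> sol s0 st H; have t0 := le_trans s0 st.
apply: (@norm_increment_le_cst R (drift a p i) (fun r => a (p r) i 0)) => //.
- exact: (@drift_continuous _ _ _ _ K0 lip _ _ _ _ sol i s t s0 st).
- move=> r; rewrite in_itv/= => /andP[sr rt].
  exact: (drift_derive K0 lip sol _ (le_lt_trans s0 sr)).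
- move=> r; rewrite in_itv/= => /andP[sr rt].
  by apply: le_trans (ler_mx_entry _ _ _) _; apply: H; rewrite !ltW.
Qed.

Variables (w w' : R -> 'cV[R]_d.+1) (x x' : 'cV[R]_d.+1).
Variables (p p' : R -> 'cV[R]_d.+1) (l l' : R -> R).
Hypothesis sol : reflected_solution a w x p l.
Hypothesis sol' : reflected_solution a w' x' p' l'.

Let J i s := drift a p i s - drift a p' i s.

Lemma drift_diff_continuous i (s t : R) : 0 <= s -> s <= t ->
  {within `[s, t], continuous (J i)}.
Proof.
move=> s0 st r.
have h1 := @drift_continuous _ _ _ _ K0 lip _ _ _ _ sol i s t s0 st r.
have h2 := @drift_continuous _ _ _ _ K0 lip _ _ _ _ sol' i s t s0 st r.
exact: cvgB h1 h2.
Qed.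

Lemma drift_diff_derive i (s : R) : 0 < s ->
  is_derive s 1 (J i) (a (p s) i 0 - a (p' s) i 0).
Proof.
move=> s0; apply: is_deriveB.
- exact: (drift_derive K0 lip sol).
- exact: (drift_derive K0 lip sol').
Qed.

Lemma drift_diff_derive_le i (s : R) : 0 <= s ->
  `|a (p s) i 0 - a (p' s) i 0| <= K * `|p s - p' s|.
Proof.
move=> s0; have := ler_mx_entry (a (p s) - a (p' s)) i 0; rewrite !linmxE => /le_trans; apply.
by apply: lip; [exact: (refl_halfspace sol)|exact: (refl_halfspace sol')].
Qed.

Lemma drift_diff_increment_le i (s t c : R) : 0 <= s -> s <= t ->
  (forall r, s <= r <= t -> `|p r - p' r| <= c) ->
  `|J i t - J i s| <= K * c * (t - s).
Proof.
move=> s0 st H.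
apply: (@norm_increment_le_cst R (J i) (fun r => a (p r) i 0 - a (p' r) i 0)) => //.
- exact: drift_diff_continuous.
- move=> r; rewrite in_itv/= => /andP[sr rt].
  exact: drift_diff_derive (le_lt_trans s0 sr).
- move=> r; rewrite in_itv/= => /andP[sr rt].
  apply: le_trans (drift_diff_derive_le _ _) _; first by rewrite (le_trans s0)// ltW.
  by rewrite ler_pM2l// H// !ltW.
Qed.

Lemma path_diff_bounded (s t : R) : 0 <= s -> s <= t ->
  exists M : R, forall r, s <= r <= t -> `|p r - p' r| <= M.
Proof.
move=> s0 st.
have [|c _ H] := @EVT_max R (fun r => `|p (Num.max r 0) - p' (Num.max r 0)|) s t st.
  apply: continuous_subspaceT => r; apply: cvg_norm; apply: cvgB.
  - exact: clamped_path_continuous sol r.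
  - exact: clamped_path_continuous sol' r.
exists `|p (Num.max c 0) - p' (Num.max c 0)| => r srt.
have r0 : 0 <= r by case/andP: srt => sr _; exact: le_trans sr.
by have := H r; rewrite in_itv/= => /(_ srt); rewrite (max_l r0).
Qed.

(** The Lipschitz property of the Skorokhod reflection map. At the last zero [r] of one path before
    [s], its local time is minus its unreflected part, hence exceeds the other local time by at most
    [B], the other path being nonnegative at [r]. Monotonicity carries this to [s]. If there is no
    zero, the first local time is still 0. *)
Lemma local_diff_le (s B : R) : 0 <= s -> 0 <= B ->
  (forall r, 0 <= r <= s ->
    `|(p r ord_max 0 - l r) - (p' r ord_max 0 - l' r)| <= B) ->
  `|l s - l' s| <= B.
Proof.
have half w1 x1 p1 l1 w2 x2 p2 l2 : reflected_solution a w1 x1 p1 l1 ->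
    reflected_solution a w2 x2 p2 l2 -> 0 <= s -> 0 <= B ->
    (forall r, 0 <= r <= s ->
      `|(p1 r ord_max 0 - l1 r) - (p2 r ord_max 0 - l2 r)| <= B) ->
    l1 s - l2 s <= B.
  move=> s1 s2 s0 B0 H.
  have [[r [rs pr <- _]]|[-> _]] := last_zero_or_constant s1 (lexx 0) s0.
    have [r0 rs'] := andP rs.
    have := H r rs; rewrite pr ler_norml => /andP[h1 h2].
    have := refl_local_nondecreasing s2 r0 rs'.
    have := normal_coord_ge0 s2 r0.
    by lra.
  have := refl_local0 s1; have := local_ge0 s2 s0; lra.
move=> s0 B0 H; rewrite ler_norml; apply/andP; split; last exact: half sol sol' _ _ H.
have := half _ _ _ _ _ _ _ _ sol' sol s0 B0.
suff h : forall r, 0 <= r <= s ->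
    `|(p' r ord_max 0 - l' r) - (p r ord_max 0 - l r)| <= B.
  by move=> /(_ h); lra.
by move=> r rs; rewrite distrC; exact: H.
Qed.

(** The unreflected parts differ by [|x - x'| + e] plus the oscillation of the drift difference, and
    by [local_diff_le] the local times differ by no more; adding both explains the factor 2 in
    [gronwall]. Two different noises are allowed in order to compare two outcomes; equal noises give
    the Lipschitz property of the flow. *)
Lemma solution_lipschitz (T e : R) : 0 <= T ->
  (forall s, 0 <= s <= T -> `|w s - w' s| <= e) ->
  forall s, 0 <= s <= T ->
    `|p s - p' s| <= 4 * (`|x - x'| + e) * expR (4 * K * s).
Proof.
move=> T0 we.
have e0 : 0 <= e.
  by apply: le_trans (we 0 _); rewrite ?normr_ge0// lexx.
have k0 : 0 <= 2 * (`|x - x'| + e) by rewrite mulr_ge0// addr_ge0.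
have Jder i s : s \in `]0, T[ -> is_derive s 1 (J i) (a (p s) i 0 - a (p' s) i 0).
  by rewrite in_itv/= => /andP[s0 _]; exact: drift_diff_derive.
have Jle i s : s \in `]0, T[ -> `|a (p s) i 0 - a (p' s) i 0| <= K * `|p s - p' s| + 0.
  by rewrite in_itv/= addr0 => /andP[s0 _]; apply: drift_diff_derive_le; rewrite ltW.
have H := @gronwall R d.+1 (fun s => p s - p' s) J
  (fun i s => a (p s) i 0 - a (p' s) i 0) 0 T K (2 * (`|x - x'| + e)) 0 T0 K0 k0 (lexx 0)
  (path_diff_bounded (lexx 0) T0) (fun i => @drift_diff_continuous i 0 T (lexx 0) T0) Jder Jle.
move=> s sT; rewrite -[X in expR (_ * X)]subr0.
apply: le_trans (H _ s sT) _; last by rewrite mul0r mulr0 addr0 mulrA -natrM.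
move=> {sT}s B sT B0 JB; have [s0 sT'] := andP sT.
have zB r i : 0 <= r <= s ->
    `|(p r i 0 - (i == ord_max)%:R * l r) - (p' r i 0 - (i == ord_max)%:R * l' r)|
    <= `|x - x'| + e + B.
  move=> /andP[r0 rs].
  rewrite (path_eq sol i r0) (path_eq sol' i r0).
  have -> : x i 0 + drift a p i r + w r i 0 + (i == ord_max)%:R * l r -
     (i == ord_max)%:R * l r - (x' i 0 + drift a p' i r + w' r i 0 +
     (i == ord_max)%:R * l' r - (i == ord_max)%:R * l' r) =
     (x - x') i 0 + (w r - w' r) i 0 + (J i r - J i 0).
    by rewrite /J /= (drift0 a p) (drift0 a p') !linmxE; ring.
  apply: le_trans (ler_normD _ _) _; apply: lerD; last by apply: JB; rewrite r0.
  apply: le_trans (ler_normD _ _) _; apply: lerD; first exact: ler_mx_entry.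
  apply: le_trans (ler_mx_entry _ _ _) _; apply: we.
  by rewrite r0 (le_trans rs).
have B'0 : 0 <= `|x - x'| + e + B by rewrite !addr_ge0.
have lB : `|l s - l' s| <= `|x - x'| + e + B.
  apply: local_diff_le => // r rs.
  by have := zB r ord_max rs; rewrite eqxx !mul1r.
apply: mx_norm_le => [|i j]; first by rewrite addr_ge0// mulr_ge0.
rewrite ord1 !linmxE.
have ss : 0 <= s <= s by rewrite s0 lexx.
have := zB s i ss; case: (i == ord_max); rewrite ?mul1r ?mul0r ?subr0 => h.
  have -> : p s i 0 - p' s i 0 =
    (p s i 0 - l s - (p' s i 0 - l' s)) + (l s - l' s) by ring.
  by apply: le_trans (ler_normD _ _) _; lra.
by lra.
Qed.

(** With frozen local times only the noise increments after [s] enter. Two outcomes can thus be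
    compared beyond an interval on which their noises are not known to be close. *)
Lemma unreflected_diff_le (s t e : R) : 0 <= s -> s <= t -> 
  (forall r, s <= r <= t -> l r = l s) -> (forall r, s <= r <= t -> l' r = l' s) ->
  (forall r, s <= r <= t -> `|(w r - w s) - (w' r - w' s)| <= e) ->
  forall r, s <= r <= t ->
    `|p r - p' r| <= 2 * (`|p s - p' s| + e) * expR (4 * K * (r - s)).
Proof.
move=> s0 st lc lc' we.
have e0 : 0 <= e by apply: le_trans (we s _); rewrite ?normr_ge0// lexx.
have k0 : 0 <= `|p s - p' s| + e by rewrite addr_ge0.
have Jder i r : r \in `]s, t[ -> is_derive r 1 (J i) (a (p r) i 0 - a (p' r) i 0).
  by rewrite in_itv/= => /andP[sr _]; apply: drift_diff_derive; exact: le_lt_trans sr.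
have Jle i r : r \in `]s, t[ -> `|a (p r) i 0 - a (p' r) i 0| <= K * `|p r - p' r| + 0.
  rewrite in_itv/= addr0 => /andP[sr _]; apply: drift_diff_derive_le.
  by rewrite (le_trans s0)// ltW.
have H := @gronwall R d.+1 (fun s => p s - p' s) J
  (fun i s => a (p s) i 0 - a (p' s) i 0) s t K (`|p s - p' s| + e) 0 st K0 k0 (lexx 0)
  (path_diff_bounded s0 st) (fun i => @drift_diff_continuous i s t s0 st) Jder Jle.
move=> r srt.
apply: le_trans (H _ r srt) _; last by rewrite mul0r mulr0 addr0.
move=> {srt}r B srt B0 JB; have [sr rt] := andP srt.
have r0 := le_trans s0 sr.
apply: mx_norm_le => [|i j]; first by rewrite !addr_ge0// mulr_ge0.
rewrite ord1 !linmxE.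
have -> : p r i 0 - p' r i 0 = (p s - p' s) i 0 + ((w r - w s) - (w' r - w' s)) i 0
    + (J i r - J i s).
  rewrite !linmxE (path_eq sol i r0) (path_eq sol' i r0) (path_eq sol i s0) (path_eq sol' i s0).
  by rewrite lc ?lc'// /J; ring.
have := JB r i; rewrite sr lexx => /(_ isT) h.
have := ler_mx_entry (p s - p' s) i 0.
have := ler_mx_entry ((w r - w s) - (w' r - w' s)) i 0.
have h1 := we r srt; move=> h2 h3.
apply: le_trans (ler_normD _ _) _; apply: le_trans (lerD (ler_normD _ _) h) _.
by lra.
Qed.

End CompareSolutions.

(** * Concentration from independence *)

Section NormalIncrements.
Context {R : realType}.

Lemma normal_peak_le (s : R) : 0 < s -> normal_peak s <= s^-1.
Proof.
move=> s0; rewrite /normal_peak lef_pV2 ?posrE//; last first.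
  by rewrite sqrtr_gt0 mulrn_wgt0// mulr_gt0 ?pi_gt0// exprn_gt0.
rewrite -[leLHS](gtr0_norm s0) -sqrtr_sqr ler_sqrt//.
  rewrite -mulrnAr ler_peMr ?sqr_ge0//.
  by have := pi_ge2 R; rewrite mulr2n; lra.
by rewrite mulrn_wge0// mulr_ge0 ?sqr_ge0 ?pi_ge0.
Qed.

Lemma normal_prob_itv_le (s a b : R) : 0 < s -> a <= b ->
  (normal_prob 0 s `[a, b]%classic <= ((b - a) / s)%:E)%E.
Proof.
move=> s0 ab.
rewrite /normal_prob.
apply: (@le_trans _ _ (\int[lebesgue_measure]_(x in `[a, b]) (cst (s^-1)%:E x))%E).
  apply: ge0_le_integral => //.
  - by move=> x _; rewrite lee_fin normal_pdf_ge0.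
  - apply/measurable_EFinP; apply: measurable_funTS; exact: measurable_normal_pdf.
  - move=> x _; rewrite lee_fin /=.
    by apply: le_trans (normal_peak_le s0); apply: normal_pdf_ub; rewrite gt_eqF.
rewrite integral_cst//= lebesgue_measure_itv/= lte_fin.
case: ltP => h; first by rewrite -EFinB -EFinM lee_fin mulrC.
by rewrite mule0 lee_fin divr_ge0 ?subr_ge0// ltW.
Qed.

(** The density of a centred normal law of standard deviation [s] at the point [2 * s], times the
    length [s] of []s, 2 * s]]. The scale [s] cancels. *)
Definition normal_tail : R := (Num.sqrt (pi *+ 2))^-1 * expR (- 2).

Lemma normal_tail_gt0 : 0 < normal_tail.
Proof. by rewrite mulr_gt0 ?expR_gt0// invr_gt0 sqrtr_gt0 mulrn_wgt0 ?pi_gt0. Qed.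

Lemma normal_prob_tail_ge (s : R) : 0 < s ->
  (normal_tail%:E <= normal_prob 0 s `]s, (2 * s)%R]%classic)%E.
Proof.
move=> s0.
rewrite /normal_prob.
apply: (@le_trans _ _ (\int[lebesgue_measure]_(x in `]s, (2 * s)%R]) (cst (s^-1 * normal_tail)%:E x))%E).
  rewrite integral_cst//= lebesgue_measure_itv/= lte_fin.
  have -> : s < 2 * s by lra.
  rewrite -EFinB -EFinM lee_fin (_ : 2 * s - s = s); last by ring.
  by rewrite mulrAC mulVf ?mul1r// gt_eqF.
apply: ge0_le_integral => //.
- by move=> x _; rewrite lee_fin mulr_ge0 ?invr_ge0 ?ltW// normal_tail_gt0.
- apply/measurable_EFinP; apply: measurable_funTS; exact: measurable_normal_pdf.
- move=> x /=; rewrite in_itv/= => /andP[sx x2s]; rewrite lee_fin.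
  rewrite /normal_pdf gt_eqF// /normal_tail /normal_peak /normal_fun.
  rewrite mulrA; apply: ler_pM.
  + by rewrite mulr_ge0 ?invr_ge0 ?sqrtr_ge0// ltW.
  + exact: expR_ge0.
  + rewrite -mulrnAr sqrtrM ?sqr_ge0// sqrtr_sqr gtr0_norm// invfM.
    by rewrite lexx.
  + rewrite ler_expR subr0 mulNr lerN2 ler_pdivrMr.
      rewrite (_ : 2 * (s ^+ 2 *+ 2) = (2 * s) ^+ 2); last by ring.
      by rewrite ler_sqr ?nnegrE//; lra.
    by rewrite mulrn_wgt0// exprn_gt0.
Qed.

End NormalIncrements.

Section SmallSets.
Context {disp : measure_display} {Omega : measurableType disp} {R : realType}.
Variable Pr : probability Omega R.

(** Outer probability at most [e]. Events that involve the solution are not known to be measurable,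
    so they are estimated through measurable covers. *)
Definition outer_le (e : R) (A : set Omega) :=
  exists C, [/\ measurable C, A `<=` C & (Pr C <= e%:E)%E].

Lemma outer_le_negligible A : (forall e, 0 < e -> outer_le e A) -> Pr.-negligible A.
Proof.
move=> H.
have H' n : outer_le (n.+1%:R^-1) A by apply: H; rewrite invr_gt0.
pose C n := sval (cid (H' n)).
have [mC AC PC] : [/\ forall n, measurable (C n), forall n, A `<=` C n &
    forall n, (Pr (C n) <= (n.+1%:R^-1)%:E)%E].
  by split=> n; rewrite /C; case: cid => /= D [].
have mI : measurable (\bigcap_n C n) by exact: bigcapT_measurable.
exists (\bigcap_n C n); split=> //; last by move=> x Ax n _; exact: AC.
apply/eqP; rewrite eq_le measure_ge0 andbT.
apply/lee_addgt0Pr => e e0; rewrite add0e.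
have [n ne] : exists n : nat, n.+1%:R^-1 < e.
  exists (Num.trunc e^-1); rewrite invf_plt ?posrE//.
  exact: Num.Theory.truncnS_gt.
apply: (@le_trans _ _ (Pr (C n))).
  by apply: le_measure; rewrite ?inE//; exact: bigcap_inf.
by apply: (le_trans (PC n)); rewrite lee_fin ltW.
Qed.

(** Continuity from below for the outer probability. The covers [C n] need not increase, but the
    intersections [D n] of all later covers do, and they still contain [A n] because the sets [A n]
    increase. *)
Lemma outer_le_bigcup e (A : nat -> set Omega) :
  {homo A : n m / (n <= m)%N >-> n `<=` m} ->
  (forall n, outer_le e (A n)) -> outer_le e (\bigcup_n A n).
Proof.
move=> Amono H.
pose C n := sval (cid (H n)).
have [mC AC PC] : [/\ forall n, measurable (C n), forall n, A n `<=` C n &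
    forall n, (Pr (C n) <= e%:E)%E].
  by split=> n; rewrite /C; case: cid => /= D [].
pose D n := \bigcap_(k in [set k | (n <= k)%N]) C k.
have mD n : measurable (D n) by apply: bigcap_measurable => //; exists n => /=.
have mDU : measurable (\bigcup_n D n) by exact: bigcupT_measurable.
exists (\bigcup_n D n); split=> //.
  by move=> x [n _ Anx]; exists n => // k /= nk; apply: AC; exact: Amono Anx.
have Dmono : {homo D : n m / (n <= m)%N >-> (n <= m)%O}.
  move=> n m nm; apply/subsetPset => x Dx k /= mk; apply: Dx => /=.
  exact: leq_trans mk.
have cD := @nondecreasing_cvg_mu _ _ _ Pr _ mD mDU Dmono.
have -> : Pr (\bigcup_n D n) = limn (Pr \o D) by apply/esym/cvg_lim.
apply: lime_le; first by apply/cvg_ex; exists (Pr (\bigcup_n D n)).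
near=> n => /=; apply: (@le_trans _ _ (Pr (C n))) => //.
by apply: le_measure; rewrite ?inE//; apply: bigcap_inf => /=.
Unshelve. all: by end_near.
Qed.

Lemma outer_leW e A B : A `<=` B -> outer_le e B -> outer_le e A.
Proof. by move=> AB [C [mC BC PC]]; exists C; split=> //; exact: subset_trans BC. Qed.

(* [X i0] is independent of the other coordinates, which determine it on [A] up
   to [c] once they are known up to [h]. *)
Lemma concentration (T : finType) (X : T -> Omega -> R) (i0 : T) (A : set Omega) (h c e : R) :
  mutually_independent Pr X -> (forall i, measurable_fun [set: Omega] (X i)) ->
  0 <= e -> 0 <= c ->
  (forall b, (Pr (X i0 @^-1` `[(b - c)%R, (b + c)%R]%classic) <= e%:E)%E) ->
  (forall om om', A om -> A om' ->
    (forall i, i != i0 -> Num.floor (X i om / h) = Num.floor (X i om' / h)) ->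
    `|X i0 om - X i0 om'| <= c) ->
  outer_le e A.
Proof.
move=> indX mX e0 c0 Xc H.
(* A cell fixes every coordinate up to [h] except [i0], which it leaves free; independence can then
   split off a condition on [X i0]. *)
pose J i (k : int) : set R := if i == i0 then setT else [set x | Num.floor (x / h) = k].
have mJ i k : measurable (J i k).
  rewrite /J; case: ifP => // _.
  have -> : [set x : R | Num.floor (x / h) = k] =
      (fun x => x * h^-1) @^-1` `[k%:~R, (k + 1)%:~R[%classic.
    apply/seteqP; split=> x /=; rewrite in_itv/=.
      by move=> <-; rewrite floor_le/= lt_succ_floor.
    by move=> ?; apply/floor_def.
  rewrite -[X in measurable X]setTI; apply: mulrr_measurable => //.
pose D (v : {ffun T -> int}) := \bigcap_(i in [set: T]) X i @^-1` J i (v i).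
have mXJ i k : measurable (X i @^-1` J i k).
  by rewrite -[X in measurable X]setTI; exact: mX.
have mD v : measurable (D v).
  by apply: fin_bigcap_measurable.
(* Any outcome of [A] in the cell supplies the centre: the hypothesis on pairs of outcomes places
   all of [A] within the cell in the window of half-width [c] around it. Cells that miss [A] get the
   dummy centre 0. *)
pose b v := if pselect (exists om, (D v `&` A) om) is left ex then X i0 (sval (cid ex)) else 0.
pose C v := D v `&` X i0 @^-1` `[(b v - c)%R, (b v + c)%R]%classic.
have mC v : measurable (C v).
  by apply: measurableI => //; rewrite -[X in measurable X]setTI; exact: mX.
have PC v : (Pr (C v) <= e%:E * Pr (D v))%E.
  pose B i := if i == i0 then `[(b v - c)%R, (b v + c)%R]%classic else J i (v i).
  have mB i : measurable (B i) by rewrite /B; case: ifP.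
  have -> : C v = \bigcap_(i in [set: T]) X i @^-1` B i.
    apply/seteqP; split=> om.
      move=> [Dom Xom] i _; rewrite /B; case: eqVneq => [->//|_]; exact: Dom.
    move=> Bom; split=> [i _|]; last by have := Bom i0 I; rewrite /B eqxx.
    have := Bom i; rewrite /B; case: eqVneq => [-> _|_]; last exact.
    by rewrite /J eqxx.
  rewrite (indX _ mB) /D (indX (fun i => J i (v i)))//.
  rewrite (bigD1 i0)//= [in X in (_ <= X)%E](bigD1 i0)//=.
  rewrite {1}/B eqxx /J eqxx preimage_setT probability_setT mul1e.
  rewrite lee_pmul//; first by rewrite prode_ge0.
  rewrite le_eqVlt; apply/orP; left; apply/eqP; apply: eq_bigr => i /negbTE ii0.
  by rewrite /B /J ii0.
(* Cells are enumerated by codes. The index at [i0] is normalised to 0, since [J] ignores it and the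
   same cell would otherwise recur under many codes, which would destroy disjointness. *)
pose Dn n := if @choice.pickle_inv {ffun T -> int} n is Some v then
  (if v i0 == 0 then D v else set0) else set0.
pose Cn n := if @choice.pickle_inv {ffun T -> int} n is Some v then
  (if v i0 == 0 then C v else set0) else set0.
have mDn n : measurable (Dn n) by rewrite /Dn; case: choice.pickle_inv => // v; case: ifP.
have mCn n : measurable (Cn n) by rewrite /Cn; case: choice.pickle_inv => // v; case: ifP.
have PCn n : (Pr (Cn n) <= e%:E * Pr (Dn n))%E.
  rewrite /Cn /Dn; case: choice.pickle_inv => [v|]; last by rewrite measure0 mule0.
  by case: ifP; rewrite ?measure0 ?mule0.
have CDn n : Cn n `<=` Dn n.
  rewrite /Cn /Dn; case: choice.pickle_inv => [v|//].
  by case: ifP => // _ om [].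
have tDn : trivIset setT Dn.
  apply/trivIsetP => n m _ _ nm; apply/seteqP; split=> // om.
  rewrite /Dn; case En: (choice.pickle_inv n) => [v|]; last by case.
  case Em: (choice.pickle_inv m) => [v'|]; last by case.
  case: eqP => [v0|_]; last by case.
  case: eqP => [v'0|_]; last by case.
  move=> [Dv Dv']; have vv' : v = v'.
    apply/ffunP => i; have := Dv i I; have := Dv' i I; rewrite /J /preimage/=.
    by case: eqVneq => [-> _ _|_ <- <-//]; rewrite v0 v'0.
  exfalso; move/eqP: nm; apply; rewrite -[n](@choice.pickle_invK {ffun T -> int}).
  by rewrite -[m](@choice.pickle_invK {ffun T -> int}) En Em vv'.
have tCn : trivIset setT Cn.
  apply/trivIsetP => n m _ _ nm; apply/seteqP; split=> // om [/CDn Dnom /CDn Dmom].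
  by move/trivIsetP : tDn => /(_ n m I I nm) <-; split.
exists (\bigcup_n Cn n); split.
- exact: bigcupT_measurable.
- move=> om Aom.
  pose v := [ffun i => if i == i0 then 0 else Num.floor (X i om / h)] : {ffun T -> int}.
  have Dom : D v om.
    by move=> i _; rewrite /J /preimage /= ffunE; case: eqVneq.
  exists (choice.pickle v) => //; rewrite /Cn choice.pickleK_inv ffunE !eqxx; split=> //=.
  rewrite in_itv/= -ler_distl /b; case: pselect => [ex|nex].
    case: cid => /= om' [Dom' Aom']; apply: H => // i ii0.
    have := Dom i I; have := Dom' i I.
    by rewrite /J /preimage /= (negbTE ii0) => -> ->.
  by exfalso; apply: nex; exists om.
- rewrite measure_bigcup//.
  apply: (@le_trans _ _ (\sum_(0 <= n <oo | n \in setT) (e%:E * Pr (Dn n)))%E).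
    by apply: lee_nneseries => // n _; exact: PCn.
  rewrite nneseriesZl//; rewrite -measure_bigcup//.
  have P1 : (Pr (\bigcup_n Dn n) <= 1)%E.
    by apply: probability_le1; exact: bigcupT_measurable.
  by rewrite -[leRHS]mule1; apply: lee_wpmul2l => //; rewrite lee_fin.
Qed.

End SmallSets.

(** * Increments of the Wiener process *)

Lemma measurable_norm_ge (R : realType) (a : R) : measurable [set x : R | (a <= `|x|)%R].
Proof.
have -> : [set x : R | (a <= `|x|)%R] = (fun x : R => `|x|) @^-1` `[a, +oo[%classic.
  by apply/seteqP; split=> x /=; rewrite in_itv/= andbT.
by rewrite -[X in measurable X]setTI; apply: normr_measurable.
Qed.

Section WienerIncrements.
Context {disp : measure_display} {Omega : measurableType disp} {R : realType}.
Variable Pr : probability Omega R.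
Context {n : nat}.
Variable w : R -> Omega -> 'cV[R]_n.
Hypothesis hw : wiener Pr w.

Definition wincr (s t : R) i om : R := w t om i 0 - w s om i 0.

Lemma wiener_increment_measurable (s t : R) i : 0 <= s -> 0 <= t ->
  measurable_fun [set: Omega] (wincr s t i).
Proof. by move=> s0 t0; apply: measurable_funB; exact: (wiener_measurable hw). Qed.

Lemma wiener_increment_preimage (s t : R) i (B : set R) : 0 <= s -> 0 <= t ->
  measurable B -> measurable ((wincr s t i) @^-1` B).
Proof.
move=> s0 t0 mB; rewrite -[X in measurable X]setTI.
exact: wiener_increment_measurable.
Qed.

Lemma wiener_increment_itv_le (s t a b : R) i : 0 <= s -> s < t -> a <= b ->
  (Pr ((wincr s t i) @^-1` `[a, b]%classic) <=
    ((b - a) / Num.sqrt (t - s))%:E)%E.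
Proof.
move=> s0 st ab; rewrite /wincr (wiener_gaussian hw)//.
by apply: normal_prob_itv_le => //; rewrite sqrtr_gt0 subr_gt0.
Qed.

Lemma wiener_increment_tail_le (s t : R) i : 0 <= s -> s < t ->
  (Pr ((wincr s t i) @^-1` `]-oo, (Num.sqrt (t - s))]%classic) <=
    (1 - normal_tail)%:E)%E.
Proof.
move=> s0 st; set sg := Num.sqrt _.
have sg0 : 0 < sg by rewrite sqrtr_gt0 subr_gt0.
have t0 : 0 <= t by rewrite ltW// (le_lt_trans s0).
set X := wincr s t i.
have mX B : measurable B -> measurable (X @^-1` B).
  by move=> mB; exact: wiener_increment_preimage.
apply: (@le_trans _ _ (Pr (~` (X @^-1` `]sg, (2 * sg)]%classic)))).
  apply: le_measure; rewrite ?inE; [exact: mX|by apply: measurableC; exact: mX|].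
  by move=> om /=; rewrite !in_itv/= => h; apply/negP; rewrite negb_and -leNgt h.
rewrite probability_setC; last exact: mX.
rewrite /X /wincr (wiener_gaussian hw)// -/sg EFinB leeB//.
exact: normal_prob_tail_ge.
Qed.

Lemma wiener_path_continuous om i : continuous (fun s : R => w (Num.max s 0) om i 0).
Proof.
move=> s; apply: (@continuous_comp _ _ _ (fun s : R => w (Num.max s 0) om)
  (fun u : 'cV[R]_n => u i 0)).
  have H := continuous_clamp (@wiener_continuous _ _ _ _ _ _ hw om); exact: H.
exact: coord_continuous.
Qed.

(** By continuity of the paths at [t] the unions [F k] decrease to the empty set, so one of them has
    probability at most [e]. The restriction [del <= b / 2] is there for iteration: the times so
    obtained approach [t] at least geometrically. *)
Lemma wiener_small_increment (t a b e : R) i : 0 < a -> 0 < b -> b <= t -> 0 < e ->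
  exists2 del, 0 < del <= b / 2 &
    (Pr ((wincr (t - del) t i) @^-1`
       [set x : R | (a <= `|x|)%R]) <= e%:E)%E.
Proof.
move=> a0 b0 bt e0.
have t0 : 0 < t by exact: lt_le_trans bt.
pose del k : R := b / 2 * k.+1%:R^-1.
have del0 k : 0 < del k by rewrite mulr_gt0 ?divr_gt0// invr_gt0.
have delb k : del k <= b / 2.
  apply: ler_piMr; first by rewrite divr_ge0// ltW.
  by rewrite invf_le1// ler1n.
have delt k : 0 <= t - del k by have := delb k; lra.
pose A k := (wincr (t - del k) t i) @^-1` [set x : R | (a <= `|x|)%R].
have mB := measurable_norm_ge a.
have mA k : measurable (A k) by apply: wiener_increment_preimage => //; exact: ltW.
pose F k := \bigcup_(j in [set j | (k <= j)%N]) A j.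
have mF k : measurable (F k) by exact: bigcup_measurable.
have F0 : \bigcap_k F k = set0.
  apply/seteqP; split=> // om Fom.
  have /cvgrPdist_lt /(_ _ a0) := @wiener_path_continuous om i t.
  rewrite max_l ?ltW// => -[d /= d0 Hd].
  have [k kd] : exists k, del k < d.
    have [k hk] : exists k : nat, b / 2 / d < k%:R.
      by exists (Num.trunc (b / 2 / d)).+1; exact: Num.Theory.truncnS_gt.
    exists k; rewrite /del ltr_pdivrMr//; move: hk; rewrite ltr_pdivrMr// => hk.
    by apply: lt_le_trans hk _; rewrite mulrC ler_pM2l// ler_nat.
  have [j /= kj] := Fom k I; rewrite /A /wincr /=.
  have djd : del j <= del k.
    apply: ler_wpM2l; first by rewrite divr_ge0// ltW.
    by rewrite lef_pV2 ?posrE// ler_nat ltnS.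
  have := Hd (t - del j); rewrite /ball_ /= opprB addrCA subrr addr0.
  rewrite gtr0_norm// => /(_ (le_lt_trans djd kd)); rewrite max_l//.
  by rewrite ltNge => /negbTE ->.
have Fmono : {homo F : n m / (n <= m)%N >-> (m <= n)%O}.
  move=> k m km; apply/subsetPset => om [j /= mj Aj]; exists j => //=.
  exact: leq_trans mj.
have := @nonincreasing_cvg_mu _ _ _ Pr F _ mF _ Fmono.
rewrite F0 measure0 => /(_ _ _) cF.
have {}cF : (Pr \o F) x @[x --> \oo] --> 0%E.
  apply: cF => //; apply: le_lt_trans (probability_le1 Pr (mF 0%N)) _.
  by rewrite ltry.
have [k Fk] : exists k, (Pr (F k) <= e%:E)%E.
  apply: contrapT => /forallNP nF.
  have : (e%:E <= limn (Pr \o F))%E.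
    apply: lime_ge; first by apply/cvg_ex; exists 0%E.
    by apply: nearW => k /=; rewrite ltW// ltNge; apply/negP; exact: nF.
  by rewrite (cvg_lim _ cF)// lee_fin leNgt e0.
exists (del k); first by rewrite del0 delb.
apply: le_trans Fk.
apply: le_measure; rewrite ?inE; [exact: mA|exact: mF|].
by move=> om Aom; exists k => /=.
Qed.

(** Times [u k = t - eps k] approach [t] so fast that the noise from [u k.+1] to [t] is small
    against the square root of [eps k], except with probability [eta]. Linear growth then keeps the
    increment over [[u k, u k.+1]] below its own standard deviation. These events are independent,
    of probability at most [c < 1] each, and [N] of them together have probability at most
    [c ^+ N]. *)
Lemma wiener_left_growth_negligible (t M : R) i : 0 < t ->
  Pr.-negligible [set om | forall r, 0 <= r <= t ->
    w t om i 0 - w r om i 0 <= M * (t - r)].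
Proof.
move=> t0; apply: outer_le_negligible => e e0.
set V := [set om | _].
set c := 1 - @normal_tail R.
have c1 : c < 1 by rewrite /c; have := @normal_tail_gt0 R; lra.
have c0 : 0 <= c.
  have := wiener_increment_tail_le i (lexx 0) t0.
  by rewrite -lee_fin; apply: le_trans; exact: measure_ge0.
have [N cN] : exists N, c ^+ N <= e / 2.
  have : c ^+ k @[k --> \oo] --> 0 by apply: cvg_expr; rewrite ger0_norm.
  have e2 : 0 < e / 2 by rewrite divr_gt0.
  move=> /cvgrPdist_le /(_ _ e2) [N _ /(_ N (leqnn N))].
  by rewrite /= sub0r normrN => h; exists N; apply: le_trans h; exact: ler_norm.
(* The [N] exceptional events share the budget [e / 2]; [N.+1] avoids a division by 0. *)
pose eta := e / 2 / N.+1%:R.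
have eta0 : 0 < eta by rewrite !divr_gt0.
pose M' := `|M| + 1.
have M'0 : 0 < M' by rewrite ltr_wpDl.
(* The second bound makes [M' * eps k] at most a quarter of the square root of [eps k]: on this
   scale linear growth is dominated by Gaussian fluctuations. The first keeps all times
   nonnegative. *)
pose eps0 := Num.min (t / 2) ((4 * M')^-1 ^+ 2).
have eps00 : 0 < eps0.
  by rewrite lt_min divr_gt0//= exprn_gt0// invr_gt0 mulr_gt0.
have step (x : R) : exists y, 0 < x -> x <= t -> 0 < y <= x / 2 /\
   (Pr ((wincr (t - y) t i) @^-1`
       [set z : R | (Num.sqrt x / 4 <= `|z|)%R]) <= eta%:E)%E.
  have [/andP[x0 xt]|nx] := boolP ((0 < x) && (x <= t)).
    have sx : 0 < Num.sqrt x / 4 by rewrite divr_gt0// sqrtr_gt0.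
    by have [y h1 h2] := wiener_small_increment i sx x0 xt eta0; exists y.
  by exists 0 => x0 xt; move: nx; rewrite x0 xt.
pose f x := sval (cid (step x)).
pose eps k := iter k f eps0.
have eps_bd k : 0 < eps k <= eps0.
  elim: k => [|k /andP[ih1 ih2]]; first by rewrite /eps /= eps00 lexx.
  have ih3 : eps k <= t.
    by apply: le_trans ih2 _; rewrite ge_min; apply/orP; left; lra.
  rewrite /eps iterS -/(eps k) /f; case: cid => /= y /(_ ih1 ih3) [/andP[h1 h2] _].
  by rewrite h1 (le_trans h2)//; lra.
have eps0t : eps0 <= t / 2 by rewrite ge_min lexx.
have epsS k : 0 < eps k.+1 <= eps k / 2 /\
   (Pr ((wincr (t - eps k.+1) t i) @^-1`
       [set z : R | (Num.sqrt (eps k) / 4 <= `|z|)%R]) <= eta%:E)%E.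
  have /andP[h1 h2] := eps_bd k.
  rewrite [eps k.+1]/eps iterS -/(eps k) /f; case: cid => /= y; apply => //.
  lra.
have Meps k : M' * Num.sqrt (eps k) <= 1 / 4.
  have /andP[h1 h2] := eps_bd k.
  have : Num.sqrt (eps k) <= (4 * M')^-1.
    have M4 : 0 <= (4 * M')^-1 by rewrite invr_ge0 mulr_ge0// ltW.
    rewrite -[leRHS](ger0_norm M4) -sqrtr_sqr ler_sqrt ?sqr_ge0//.
    by apply: le_trans h2 _; rewrite ge_min lexx orbT.
  move=> /(ler_wpM2l (ltW M'0)) /le_trans; apply.
  by rewrite invfM mulrCA mulfV ?gt_eqF// mulr1 mul1r.
pose u k := t - eps k.
have u0 : 0 <= u 0%N by rewrite /u /eps /=; lra.
have uS k : u k < u k.+1.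
  by have [/andP[h1 h2] _] := epsS k; have /andP[h3 _] := eps_bd k; rewrite /u; lra.
have uge0 k : 0 <= u k by have /andP[_ h2] := eps_bd k; rewrite /u; lra.
pose X (ki : 'I_N * 'I_n) := wincr (u ki.1) (u ki.1.+1) ki.2.
pose B (ki : 'I_N * 'I_n) : set R :=
  if ki.2 == i then `]-oo, (Num.sqrt (u ki.1.+1 - u ki.1))]%classic else setT.
have mB ki : measurable (B ki) by rewrite /B; case: ifP.
pose A k := (wincr (u k.+1) t i) @^-1`
       [set z : R | (Num.sqrt (eps k) / 4 <= `|z|)%R].
have mA k : measurable (A k).
  apply: wiener_increment_preimage => //; first exact: ltW.
  exact: measurable_norm_ge.
pose G := \bigcap_(ki in [set: 'I_N * 'I_n]) X ki @^-1` B ki.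
have mG : measurable G.
  by apply: fin_bigcap_measurable => // ki _; exact: wiener_increment_preimage.
pose U := \big[setU/set0]_(k < N) A k.
have mU : measurable U by exact: bigsetU_measurable.
exists (G `|` U); split; first exact: measurableU.
- move=> om Vom; have [Uom|nU] := pselect (U om); [by right|left].
  move=> [k j] _; rewrite /X /B /wincr /=; case: eqVneq => [->|//]; rewrite /= in_itv/=.
  have nA : ~ A k om.
    by move=> Ak; apply: nU; rewrite /U (bigD1 k)//=; left.
  have [/andP[e1 e2] _] := epsS k; have /andP[e3 e4] := eps_bd k.
  have h1 : w t om i 0 - w (u k) om i 0 <= M * (t - u k).
    by apply: Vom; rewrite uge0 /u; lra.
  have h2 : `|w t om i 0 - w (u k.+1) om i 0| < Num.sqrt (eps k) / 4.
    by rewrite ltNge; apply/negP.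
  have h3 : M * (t - u k) <= M' * eps k.
    rewrite /u opprB addrCA subrr addr0 ler_wpM2r// ?ltW// /M'.
    by have := ler_norm M; lra.
  have h4 : M' * eps k <= Num.sqrt (eps k) / 4.
    rewrite -{1}(sqr_sqrtr (ltW e3)) expr2 mulrA.
    by have := ler_wpM2r (sqrtr_ge0 (eps k)) (Meps k); lra.
  (* The two quarters from [h2] and [h4] add up to this half. As [eps k.+1 <= eps k / 2], the step
     from [u k] to [u k.+1] is longer than [eps k / 4]. *)
  have h5 : Num.sqrt (eps k) / 2 <= Num.sqrt (u k.+1 - u k).
    have -> : Num.sqrt (eps k) / 2 = Num.sqrt (eps k / 4).
      rewrite sqrtrM ?ltW// (_ : 4^-1 = (2^-1) ^+ 2 :> R); last by field.
      by rewrite sqrtr_sqr ger0_norm.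
    by rewrite ler_sqrt /u; clear -e1 e2 e3; lra.
  move: h2; rewrite ltr_norml => /andP[h2 _]; lra.
- apply: le_trans (measureU2 _ mG mU) _.
  have -> : e = e / 2 + e / 2 by lra.
  rewrite EFinD; apply: leeD.
    apply: (@le_trans _ _ (\prod_(ki : 'I_N * 'I_n) Pr (X ki @^-1` B ki))%E).
      rewrite le_eqVlt; apply/orP; left; apply/eqP.
      exact: (wiener_independent hw u0 (fun k _ => uS k) mB).
    apply: (@le_trans _ _ (c ^+ N)%:E); last by rewrite lee_fin.
    have -> : (\prod_(ki : 'I_N * 'I_n) Pr (X ki @^-1` B ki) =
       \prod_(k < N) \prod_(j < n) Pr (X (k, j) @^-1` B (k, j)))%E.
      by rewrite pair_bigA; apply: eq_bigr => -[].
    have -> : ((c ^+ N)%:E = \prod_(k < N) c%:E)%E.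
      by rewrite prodEFin prodr_const card_ord.
    (* The goal is strengthened by nonnegativity of the left product, without which inequalities
       between extended reals cannot be multiplied in the induction. *)
    apply: (fun P Q (h : P /\ Q) => proj2 h) (0 <= _)%E _ _.
    apply: (big_ind2 (fun x y : \bar R => (0 <= x)%E /\ (x <= y)%E)).
    - by rewrite lee_fin ler01.
    - by move=> x1 x2 y1 y2 [h1 h2] [h3 h4]; rewrite mule_ge0 ?lee_pmul.
    move=> k _; split; first by rewrite prode_ge0.
    rewrite (bigD1 i)//= big1 ?mule1 => [|j ji]; last first.
      by rewrite /B /= (negbTE ji) preimage_setT probability_setT.
    rewrite /B /= eqxx; exact: wiener_increment_tail_le.
  have UA : U `<=` \big[setU/set0]_(k < N) A k by [].
  apply: le_trans (content_subadditive Pr (fun k _ => mA k) mU UA) _.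
  apply: (@le_trans _ _ (\sum_(k < N) eta%:E)%E).
    by apply: lee_sum => k _; have [_] := epsS k.
  rewrite sumEFin sumr_const card_ord lee_fin /eta -[leLHS]mulr_natr.
  by rewrite mulrAC ler_pdivrMr// ler_pM2l ?divr_gt0// ler_nat.
Qed.

End WienerIncrements.

(** * Visits of the boundary *)

Section BoundaryVisits.
Context {R : realType} {d : nat}.
Variables (a : 'cV[R]_d.+1 -> 'cV[R]_d.+1) (K : R).
Hypothesis K0 : 0 < K.
Hypothesis lip : forall x y, halfspace x -> halfspace y -> `|a x - a y| <= K * `|x - y|.

Lemma path_drift_bounded w x p l (t : R) : reflected_solution a w x p l -> 0 <= t ->
  exists2 M : R, 0 <= M & forall r, 0 <= r <= t -> `|a (p r)| <= M.
Proof.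
move=> sol t0.
have cap : continuous (fun s : R => a (p (Num.max s 0))).
  move=> s; apply/cvgrPdist_le => e e0.
  have eK : 0 < e / K by rewrite divr_gt0.
  have cp : continuous (fun s : R => p (Num.max s 0)) by exact: (clamped_path_continuous sol).
  have /cvgrPdist_le /(_ _ eK) := cp s.
  apply: filterS => r; rewrite ler_pdivlMr// => H.
  apply: le_trans (lip (clamped_halfspace sol s) (clamped_halfspace sol r)) _.
  by rewrite mulrC.
have [|c _ H] := @EVT_max R (fun r : R => `|a (p (Num.max r 0))|) 0 t t0.
  by apply: continuous_subspaceT => r; apply: cvg_norm; exact: cap.
exists `|a (p (Num.max c 0))| => // r /[dup] /andP[r0 _] rt.
by have := H r; rewrite in_itv/= (max_l r0); exact.
Qed.

(* The local time only increases, so at a zero of the normal coordinate the noise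
   has grown at most linearly since any earlier time. *)
Lemma zero_left_growth w x p l (s : R) : reflected_solution a w x p l -> 0 <= s ->
  p s ord_max 0 = 0 ->
  exists M, forall r, 0 <= r <= s -> w s ord_max 0 - w r ord_max 0 <= M * (s - r).
Proof.
move=> sol s0 ps; have [M M0 HM] := path_drift_bounded sol s0.
exists M => r /andP[r0 rs].
have := drift_increment_le K0 lip ord_max sol r0 rs
  (fun q (hq : r <= q <= s) => HM q (introT andP (conj (le_trans r0 (proj1 (andP hq))) (proj2 (andP hq))))).
rewrite ler_norml => /andP[h _].
have := path_eq sol ord_max s0; have := path_eq sol ord_max r0.
rewrite ps eqxx !mul1r.
have := normal_coord_ge0 sol r0; have := refl_local_nondecreasing sol r0 rs.
by lra.
Qed.

Section Touch.
Variables (x : 'cV[R]_d.+1) (s s' t M del : R).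
Hypotheses (s0 : 0 <= s) (ss' : s' = s + del) (s't : s' <= t) (del0 : 0 <= del).
Hypothesis short : K * (2 * expR (4 * K * (t - s))) * (t - s) <= 1 / 4.

(** In units of [del]: the displacement at [s] caused by noises that differ by [3 * del] up to [s],
    the drifts of both solutions over [[s, s']], and a reserve for the remaining noise errors.
    [touch_cst] is a generous multiple, chosen for convenience. *)
Let c2 := 12 * expR (4 * K * s) + 2 * M + 3.

Definition touch_cst := 2 * (2 * c2 + 4).

Lemma touch_cst_gt0 : 0 <= M -> 0 < touch_cst.
Proof. by move=> M0; rewrite /touch_cst /c2; have := expR_gt0 (4 * K * s); lra. Qed.

(* Without local time between [s] and [t], the zero of [p1] bounds the noise [w1]
   over [s, r0] from above, while [p2 >= 0] bounds [w2] from below; the increments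
   outside [s, s'] and the drifts cancel up to [O(del)]. *)
Lemma touch_increment_le w1 w2 p1 p2 l1 l2 :
  reflected_solution a w1 x p1 l1 -> reflected_solution a w2 x p2 l2 -> 0 <= M ->
  (forall r, 0 <= r <= t -> `|a (p1 r)| <= M) ->
  (forall r, 0 <= r <= t -> `|a (p2 r)| <= M) ->
  l1 t = l1 s -> l2 t = l2 s ->
  (exists2 r, s' <= r <= t & p1 r ord_max 0 = 0) ->
  (forall r, 0 <= r <= s -> `|w1 r - w2 r| <= 3 * del) ->
  (forall r, s' <= r <= t -> `|(w1 r - w1 s') - (w2 r - w2 s')| <= 3 * del) ->
  (forall i, i != ord_max ->
    `|(w1 s' i 0 - w1 s i 0) - (w2 s' i 0 - w2 s i 0)| <= del) ->
  (w1 s' ord_max 0 - w1 s ord_max 0) - (w2 s' ord_max 0 - w2 s ord_max 0) <=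
    touch_cst * del.
Proof.
move=> sol1 sol2 M0 M1 M2 l1c l2c [r0 r0t pr0] w0 w1t wtan.
have ss'_ : s <= s' by rewrite ss' lerDl.
have st : s <= t by exact: le_trans s't.
have s'0 : 0 <= s' by exact: le_trans ss'_.
have [s'r0 r0t'] := andP r0t.
have lcst w p l : reflected_solution a w x p l -> l t = l s ->
    forall r, s <= r <= t -> l r = l s.
  move=> sol lc r /andP[sr rt]; apply/eqP; rewrite eq_le.
  have := refl_local_nondecreasing sol s0 sr.
  have := refl_local_nondecreasing sol (le_trans s0 sr) rt.
  by rewrite lc => -> ->.
set D := _ - (_ - _).
pose Dl i r := p1 r i 0 - p2 r i 0.
have psub i r : (p1 r - p2 r) i 0 = Dl i r by rewrite !linmxE.
pose E0 := expR (4 * K * s).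
have E00 : 0 < E0 := expR_gt0 _.
have h1 : `|p1 s - p2 s| <= 12 * E0 * del.
  have ss : 0 <= s <= s by rewrite s0 lexx.
  apply: le_trans (solution_lipschitz K0 lip sol1 sol2 s0 w0 ss) _.
  rewrite subrr normr0 add0r -/E0; have : 0 <= E0 * del by rewrite mulr_ge0// ltW.
  by lra.
have dincr w p l i : reflected_solution a w x p l ->
    (forall r, 0 <= r <= t -> `|a (p r)| <= M) ->
    `|drift a p i s' - drift a p i s| <= M * del.
  move=> sol HM; have -> : del = s' - s by rewrite ss'; ring.
  apply: (drift_increment_le K0 lip i sol s0 ss'_) => r /andP[sr rs'].
  by apply: HM; rewrite (le_trans s0 sr) (le_trans rs').
have step i : Dl i s' = Dl i s + (drift a p1 i s' - drift a p1 i s)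
   - (drift a p2 i s' - drift a p2 i s)
   + ((w1 s' i 0 - w1 s i 0) - (w2 s' i 0 - w2 s i 0)).
  rewrite /Dl (path_eq sol1 i s'0) (path_eq sol2 i s'0) (path_eq sol1 i s0) (path_eq sol2 i s0).
  rewrite (lcst _ _ _ sol1 l1c s') ?ss'_// (lcst _ _ _ sol2 l2c s') ?ss'_//.
  by ring.
have near_w i : `|Dl i s' - ((w1 s' i 0 - w1 s i 0) - (w2 s' i 0 - w2 s i 0))|
    <= (12 * E0 + 2 * M) * del.
  rewrite step addrK.
  have := le_trans (ler_mx_entry (p1 s - p2 s) i 0) h1; rewrite psub.
  have := dincr _ _ _ i sol1 M1; have := dincr _ _ _ i sol2 M2.
  rewrite !ler_norml => /andP[? ?] /andP[? ?] /andP[? ?].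
  by apply/andP; split; lra.
have c2E : (12 * E0 + 2 * M) * del = c2 * del - 3 * del by rewrite /c2 -/E0; ring.
have c20 : 0 <= c2 * del by rewrite /c2 -/E0 mulr_ge0// !addr_ge0// mulr_ge0// ltW.
have Dl_le : `|p1 s' - p2 s'| <= `|D| + c2 * del.
  apply: mx_norm_le => [|i j]; first by rewrite addr_ge0.
  rewrite ord1 psub; have := near_w i; have [->|ni] := eqVneq i ord_max.
    rewrite c2E -/D => h; rewrite -[Dl _ _](subrK D).
    apply: le_trans (ler_normD _ _) _; rewrite addrC lerD2l (le_trans h)//.
    by rewrite gerBl mulr_ge0.
  rewrite c2E; have := wtan i ni; set W := _ - (_ - _) => hW h; rewrite -[Dl _ _](subrK W).
  apply: le_trans (ler_normD _ _) _; move: hW h (normr_ge0 D) del0.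
  by move: `|W| `|D| `|_ - W| (c2 * del) => u1 u2 u3 u4; lra.
pose G := 2 * expR (4 * K * (t - s)).
have G0 : 0 < G by rewrite mulr_gt0// expR_gt0.
have gr r : s' <= r <= t -> `|p1 r - p2 r| <= G * (`|D| + c2 * del + 3 * del).
  move=> s'rt; have [s'r rt] := andP s'rt.
  have sub q : s' <= q <= t -> s <= q <= t.
    by move=> /andP[s'q ->]; rewrite (le_trans ss'_).
  have s's : s <= s' <= t by rewrite ss'_.
  have := unreflected_diff_le K0 lip sol1 sol2 s'0 s't
    (fun q hq => etrans (lcst _ _ _ sol1 l1c q (sub q hq)) (esym (lcst _ _ _ sol1 l1c s' s's)))
    (fun q hq => etrans (lcst _ _ _ sol2 l2c q (sub q hq)) (esym (lcst _ _ _ sol2 l2c s' s's)))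
    w1t s'rt.
  move=> /le_trans; apply.
  rewrite /G mulrAC; apply: ler_pM.
  - by rewrite mulr_ge0// expR_ge0.
  - by rewrite addr_ge0// mulr_ge0.
  - apply: ler_wpM2l => //; rewrite ler_expR; apply: ler_wpM2l; last by lra.
    by rewrite mulr_ge0// ltW.
  - by lra.
(* If [D] were larger, it would dominate every other contribution and [p1] would lie strictly above
   [p2] in the normal direction at [r0], although [p1] vanishes there and [p2] is nonnegative. *)
rewrite leNgt; apply/negP => Dbig.
have tE : touch_cst * del = 4 * (c2 * del) + 8 * del by rewrite /touch_cst; ring.
have DG : 0 <= touch_cst * del by rewrite tE addr_ge0// mulr_ge0.
have D0 : 0 < D by exact: le_lt_trans Dbig.
have jn := drift_diff_increment_le K0 lip sol1 sol2 ord_max s'0 s'r0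
  (fun q (hq : s' <= q <= r0) => gr q (introT andP (conj (proj1 (andP hq)) (le_trans (proj2 (andP hq)) r0t')))).
have Dr0 : Dl ord_max r0 = Dl ord_max s'
   + (drift a p1 ord_max r0 - drift a p2 ord_max r0
      - (drift a p1 ord_max s' - drift a p2 ord_max s'))
   + ((w1 r0 - w1 s') - (w2 r0 - w2 s')) ord_max 0.
  have r00 : 0 <= r0 by exact: le_trans s'r0.
  rewrite /Dl !linmxE (path_eq sol1 _ r00) (path_eq sol2 _ r00) (path_eq sol1 _ s'0) (path_eq sol2 _ s'0).
  rewrite (lcst _ _ _ sol1 l1c s') ?ss'_// (lcst _ _ _ sol2 l2c s') ?ss'_//.
  rewrite (lcst _ _ _ sol1 l1c r0) ?(le_trans ss'_ s'r0)//.
  rewrite (lcst _ _ _ sol2 l2c r0) ?(le_trans ss'_ s'r0)//.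
  by ring.
(* By [short], the drift difference accumulated after [s'] takes away at most a quarter of [D], up
   to multiples of [del]. *)
have jb : K * (G * (`|D| + c2 * del + 3 * del)) * (r0 - s') <=
    (`|D| + c2 * del + 3 * del) / 4.
  have Q0 : 0 <= `|D| + c2 * del + 3 * del.
    by rewrite !addr_ge0// mulr_ge0.
  apply: (@le_trans _ _ (K * G * (t - s) * (`|D| + c2 * del + 3 * del))).
    have -> : K * (G * (`|D| + c2 * del + 3 * del)) * (r0 - s') =
       (`|D| + c2 * del + 3 * del) * (K * G) * (r0 - s') by ring.
    rewrite [leRHS]mulrC [leRHS]mulrA; apply: ler_wpM2l; last by lra.
    by rewrite mulr_ge0// mulr_ge0// ltW.
  have := ler_wpM2r Q0 short; rewrite -/G; lra.
have := le_trans (ler_mx_entry _ ord_max 0) (w1t r0 r0t).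
have := near_w ord_max; rewrite -/D c2E.
have r00 : 0 <= r0 by exact: le_trans s'r0.
have := normal_coord_ge0 sol2 r00.
move: jn jb Dr0 Dbig; rewrite (gtr0_norm D0) tE [Dl _ r0]/Dl pr0.
set jj := drift a p1 _ r0 - _ - _; set ww := fun_of_matrix (w1 r0 - w1 s' - (w2 r0 - w2 s')) ord_max 0.
set KG := K * _ * (r0 - s').
rewrite !ler_norml => /andP[j1 j2] jb E Dbig p20 /andP[n1 n2] /andP[m1 m2].
move: j1 j2 jb E Dbig p20 n1 n2 m1 m2 c20 del0 D0.
move: (c2 * del) (KG) (jj) (ww) (D) (Dl _ _) (p2 _ _ _) => u1 u2 u3 u4 u5 u6 u7.
by lra.
Qed.

End Touch.
End BoundaryVisits.

(** * Times of linear growth form a Lebesgue-null set *)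

Section FubiniNull.
Context {disp : measure_display} {Omega : measurableType disp} {R : realType}.
Variable Pr : probability Omega R.

Lemma ysection_null_ae (G : set (measurableTypeR R * Omega)) : measurable G ->
  (forall s, Pr (xsection G s) = 0%E) ->
  \forall om \ae Pr, lebesgue_measure (ysection G om) = 0%E.
Proof.
move=> mG G0.
have := indic_fubini_tonelli (@lebesgue_measure R) Pr mG.
rewrite indic_fubini_tonelli_FE// indic_fubini_tonelli_GE//.
rewrite integral0_eq => [E|s _ /=]; last exact: G0.
have mL : measurable_fun [set: Omega] ((@lebesgue_measure R) \o ysection G).
  exact: measurable_fun_ysection.
have [+ _] := ae_eq_integral_abs Pr measurableT mL.
have -> : (\int[Pr]_x `|((@lebesgue_measure R) \o ysection G) x|)%E = 0%E.
  by rewrite [RHS]E; apply: eq_integral => x _; rewrite gee0_abs//=.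
by move=> /(_ erefl); apply: filterS => om /(_ I).
Qed.

End FubiniNull.

Section JointMeasurability.
Context {disp : measure_display} {Omega : measurableType disp} {R : realType}.

Lemma measurable_truncn (c : R) (k : nat) :
  measurable [set s : R | Num.truncn (c * Num.max s 0) = k].
Proof.
have -> : [set s : R | Num.truncn (c * Num.max s 0) = k] =
   (fun s : R => c * Num.max s 0) @^-1` [set x : R | Num.truncn x = k] by [].
have mf : measurable_fun [set: R] (fun s : R => c * Num.max s 0).
  apply: measurable_funM => //; exact: measurable_maxr.
rewrite -[X in measurable X]setTI; apply: mf => //.
have [->|k0] := eqVneq k 0%N.
  have -> : [set x : R | Num.truncn x = 0%N] = `]-oo, 1[%classic.
    apply/seteqP; split=> x /=; rewrite in_itv/=.
      by move=> /truncn0Pn; rewrite -ltNge.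
    by move=> h; apply/truncn0Pn; rewrite -ltNge.
  exact: measurable_itv.
have -> : [set x : R | Num.truncn x = k] = `[k%:R, k.+1%:R[%classic.
  apply/seteqP; split=> x /=; rewrite in_itv/=; last exact: truncn_def.
  move=> xk; have [x0|x0] := leP 0 x; first by rewrite -xk; exact: truncn_itv.
  move: k0; rewrite -xk => /eqP []; apply/truncn0Pn; rewrite -ltNge.
  by rewrite (lt_trans x0).
exact: measurable_itv.
Qed.

(** Rounding time down to multiples of [1 / m.+1] gives functions whose preimages are countable
    unions of measurable rectangles; by continuity in time they converge pointwise. *)
Lemma measurable_path_joint (f : R -> Omega -> R) :
  (forall s, 0 <= s -> measurable_fun [set: Omega] (f s)) ->
  (forall om, continuous (fun s : R => f (Num.max s 0) om)) ->
  measurable_fun [set: measurableTypeR R * Omega] (fun z => f (Num.max z.1 0) z.2).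
Proof.
move=> mf cf.
pose g (m : nat) (z : measurableTypeR R * Omega) : R :=
  f ((Num.truncn (m.+1%:R * Num.max z.1 0))%:R / m.+1%:R) z.2.
apply: (@measurable_fun_cvg _ _ _ _ g) => [m|[s om] _ /=].
  move=> _ Y mY; rewrite setTI.
  have -> : g m @^-1` Y = \bigcup_k
     ([set s : R | Num.truncn (m.+1%:R * Num.max s 0) = k] `*` (f (k%:R / m.+1%:R) @^-1` Y)).
    apply/seteqP; split=> [[s om] /= h|[s om] [k _ [/= <-]]//].
    by exists (Num.truncn (m.+1%:R * Num.max s 0)).
  apply: bigcupT_measurable => k; apply: measurableX; first exact: measurable_truncn.
  by rewrite -[X in measurable X]setTI; apply: mf => //; rewrite divr_ge0.
rewrite /g /=; set s' := Num.max s 0.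
have s'0 : 0 <= s' by rewrite le_max lexx orbT.
apply/cvgrPdist_le => e e0.
have /cvgrPdist_le /(_ _ e0) [del /= del0 H] := cf om s.
have [N HN] : exists N : nat, del^-1 < N.+1%:R.
  by exists (Num.truncn del^-1); exact: truncnS_gt.
exists N => // m /= Nm.
pose r := (Num.truncn (m.+1%:R * s'))%:R / m.+1%:R : R.
have rs : r <= s' < r + m.+1%:R^-1.
  have := @truncn_itv R (m.+1%:R * s'); rewrite mulr_ge0// => /(_ isT).
  rewrite /r ler_pdivrMr// mulrC => /andP[-> h] /=.
  by rewrite -[X in _ + X]mul1r -mulrDl natr1 ltr_pdivlMr.
have m_del : m.+1%:R^-1 < del :> R.
  rewrite invf_plt ?posrE//; apply: lt_le_trans HN _.
  by rewrite ler_nat ltnS.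
have r0 : 0 <= r by rewrite divr_ge0.
have := H (s - (s' - r)); rewrite /ball_ /= opprB addrCA subrr addr0.
rewrite -/s' ger0_norm ?subr_ge0; last by case/andP: rs.
have -> : s' - r < del.
  by case/andP: rs => _ h; rewrite ltrBlDl; apply: lt_trans h _; rewrite ltrD2l.
have [s0|s0] := leP 0 s.
  have s's : s' = s by rewrite /s' max_l.
  by rewrite s's opprB addrCA subrr addr0 (max_l r0) -s's; exact.
have s'E : s' = 0 by rewrite /s' max_r// ltW.
have rE : r = 0 by move: rs; rewrite s'E => /andP[h _]; apply/eqP; rewrite eq_le h r0.
by move=> /(_ isT); rewrite -/r rE s'E !subr0 (max_r (ltW s0)).
Qed.

End JointMeasurability.

Section ZeroSetNull.
Context {disp : measure_display} {Omega : measurableType disp} {R : realType}.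
Variable Pr : probability Omega R.
Context {n : nat}.
Variable w : R -> Omega -> 'cV[R]_n.
Hypothesis hw : wiener Pr w.

Let rat_seq (k : nat) : R := ratr (odflt 0 (@choice.pickle_inv rat k)).

(** Measurability calls for countably many conditions. A violation at a real [r < s] is strict, so
    by continuity it persists just to the right of [r], where a rational can be found. *)
Lemma left_growth_rational (s M : R) i om : 0 <= s ->
  (forall k, 0 <= rat_seq k <= s ->
    w s om i 0 - w (rat_seq k) om i 0 <= M * (s - rat_seq k)) ->
  forall r, 0 <= r <= s -> w s om i 0 - w r om i 0 <= M * (s - r).
Proof.
move=> s0 H r /andP[r0 rs].
have [->|rs'] := eqVneq r s; first by rewrite !subrr mulr0.
have {}rs : r < s by rewrite lt_neqAle rs'.
rewrite leNgt; apply/negP => Hlt.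
pose g (q : R) := M * (s - q) + w (Num.max q 0) om i 0.
have cg : continuous g.
  move=> q; apply: cvgD; last exact: (@wiener_path_continuous _ _ _ Pr _ w hw om i q).
  by apply: cvgM; [exact: cvg_cst|apply: cvgB; [exact: cvg_cst|exact: cvg_id]].
have g0 : 0 < w s om i 0 - g r.
  by rewrite /g max_l//; move: Hlt; lra.
have /cvgrPdist_lt /(_ _ g0) [del /= del0 Hd] := cg r.
have [|q] := @rat_in_itvoo R r (Num.min s (r + del)).
  by rewrite lt_min rs ltrDl.
rewrite in_itv/= lt_min => /and3P[rq qs qd].
have q0 : 0 <= ratr q :> R by rewrite ltW// (le_lt_trans r0).
have qE : rat_seq (choice.pickle q) = ratr q.
  by rewrite /rat_seq choice.pickleK_inv.
have := H (choice.pickle q); rewrite qE q0 ltW// => /(_ isT).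
have := Hd (ratr q); rewrite /ball_ /= distrC gtr0_norm ?subr_gt0//.
have -> : ratr q - r < del by move: qd; lra.
move=> /(_ isT); rewrite {2}/g max_l// ltr_norml => /andP[h1 h2].
by move: h1; rewrite /g; lra.
Qed.

Lemma left_growth_measurable (M : R) i : measurable
  [set z : measurableTypeR R * Omega | 0 < z.1 /\ forall r, 0 <= r <= z.1 ->
    w z.1 z.2 i 0 - w r z.2 i 0 <= M * (z.1 - r)].
Proof.
pose gw (z : measurableTypeR R * Omega) : R := w (Num.max z.1 0) z.2 i 0.
have mgw : measurable_fun setT gw.
  apply: (@measurable_path_joint _ _ _ (fun s om => w s om i 0)).
  - by move=> s s0; exact: (wiener_measurable hw).
  - by move=> om s; exact: (@wiener_path_continuous _ _ _ Pr _ w hw om i s).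
have m1 : measurable_fun [set: measurableTypeR R * Omega] (fun z => z.1 : R).
  exact: measurable_fst.
pose S k := [set z : measurableTypeR R * Omega | z.1 < rat_seq k] `|`
  [set z | gw z - w (rat_seq k) z.2 i 0 - M * (z.1 - rat_seq k) <= 0].
have mS k : 0 <= rat_seq k -> measurable (S k).
  move=> q0; apply: measurableU.
    rewrite -[X in measurable X]setTI.
    have := m1 measurableT `]-oo, (rat_seq k)[%classic (measurable_itv _).
    by congr (measurable _); apply/seteqP; split=> z /=; rewrite in_itv.
  have mf : measurable_fun [set: measurableTypeR R * Omega]
     (fun z => gw z - w (rat_seq k) z.2 i 0 - M * (z.1 - rat_seq k)).
    apply: measurable_funB.
      apply: measurable_funB => //.
      apply: (measurableT_comp (f := fun om => w (rat_seq k) om i 0)).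
        exact: (wiener_measurable hw).
      exact: measurable_snd.
    by apply: measurable_funM => //; exact: measurable_funB.
  have := mf measurableT `]-oo, 0]%classic (measurable_itv _).
  by rewrite setTI; congr (measurable _); apply/seteqP; split=> z /=; rewrite in_itv.
(* The noise is known to be measurable at nonnegative times only, so negative rationals are made to
   impose no condition. *)
pose S' k := if 0 <= rat_seq k then S k else setT.
have mS' k : measurable (S' k) by rewrite /S'; case: ifPn => // /mS.
have -> : [set z : measurableTypeR R * Omega | 0 < z.1 /\ forall r, 0 <= r <= z.1 ->
    w z.1 z.2 i 0 - w r z.2 i 0 <= M * (z.1 - r)] =
   [set z | 0 < z.1] `&` \bigcap_k S' k.
  apply/seteqP; split=> [[s om] /= [s0 H]|[s om] [/= s0 H]]; split=> //.
    move=> k _; rewrite /S'; case: ifPn => // q0.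
    have [h|h] := ltP s (rat_seq k); [by left|right].
    by rewrite /= /gw /= max_l ?(ltW s0)//; have := H (rat_seq k); rewrite q0 h => /(_ isT); lra.
  apply: left_growth_rational; first exact: ltW.
  move=> k /andP[q0 qs]; have := H k I; rewrite /S' q0 => -[/=|/=].
    by rewrite ltNge qs.
  by rewrite /gw /= max_l ?(ltW s0)//; lra.
apply: measurableI; last exact: bigcapT_measurable.
have := m1 measurableT `]0, +oo[%classic (measurable_itv _).
by rewrite setTI; congr (measurable _); apply/seteqP; split=> z /=; rewrite in_itv/= andbT.
Qed.

Lemma wiener_left_growth_ae i : \forall om \ae Pr,
  (@lebesgue_measure R).-negligible [set s | 0 < s /\ exists M, forall r, 0 <= r <= s ->
    w s om i 0 - w r om i 0 <= M * (s - r)].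
Proof.
pose G (k : nat) := [set z : measurableTypeR R * Omega | 0 < z.1 /\ forall r, 0 <= r <= z.1 ->
    w z.1 z.2 i 0 - w r z.2 i 0 <= k%:R * (z.1 - r)].
have mG k : measurable (G k) := left_growth_measurable k%:R i.
have : \forall om \ae Pr, forall k, lebesgue_measure (ysection (G k) om) = 0%E.
  apply: ae_foralln => k; apply: ysection_null_ae => // s.
  have [s0|s0] := ltP 0 s; last first.
    rewrite (_ : xsection _ _ = set0) ?measure0//; apply/seteqP; split=> // om.
    by move=> /xsectionP [/=]; rewrite ltNge s0.
  have := wiener_left_growth_negligible hw k%:R i s0.
  have -> : [set om | forall r : R, 0 <= r <= s -> w s om i 0 - w r om i 0 <= k%:R * (s - r)] =
     xsection (G k) s.
    by apply/seteqP; split=> om; [move=> H; apply/xsectionP; split|move=> /xsectionP []].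
  by move=> /negligibleP; apply; exact: measurable_xsection.
apply: filterS => om H.
have : (@lebesgue_measure R).-negligible (\bigcup_k ysection (G k) om).
  apply: negligible_bigcup => k; apply/negligibleP => //; first exact: measurable_ysection.
  exact: H.
apply: negligibleS => s [s0 [M HM]].
exists (Num.truncn `|M|).+1 => //; apply/ysectionP; split=> //= r rs.
apply: le_trans (HM r rs) _; apply: ler_wpM2r; first by rewrite subr_ge0; case/andP: rs.
by apply: ltW; apply: le_lt_trans (ler_norm _) _; exact: truncnS_gt.
Qed.

End ZeroSetNull.

Lemma uniform_continuity_segment (R : realType) (V : normedModType R) (f : R -> V) (a b e : R) :
  continuous f -> 0 < e ->
  exists2 del, 0 < del & forall x y, a <= x <= b -> `|y - x| <= del -> `|f y - f x| <= e.
Proof.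
move=> cf e0.
have /compact_near_coveringP := @segment_compact R a b.
move=> /(_ R (nbhs (0 : R)) (fun h x => `|f (x + h) - f x| <= e) _) H.
have {}H : \forall h \near (0 : R), `[a, b]%classic `<=` (fun x => `|f (x + h) - f x| <= e).
  apply: H => x xab.
  have e2 : 0 < e / 2 by rewrite divr_gt0.
  have /cvgrPdist_le /(_ _ e2) [del /= del0 Hd] := cf x.
  have d2 : 0 < del / 2 by rewrite divr_gt0.
  exists (ball x (del / 2), ball (0 : R) (del / 2)); first by split; exact: nbhsx_ballx.
  move=> [y h] [/= ball_y ball_h].
  move: ball_y ball_h; rewrite /ball /= => by_ bh.
  have h1 := Hd y; have h2 := Hd (y + h).
  have -> : f (y + h) - f y = (f x - f y) - (f x - f (y + h)).
    by rewrite opprB [RHS]addrC subrKA.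
  apply: le_trans (ler_normB _ _) _.
  have -> : e = e / 2 + e / 2 by lra.
  apply: lerD.
    by apply: h1; rewrite /ball_ /=; apply: lt_trans by_ _; lra.
  apply: h2; rewrite /ball_ /=.
  rewrite opprD addrA; apply: le_lt_trans (ler_normB _ _) _.
  by move: bh; rewrite sub0r normrN; move: by_; lra.
case: H => del /= del0 H.
exists (del / 2); first by rewrite divr_gt0.
move=> x y xab yx.
have := H (y - x) _ x; rewrite /= addrCA subrr addr0; apply; last by rewrite in_itv.
by rewrite /ball_ /= sub0r normrN (le_lt_trans yx)//; lra.
Qed.

Lemma floor_eq_dist (R : realType) (x y h : R) : 0 < h ->
  Num.floor (x / h) = Num.floor (y / h) -> `|x - y| <= h.
Proof.
move=> h0 E.
have := floor_le (x / h); have := lt_succ_floor (x / h).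
have := floor_le (y / h); have := lt_succ_floor (y / h).
rewrite E; set z := (Num.floor (y / h))%:~R.
rewrite !ler_pdivlMr// !ltr_pdivrMr// intrD mulrDl mul1r => h1 h2 h3 h4.
by rewrite ler_norml; lra.
Qed.

Lemma grid_near (R : realType) (A B r : R) (n : nat) : (0 < n)%N -> A < B -> A <= r <= B ->
  exists2 k, (k <= n)%N &
    A <= A + (B - A) * k%:R / n%:R <= B /\
    `|r - (A + (B - A) * k%:R / n%:R)| <= (B - A) / n%:R.
Proof.
move=> n0 AB /andP[Ar rB].
have BA : 0 < B - A by rewrite subr_gt0.
have nR : 0 < n%:R :> R by rewrite ltr0n.
pose y := (r - A) * n%:R / (B - A).
have y0 : 0 <= y by rewrite divr_ge0 ?mulr_ge0 ?subr_ge0// ltW.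
have yn : y <= n%:R.
  by rewrite ler_pdivrMr// mulrC ler_pM2l// lerD2r.
exists (Num.truncn y).
  by rewrite -(ler_nat R); apply: le_trans yn; rewrite truncn_le.
have /andP[k1 k2] := truncn_itv y0; set k := (Num.truncn y)%:R in k1 *.
have k0 : 0 <= k by exact: ler0n.
have e1 : (B - A) * y / n%:R = r - A.
  by rewrite /y; field; rewrite gt_eqF// gt_eqF.
have e2 : (B - A) * k / n%:R <= (B - A) * y / n%:R.
  by rewrite ler_pM2r ?invr_gt0// ler_pM2l.
have e3 : (B - A) * y / n%:R <= (B - A) * k / n%:R + (B - A) / n%:R.
  have h : (B - A) * y <= (B - A) * (k + 1) by rewrite ler_pM2l// ltW// natr1.
  by rewrite -mulrDl ler_pM2r ?invr_gt0//; move: h; rewrite mulrDr mulr1.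
have e4 : 0 <= (B - A) * k / n%:R by rewrite divr_ge0// mulr_ge0// ltW.
rewrite e1 in e2 e3.
split; first by lra.
by rewrite ger0_norm; lra.
Qed.

(** * Touching the boundary without local time *)

Section Touching.
Context {disp : measure_display} {Omega : measurableType disp} {R : realType} {d : nat}.
Variable Pr : probability Omega R.
Variable w : R -> Omega -> 'cV[R]_d.+1.
Hypothesis hw : wiener Pr w.
Variables (a : 'cV[R]_d.+1 -> 'cV[R]_d.+1) (K : R).
Hypothesis K0 : 0 < K.
Hypothesis lip : forall x y, halfspace x -> halfspace y -> `|a x - a y| <= K * `|x - y|.
Variables (phi : R -> Omega -> 'cV[R]_d.+1) (L : R -> Omega -> R) (x : 'cV[R]_d.+1).
Hypothesis hphi : forall om,
  reflected_solution a (fun t => w t om) x (fun t => phi t om) (fun t => L t om).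

Section FixedScale.
Variables (s s' t M del : R) (N : nat).
Hypotheses (s0 : 0 < s) (ss' : s' = s + del) (s't : s' < t) (del0 : 0 < del) (M0 : 0 <= M).
Hypothesis short : K * (2 * expR (4 * K * (t - s))) * (t - s) <= 1 / 4.

Definition touching_event := [set om |
  [/\ L t om = L s om, forall r, 0 <= r <= t -> `|a (phi r om)| <= M &
    exists2 r, s' <= r <= t & phi r om ord_max 0 = 0]].

(** A modulus of continuity with fixed mesh, so that one finite grid determines the noise up to
    [del] for all outcomes of the event. As [N] grows these events exhaust the space, by uniform
    continuity on [[0, t]]. *)
Definition modulus_event := [set om |
  forall r r', 0 <= r <= t -> 0 <= r' <= t -> `|r - r'| <= N.+1%:R^-1 ->
    `|w r om - w r' om| <= del].

(** [concentration] is applied to the increments over a grid, with the normal increment over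
    [[s, s']] singled out. The other increments, known up to small cells, determine the noise before
    [s] and its increments after [s'] up to [3 * del], and [touch_increment_le], used in both
    directions, confines the remaining one. The bound is the length of the window over the standard
    deviation. *)
Lemma touching_event_le :
  outer_le Pr (2 * (touch_cst K s M * del) / Num.sqrt del) (touching_event `&` modulus_event).
Proof.
have ss_ : s < s' by rewrite ss' ltrDl.
have t0 : 0 < t by rewrite (lt_trans s0)// (lt_trans ss_).
have C0 : 0 <= touch_cst K s M * del.
  by apply: mulr_ge0; rewrite ltW// touch_cst_gt0.
(* [n] points of the grid in [0, s] and [n] in [s', t] *)
pose n := (Num.truncn (t * N.+1%:R)).+1.
have nR : 0 < n%:R :> R by rewrite ltr0n.
have tn : t / n%:R <= N.+1%:R^-1.
  by rewrite ler_pdivrMr// ler_pdivlMl// mulrC ltW// truncnS_gt.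
(* The step of index [n] is the special one, from [u n = s] to [u n.+1 = s']; hence the shift by
   [n.+1] in the second grid. *)
pose u (k : nat) : R := if (k <= n)%N then 0 + (s - 0) * k%:R / n%:R
  else s' + (t - s') * (k - n.+1)%:R / n%:R.
pose m := (n + n).+1.
have u0 : u 0%N = 0 by rewrite /u leq0n mulr0 mul0r addr0.
have un : u n = s by rewrite /u leqnn subr0 add0r mulfK// gt_eqF.
have un1 : u n.+1 = s' by rewrite /u ltnn subnn mulr0 mul0r addr0.
have uS k : (k < m)%N -> u k < u k.+1.
  move=> _; have [kn|nk|->] := ltngtP k n; last by rewrite un un1.
    rewrite /u kn ltnW// ltrD2l ltr_pM2r ?invr_gt0// ltr_pM2l ?subr0//.
    by rewrite ltr_nat.
  rewrite /u leqNgt nk/= leqNgt (leq_trans nk)//= ltrD2l ltr_pM2r ?invr_gt0//.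
  by rewrite ltr_pM2l ?subr_gt0// ltr_nat ltn_sub2r.
(* At most [n] increments are summed on either side, each known up to [h], so the total grid error
   stays below [del]. *)
pose h := del / n%:R.
have h0 : 0 < h by rewrite divr_gt0.
have nm : (n < m)%N by rewrite /m ltnS leq_addr.
pose i0 : 'I_m * 'I_d.+1 := (Ordinal nm, ord_max).
pose X (ki : 'I_m * 'I_d.+1) om : R := w (u ki.1.+1) om ki.2 0 - w (u ki.1) om ki.2 0.
have uge0 k : 0 <= u k.
  rewrite /u; case: ifP => _; first by rewrite add0r subr0 divr_ge0// mulr_ge0// ltW.
  rewrite addr_ge0 ?divr_ge0 ?mulr_ge0 ?subr_ge0// ltW// (lt_trans s0)//.
apply: (@concentration _ _ _ Pr _ X i0 _ h (touch_cst K s M * del)).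
- by apply: (wiener_independent hw) => //; rewrite u0.
- by move=> ki; exact: (wiener_increment_measurable hw ki.2 (uge0 _) (uge0 _)).
- by rewrite divr_ge0 ?sqrtr_ge0// mulr_ge0.
- exact: C0.
- move=> b; rewrite /X /= un un1.
  have := wiener_increment_itv_le hw (a := b - touch_cst K s M * del)
    (b := b + touch_cst K s M * del) ord_max (ltW s0) ss_ _.
  have -> : s' - s = del by rewrite ss'; ring.
  have -> : b + touch_cst K s M * del - (b - touch_cst K s M * del) =
    2 * (touch_cst K s M * del) by ring.
  by apply; move: C0; lra.
move=> om1 om2 [[l1c M1 z1] mod1] [[l2c M2 z2] mod2] cell.
have incr (k : nat) i : (k < m)%N -> (k != n) || (i != ord_max) ->
   `|(w (u k.+1) om1 i 0 - w (u k) om1 i 0) - (w (u k.+1) om2 i 0 - w (u k) om2 i 0)| <= h.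
  move=> km ki; apply: floor_eq_dist => //.
  apply: (cell (Ordinal km, i)).
  by move: ki; rewrite /i0 xpair_eqE -val_eqE /= negb_and.
pose W k := w (u k) om1 - w (u k) om2.
have WE k i : W k i 0 = w (u k) om1 i 0 - w (u k) om2 i 0 by rewrite /W !linmxE.
have left_grid k : (k <= n)%N -> forall i, `|W k i 0| <= k%:R * h.
  elim: k => [|k ih] kn i.
    by rewrite WE u0 !(wiener0 hw) !mxE subrr normr0 mul0r.
  have km : (k < m)%N by rewrite (leq_trans kn)// ltnW.
  have := incr k i km; rewrite neq_ltn kn /= => /(_ isT) h1.
  have := ih (ltnW kn) i; rewrite !WE => h2.
  have -> : w (u k.+1) om1 i 0 - w (u k.+1) om2 i 0 =
    (w (u k) om1 i 0 - w (u k) om2 i 0) +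
    ((w (u k.+1) om1 i 0 - w (u k) om1 i 0) - (w (u k.+1) om2 i 0 - w (u k) om2 i 0)) by ring.
  apply: le_trans (ler_normD _ _) _.
  by rewrite -natr1 mulrDl mul1r lerD.
have right_grid k : (k <= n)%N -> forall i, `|(W (n.+1 + k)%N - W n.+1) i 0| <= k%:R * h.
  elim: k => [|k ih] kn i.
    by rewrite addn0 subrr mxE normr0 mul0r.
  have km : (n.+1 + k < m)%N by rewrite /m addSn ltnS ltn_add2l.
  have := incr (n.+1 + k)%N i km; rewrite gtn_eqF /=; last by rewrite addSn ltnS leq_addr.
  move=> /(_ isT) h1.
  have := ih (ltnW kn) i; rewrite !linmxE ?WE addnS => h2.
  have -> : w (u (n.+1 + k).+1) om1 i 0 - w (u (n.+1 + k).+1) om2 i 0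
     - (w (u n.+1) om1 i 0 - w (u n.+1) om2 i 0) =
    (w (u (n.+1 + k)%N) om1 i 0 - w (u (n.+1 + k)%N) om2 i 0
     - (w (u n.+1) om1 i 0 - w (u n.+1) om2 i 0)) +
    ((w (u (n.+1 + k).+1) om1 i 0 - w (u (n.+1 + k)%N) om1 i 0) -
     (w (u (n.+1 + k).+1) om2 i 0 - w (u (n.+1 + k)%N) om2 i 0)) by ring.
  apply: le_trans (ler_normD _ _) _.
  by rewrite -natr1 mulrDl mul1r lerD.
have nh : n%:R * h = del by rewrite /h mulrC mulfVK// gt_eqF.
have kh k : (k <= n)%N -> k%:R * h <= del.
  by move=> kn; rewrite -nh ler_pM2r// ler_nat.
(* Three errors of size [del]: the modulus of each of the two outcomes, and the difference of their
   values at the grid point. *)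
have w_left r : 0 <= r <= s -> `|w r om1 - w r om2| <= 3 * del.
  move=> /[dup] rs /andP[r0 rs'].
  have [k kn [/andP[g0 gs] rg]] := grid_near (n := n) isT s0 rs.
  have uk : u k = 0 + (s - 0) * k%:R / n%:R by rewrite /u kn.
  rewrite -uk in g0 gs rg.
  have near_ : `|r - u k| <= N.+1%:R^-1.
    apply: le_trans rg _; apply: le_trans tn; rewrite ler_pM2r ?invr_gt0// subr0.
    by rewrite ltW// (lt_trans ss_).
  have rt : 0 <= r <= t by rewrite r0 (le_trans rs')// ltW// (lt_trans ss_).
  have ut : 0 <= u k <= t by rewrite g0 (le_trans gs)// ltW// (lt_trans ss_).
  have h1 := mod1 r (u k) rt ut near_; have h2 := mod2 r (u k) rt ut near_.
  have h3 : `|W k| <= del.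
    by apply: mx_norm_le => [|i j]; [exact: ltW|rewrite ord1]; exact: le_trans (left_grid k kn i) (kh k kn).
  have -> : w r om1 - w r om2 = (w r om1 - w (u k) om1) + W k - (w r om2 - w (u k) om2).
    by apply/matrixP => i j; rewrite /W !linmxE; ring.
  apply: le_trans (ler_normB _ _) _; apply: le_trans (lerD (ler_normD _ _) h2) _.
  by move: h1 h3; lra.
have w_right r : s' <= r <= t ->
    `|(w r om1 - w s' om1) - (w r om2 - w s' om2)| <= 3 * del.
  move=> /[dup] rs /andP[r0 rs'].
  have [k kn [/andP[g0 gs] rg]] := grid_near (n := n) isT s't rs.
  have uk : u (n.+1 + k)%N = s' + (t - s') * k%:R / n%:R.
    by rewrite /u leqNgt addSn ltnS leq_addr/= subSS addKn.
  rewrite -uk in g0 gs rg.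
  have near_ : `|r - u (n.+1 + k)%N| <= N.+1%:R^-1.
    apply: le_trans rg _; apply: le_trans tn; rewrite ler_pM2r ?invr_gt0//.
    by rewrite lerBlDr lerDl ltW// (lt_trans s0).
  have s'0 : 0 <= s' by rewrite ltW// (lt_trans s0).
  have rt : 0 <= r <= t by rewrite (le_trans s'0).
  have ut : 0 <= u (n.+1 + k)%N <= t by rewrite (le_trans s'0).
  have h1 := mod1 r _ rt ut near_; have h2 := mod2 r _ rt ut near_.
  have h3 : `|W (n.+1 + k)%N - W n.+1| <= del.
    by apply: mx_norm_le => [|i j]; [exact: ltW|rewrite ord1]; exact: le_trans (right_grid k kn i) (kh k kn).
  have -> : (w r om1 - w s' om1) - (w r om2 - w s' om2) =
    (w r om1 - w (u (n.+1 + k)%N) om1) + (W (n.+1 + k)%N - W n.+1)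
     - (w r om2 - w (u (n.+1 + k)%N) om2).
    by apply/matrixP => i j; rewrite /W un1 !linmxE; ring.
  apply: le_trans (ler_normB _ _) _; apply: le_trans (lerD (ler_normD _ _) h2) _.
  by move: h1 h3; lra.
have w_tan i : i != ord_max ->
    `|(w s' om1 i 0 - w s om1 i 0) - (w s' om2 i 0 - w s om2 i 0)| <= del.
  move=> im; have := incr n i nm; rewrite im orbT un un1 => /(_ isT) /le_trans; apply.
  by have := kh 1%N isT; rewrite mul1r.
have w_left' r : 0 <= r <= s -> `|w r om2 - w r om1| <= 3 * del.
  by rewrite distrC; exact: w_left.
have w_right' r : s' <= r <= t ->
    `|(w r om2 - w s' om2) - (w r om1 - w s' om1)| <= 3 * del.
  by rewrite distrC; exact: w_right.
have w_tan' i : i != ord_max ->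
    `|(w s' om2 i 0 - w s om2 i 0) - (w s' om1 i 0 - w s om1 i 0)| <= del.
  by rewrite distrC; exact: w_tan.
have key := @touch_increment_le R d a K K0 lip x s s' t M del (ltW s0) ss' (ltW s't) (ltW del0) short.
have k1 := key _ _ _ _ _ _ (hphi om1) (hphi om2) M0 M1 M2 l1c l2c z1 w_left w_right w_tan.
have k2 := key _ _ _ _ _ _ (hphi om2) (hphi om1) M0 M2 M1 l2c l1c z2 w_left' w_right' w_tan'.
rewrite /X /= un un1 ler_norml; apply/andP; split; last exact: k1.
by move: k2; lra.
Qed.

End FixedScale.

Lemma touching_negligible (s t : R) : 0 < s -> s < t ->
  K * (2 * expR (4 * K * (t - s))) * (t - s) <= 1 / 4 ->
  Pr.-negligible [set om | [/\ 0 < phi s om ord_max 0, L t om = L s om &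
    exists2 r, s <= r <= t & phi r om ord_max 0 = 0]].
Proof.
move=> s0 st short.
(* A single integer makes both the positivity near [s] and the bound on the drift uniform in the
   outcome, so that the constants below depend on [k] only. *)
pose B k := [set om | [/\ forall r, s <= r <= s + k.+1%:R^-1 -> 0 < phi r om ord_max 0,
  L t om = L s om, forall r, 0 <= r <= t -> `|a (phi r om)| <= k%:R &
    exists2 r, s <= r <= t & phi r om ord_max 0 = 0]].
have sub : [set om | [/\ 0 < phi s om ord_max 0, L t om = L s om &
    exists2 r, s <= r <= t & phi r om ord_max 0 = 0]] `<=` \bigcup_k B k.
  move=> om /= [ps Lc z].
  have [M M0 HM] := path_drift_bounded K0 lip (hphi om) (ltW (lt_trans s0 st)).
  have cp := @clamped_entry_continuous _ _ _ _ _ _ _ (hphi om) ord_max s.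
  have /cvgrPdist_lt := cp; rewrite max_l ?ltW// => /(_ _ ps) [del /= del0 Hd].
  have m1 := truncnS_gt M; have m2 := truncnS_gt del^-1.
  set k1 := (Num.truncn M).+1 in m1; set k2 := (Num.truncn del^-1).+1 in m2.
  exists (maxn k1 k2) => //; split=> // [r /andP[sr rs]|r rt].
    have kdel : (maxn k1 k2).+1%:R^-1 < del.
      rewrite invf_plt ?posrE//; apply: lt_le_trans m2 _.
      by rewrite ler_nat (leq_trans (leq_maxr k1 k2)).
    have r0 : 0 <= r by rewrite (le_trans (ltW s0)).
    have := Hd r; rewrite /ball_ /= distrC ger0_norm ?subr_ge0// (max_l r0).
    rewrite ltrBlDl (le_lt_trans rs) ?ltrD2l// => /(_ isT).
    by rewrite ltr_norml => /andP[_]; lra.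
  apply: le_trans (HM r rt) _; apply: le_trans (ltW m1) _.
  by rewrite ler_nat leq_maxl.
apply: negligibleS sub _; apply: negligible_bigcup => k.
apply: outer_le_negligible => e e0.
pose C := touch_cst K s k%:R.
have C0 : 0 < C by exact: touch_cst_gt0.
(* The three bounds in turn push every zero beyond [s'], keep [s'] before [t], and make the
   probability, of order [Num.sqrt del], at most [e]. *)
pose del := Num.min (Num.min k.+1%:R^-1 ((t - s) / 2)) ((e / (2 * C)) ^+ 2).
have ts : 0 < t - s by rewrite subr_gt0.
have del0 : 0 < del.
  by rewrite !lt_min invr_gt0 ltr0n /= divr_gt0//= exprn_gt0// divr_gt0// mulr_gt0.
have del1 : del <= k.+1%:R^-1 by rewrite !ge_min lexx.
have del2 : del <= (t - s) / 2 by rewrite !ge_min lexx orbT.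
have del3 : 2 * (C * del) / Num.sqrt del <= e.
  have sd : 0 < Num.sqrt del by rewrite sqrtr_gt0.
  have -> : 2 * (C * del) / Num.sqrt del = 2 * C * Num.sqrt del.
    by rewrite -{1}(sqr_sqrtr (ltW del0)); field; rewrite gt_eqF.
  have : Num.sqrt del <= e / (2 * C).
    have h : 0 <= e / (2 * C) by rewrite divr_ge0 ?mulr_ge0// ltW.
    rewrite -[leRHS](ger0_norm h) -sqrtr_sqr ler_sqrt ?sqr_ge0//.
    by rewrite ge_min lexx orbT.
  by rewrite ler_pdivlMr ?mulr_gt0// [X in X <= _ -> _]mulrC.
pose s' := s + del.
have s't : s' < t by rewrite /s'; lra.
have sub2 : B k `<=` \bigcup_N (touching_event s s' t k%:R `&` modulus_event t del N).
  move=> om [pos Lc aM [r /andP[sr rt] pr]].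
  have cw : continuous (fun s : R => w (Num.max s 0) om).
    exact: continuous_clamp (@wiener_continuous _ _ _ _ _ _ hw om).
  have [eta eta0 Heta] := @uniform_continuity_segment R _ _ 0 t _ cw del0.
  have Nn := truncnS_gt eta^-1; set N := Num.truncn _ in Nn.
  exists N => //; split.
    split=> //; exists r => //; rewrite rt andbT leNgt; apply/negP => rs'.
    have h : s <= r <= s + k.+1%:R^-1 by rewrite sr (le_trans (ltW rs'))// /s' lerD2l.
    by have := pos r h; rewrite pr ltxx.
  move=> r1 r2 /andP[r10 r1t] /andP[r20 r2t] h.
  have := Heta r2 r1; rewrite r20 r2t => /(_ isT); rewrite (max_l r10) (max_l r20); apply.
  apply: le_trans h _; rewrite ltW// invf_plt ?posrE//.
apply: outer_leW sub2 _; apply: outer_le_bigcup.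
  move=> N N' NN' om [h1 h2]; split=> // r r' hr hr' h; apply: h2 => //.
  by apply: le_trans h _; rewrite lef_pV2 ?posrE// ler_nat ltnS.
move=> N; have [D [mD sD PD]] := @touching_event_le s s' t k%:R del N s0 erefl s't del0
  (ler0n _ _) short.
by exists D; split=> //; apply: le_trans PD _; rewrite lee_fin.
Qed.

End Touching.

(** * The linearized flow *)

Section LinearFlow.
Context {R : realType} {d : nat}.
Variables (Da : 'cV[R]_d.+1 -> 'M[R]_d.+1) (p : R -> 'cV[R]_d.+1) (E : R -> R -> 'M[R]_d.+1).
Hypothesis hE : linearized_solution Da p E.

Let n : R := d.+1%:R.

Lemma linearized_increment (s q : R) (v : 'cV[R]_d.+1) : 0 <= s -> s <= q ->
  forall e, 0 < e -> \forall r \near q, s <= r ->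
    `|E s r *m v - E s q *m v - (r - q) *: (Da (p q) *m (E s q *m v))| <= e * `|r - q|.
Proof.
move=> s0 sq e e0.
have [_ /(_ q sq) H] := hE s0.
have c0 : 0 < n * `|v| + 1 by rewrite ltr_wpDl// mulr_ge0// ler0n.
have := H (e / (n * `|v| + 1)); rewrite divr_gt0// => /(_ isT).
rewrite near_withinE; apply: filterS => r Hr sr.
have {}Hr := Hr; have : `[s, +oo[%classic r by rewrite /= in_itv/= sr.
move=> /Hr h.
have -> : E s r *m v - E s q *m v - (r - q) *: (Da (p q) *m (E s q *m v)) =
   (E s r - E s q - (r - q) *: (Da (p q) *m E s q)) *m v.
  by rewrite !mulmxBl -scalemxAl mulmxA.
apply: le_trans (norm_mulmx _ _) _; rewrite -/n.
rewrite mulrAC; apply: le_trans (ler_wpM2l _ h) _; first by rewrite mulr_ge0// ler0n.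
rewrite mulrA ler_wpM2r// mulrCA ler_piMr ?ltW//.
by rewrite ltr_pdivrMr// mul1r ltrDl.
Qed.

Lemma linearized_derive (s q : R) (v : 'cV[R]_d.+1) i : 0 <= s -> s < q ->
  is_derive q 1 (fun r => (E s r *m v) i 0) ((Da (p q) *m (E s q *m v)) i 0).
Proof.
move=> s0 sq; apply: is_derive_eps => e e0.
have H := linearized_increment v s0 (ltW sq) e0.
have H2 : \forall r \near q, s < r by exact: lt_nbhsr.
near=> r.
have sr : s <= r by rewrite ltW//; near: r.
have h : `|E s r *m v - E s q *m v - (r - q) *: (Da (p q) *m (E s q *m v))| <= e * `|r - q|.
  by move: sr; near: r.
have := le_trans (ler_mx_entry _ i 0) h.
by rewrite !linmxE.
Unshelve. all: by end_near.
Qed.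

Lemma linearized_continuous (s t : R) (v : 'cV[R]_d.+1) i : 0 <= s ->
  {within `[s, t], continuous (fun r => (E s r *m v) i 0)}.
Proof.
move=> s0; apply: within_continuous_eps => q /=; rewrite in_itv/= => /andP[sq qt] e e0.
have H := linearized_increment v s0 sq ltr01.
set D := Da (p q) *m (E s q *m v) in H.
have H2 : \forall r \near q, `|r - q| <= e / (1 + `|D|).
  have e1 : 0 < e / (1 + `|D|) by rewrite divr_gt0// ltr_pwDl.
  near=> r; rewrite distrC; near: r.
  exact: (@cvgr_dist_le _ _ _ _ _ id q cvg_id _ e1).
near=> r; rewrite in_itv /= => /andP[sr _].
have h1 : `|E s r *m v - E s q *m v - (r - q) *: D| <= 1 * `|r - q|.
  by move: sr; near: r.
have h2 : `|r - q| <= e / (1 + `|D|) by near: r.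
have -> : (E s r *m v) i 0 - (E s q *m v) i 0 = (E s r *m v - E s q *m v) i 0.
  by rewrite !linmxE.
apply: le_trans (ler_mx_entry _ _ _) _.
rewrite -[X in `|X|](subrK ((r - q) *: D)); apply: le_trans (ler_normD _ _) _.
rewrite ler_pdivlMr ?ltr_pwDl// in h2.
by move: h1 h2; rewrite normrZ mul1r mulrDr mulr1; lra.
Unshelve. all: by end_near.
Qed.

Lemma linearized_bounded_on (s t : R) (v : 'cV[R]_d.+1) : 0 <= s -> s <= t ->
  exists M : R, forall r, s <= r <= t -> `|E s r *m v| <= M.
Proof.
move=> s0 st.
have H i : exists M : R, forall r, s <= r <= t -> `|(E s r *m v) i 0| <= M.
  have [|c _ H] := @EVT_max R (fun r => `|(E s r *m v) i 0|) s t st.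
    have C := @linearized_continuous s t v i s0.
    by move=> r; apply: cvg_norm; exact: C.
  by exists `|(E s c *m v) i 0| => r rst; apply: H; rewrite in_itv.
exists (\sum_i `|sval (cid (H i))|) => r rst; apply: mx_norm_le => [|i j].
  by rewrite sumr_ge0.
rewrite ord1 (bigD1 i)//=; case: cid => M HM /=.
apply: le_trans (HM r rst) _; apply: le_trans (ler_norm _) _.
by rewrite lerDl sumr_ge0.
Qed.

Variable K : R.
Hypothesis K0 : 0 < K.
Hypothesis DaK : forall s, 0 <= s -> `|Da (p s)| <= K.

Lemma linearized_derive_le (q : R) (u : 'cV[R]_d.+1) i : 0 <= q ->
  `|(Da (p q) *m u) i 0| <= n * K * `|u|.
Proof.
move=> q0; apply: le_trans (ler_mx_entry _ _ _) _; apply: le_trans (norm_mulmx _ _) _.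
rewrite -/n ler_wpM2r// ler_wpM2l ?ler0n//; exact: DaK.
Qed.

Lemma linearized_le (s t : R) (v : 'cV[R]_d.+1) : 0 <= s -> s <= t ->
  `|E s t *m v| <= 2 * `|v| * expR (4 * (n * K) * (t - s)).
Proof.
move=> s0 st.
have nK : 0 < n * K by rewrite mulr_gt0// ltr0n.
have Jd i r : r \in `]s, t[ ->
    is_derive r 1 (fun r => (E s r *m v) i 0) ((Da (p r) *m (E s r *m v)) i 0).
  by rewrite in_itv/= => /andP[sr _]; exact: linearized_derive.
have Jl i r : r \in `]s, t[ ->
    `|(Da (p r) *m (E s r *m v)) i 0| <= n * K * `|E s r *m v| + 0.
  rewrite in_itv/= addr0 => /andP[sr _]; apply: linearized_derive_le.
  by rewrite ltW// (le_lt_trans s0).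
have Jc i := @linearized_continuous s t v i s0.
have H := @gronwall R d.+1 (fun r => E s r *m v) (fun i r => (E s r *m v) i 0)
  (fun i r => (Da (p r) *m (E s r *m v)) i 0) s t (n * K) `|v| 0 st nK (normr_ge0 v) (lexx 0)
  (linearized_bounded_on v s0 st) Jc Jd Jl.
have tt : s <= t <= t by rewrite st lexx.
apply: le_trans (H _ t tt) _; last by rewrite mul0r mulr0 addr0.
move=> r B srt B0 JB; have [Ess _] := hE s0.
apply: mx_norm_le => [|i j]; first by rewrite addr_ge0// mulr_ge0.
rewrite ord1; have := JB r i; case/andP: srt => -> _; rewrite lexx => /(_ isT).
rewrite Ess mul1mx => h.
have -> : (E s r *m v) i 0 = ((E s r *m v) i 0 - v i 0) + v i 0 by ring.
apply: le_trans (ler_normD _ _) _.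
by have := ler_mx_entry v i 0; lra.
Qed.

Lemma linearized_increment_le (s r t : R) (v : 'cV[R]_d.+1) : 0 <= s -> s <= r -> r <= t ->
  `|E s t *m v - E s r *m v| <=
    n * K * (2 * `|v| * expR (4 * (n * K) * (t - s))) * (t - r).
Proof.
move=> s0 sr rt; have nK : 0 < n * K by rewrite mulr_gt0// ltr0n.
apply: mx_norm_le => [|i j].
  by rewrite mulr_ge0 ?subr_ge0// mulr_ge0 ?(ltW nK)// mulr_ge0 ?expR_ge0// mulr_ge0.
rewrite ord1 !linmxE.
apply: (@norm_increment_le_cst R (fun q => (E s q *m v) i 0) (fun q => (Da (p q) *m (E s q *m v)) i 0)) => //.
- apply: continuous_subspaceW (@linearized_continuous s t v i s0) => q /=.
  by rewrite !in_itv/= => /andP[rq ->]; rewrite (le_trans sr).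
- by move=> q; rewrite in_itv/= => /andP[rq _]; apply: linearized_derive => //; exact: le_lt_trans sr rq.
- move=> q; rewrite in_itv/= => /andP[rq qt].
  have sq : s <= q by rewrite (le_trans sr)// ltW.
  apply: le_trans (linearized_derive_le _ _ _) _; first by rewrite (le_trans s0).
  rewrite ler_wpM2l ?(ltW nK)//; apply: le_trans (linearized_le _ s0 sq) _.
  rewrite ler_wpM2l ?mulr_ge0// ler_expR ler_wpM2l ?lerD2r ?(ltW qt)//.
  by rewrite mulr_ge0// ltW.
Qed.

End LinearFlow.

Section FirstOrder.
Context {R : realType} {d : nat}.
Variables (a : 'cV[R]_d.+1 -> 'cV[R]_d.+1) (Da : 'cV[R]_d.+1 -> 'M[R]_d.+1) (K : R).
Hypothesis K0 : 0 < K.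
Hypothesis aD : forall x, halfspace x -> is_diff_in halfspace a x (mulmx (Da x)).
Hypothesis Dac : {within halfspace, continuous Da}.
Hypothesis DaK : forall x, halfspace x -> `|Da x| <= K.
Hypothesis lip : forall x y, halfspace x -> halfspace y -> `|a x - a y| <= K * `|x - y|.

(** The points [z] lie off the path, so uniform continuity along the path alone is not enough.
    Compactness of [[0, t]] is used as a covering property with a second filter, that of small
    displacements [v = z - p r]. *)
Lemma uniform_derivative w x p l (t e : R) : reflected_solution a w x p l -> 0 < e ->
  exists2 del, 0 < del & forall r z, 0 <= r <= t -> halfspace z -> `|z - p r| <= del ->
    `|Da z - Da (p r)| <= e.
Proof.
move=> sol e0.
pose pos (s : R) := p (Num.max s 0).
have cp : continuous pos by exact: (clamped_path_continuous sol).
have hp s : halfspace (pos s) := clamped_halfspace sol s.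
have /compact_near_coveringP := @segment_compact R 0 t.
move=> /(_ _ (nbhs (0 : 'cV[R]_d.+1))
  (fun v r => halfspace (pos r + v) -> `|Da (pos r + v) - Da (pos r)| <= e) _) H.
have {}H : \forall v \near (0 : 'cV[R]_d.+1), `[0, t]%classic `<=`
    (fun r => halfspace (pos r + v) -> `|Da (pos r + v) - Da (pos r)| <= e).
  apply: H => r _.
  have e2 : 0 < e / 2 by rewrite divr_gt0.
  have /subspace_continuousP /(_ _ (hp r)) /cvgrPdist_le /(_ _ e2) := Dac.
  rewrite near_withinE => /nbhs_ballP [del /= del0 Hd].
  have d2 : 0 < del / 2 by rewrite divr_gt0.
  have /cvgrPdist_lt /(_ _ d2) Hp := cp r.
  have Hv : \forall v \near (0 : 'cV[R]_d.+1), `|v| < del / 2.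
    near=> v; rewrite -[v]subr0 distrC; near: v.
    by apply: cvgr_dist_lt d2; exact: cvg_id.
  near=> r' v => hv.
  have h1 : `|pos r - pos r'| < del / 2 by near: r'.
  have h2 : `|v| < del / 2 by near: v.
  have k1 := Hd (pos r') _ (hp r').
  have k2 := Hd (pos r' + v) _ hv.
  have -> : Da (pos r' + v) - Da (pos r') =
    (Da (pos r) - Da (pos r')) - (Da (pos r) - Da (pos r' + v)).
    by rewrite opprB [RHS]addrC subrKA.
  apply: le_trans (ler_normB _ _) _.
  have -> : e = e / 2 + e / 2 by lra.
  apply: lerD; [apply: k1|apply: k2]; rewrite -ball_normE /ball_ /=.
    by apply: lt_trans h1 _; lra.
  by rewrite opprD addrA; apply: le_lt_trans (ler_normB _ _) _; lra.
have [del /= del0 Hd] : exists2 del : R, 0 < del & forall v, `|v| <= del ->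
   `[0, t]%classic `<=` (fun r => halfspace (pos r + v) -> `|Da (pos r + v) - Da (pos r)| <= e).
  have /nbhs_ballP [del /= del0 Hd] := H.
  exists (del / 2); first by rewrite divr_gt0.
  move=> v vd; apply: Hd; rewrite -ball_normE /ball_ /= sub0r normrN.
  by apply: le_lt_trans vd _; lra.
exists del => // r z /andP[r0 rt] hz zr.
have pr : pos r = p r by rewrite /pos max_l.
have := Hd (z - p r) zr r; rewrite pr addrC subrK => h.
by apply: h => //; rewrite /= in_itv/= r0.
Unshelve. all: by end_near.
Qed.

Lemma uniform_remainder w x p l (t e : R) : reflected_solution a w x p l -> 0 < e ->
  exists2 del, 0 < del & forall r z, 0 <= r <= t -> halfspace z -> `|z - p r| <= del ->
    `|a z - a (p r) - Da (p r) *m (z - p r)| <= e * `|z - p r|.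
Proof.
move=> sol e0.
have e'0 : 0 < e / d.+1%:R by rewrite divr_gt0.
have [del del0 H] := uniform_derivative t sol e'0.
exists del => // r z rt hz zr.
have hpr : halfspace (p r) by apply: (refl_halfspace sol); case/andP: rt.
have := @C1_remainder R d a Da (Da (p r)) (p r) z (e / d.+1%:R) (ltW e'0) aD hpr hz.
rewrite (mulrC _ (e / _)) divfK// => -> // th th01.
apply: H => //; first exact: halfspace_segment.
rewrite addrAC subrr add0r normrZ; apply: le_trans zr.
by case/andP: th01 => h0 h1; rewrite ger0_norm// ler_piMl.
Qed.

(** Gronwall for the difference between the displacement and the linear flow, with the remainder of
    [a] as source term. The linear flow starts at [s0] but the comparison only at [s1]: for an
    excursion, [s0] is its left end, where the path is still on the boundary. *)
Lemma ode_compare w x x' p p' l l' E (s0 s1 s2 e : R) v :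
  reflected_solution a w x p l -> reflected_solution a w x' p' l' ->
  linearized_solution Da p E -> 0 <= s0 -> s0 <= s1 -> s1 <= s2 -> 0 <= e ->
  (forall r, s1 <= r <= s2 -> l r = l s1) -> (forall r, s1 <= r <= s2 -> l' r = l' s1) ->
  (forall r, s1 <= r <= s2 ->
    `|a (p' r) - a (p r) - Da (p r) *m (p' r - p r)| <= e) ->
  `|p' s2 - p s2 - E s0 s2 *m v| <=
    2 * (`|p' s1 - p s1 - E s0 s1 *m v| + 2 * (e * (s2 - s1))) *
      expR (4 * (d.+1%:R * K) * (s2 - s1)).
Proof.
move=> sol sol' hE s00 s01 s12 e0 lc lc' rem.
have s10 : 0 <= s1 by exact: le_trans s01.
have nK : 0 < d.+1%:R * K by rewrite mulr_gt0.
have DpK r : 0 <= r -> `|Da (p r)| <= K by move=> r0; apply: DaK; exact: (refl_halfspace sol).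
pose u r := p' r - p r - E s0 r *m v.
pose J i r := drift a p' i r - drift a p i r - (E s0 r *m v) i 0.
pose dJ i r := a (p' r) i 0 - a (p r) i 0 - (Da (p r) *m (E s0 r *m v)) i 0.
have ub : exists M : R, forall r, s1 <= r <= s2 -> `|u r| <= M.
  have [M1 H1] := path_diff_bounded sol' sol s10 s12.
  have [M2 H2] := linearized_bounded_on hE v s00 (le_trans s01 s12).
  exists (M1 + M2) => r srs; apply: le_trans (ler_normB _ _) _; apply: lerD; first exact: H1.
  by apply: H2; case/andP: srs => sr ->; rewrite (le_trans s01).
have Jc i : {within `[s1, s2], continuous (J i)}.
  have h1 := drift_diff_continuous K0 lip sol' sol (i := i) s10 s12.
  have h2 := @linearized_continuous _ _ _ _ _ hE s0 s2 v i s00.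
  have h3 : {within `[s1, s2], continuous (fun r => (E s0 r *m v) i 0)}.
    by apply: continuous_subspaceW h2 => q /=; rewrite !in_itv/= => /andP[sq ->]; rewrite (le_trans s01).
  by move=> r; exact: cvgB (h1 r) (h3 r).
have Jd i r : r \in `]s1, s2[ -> is_derive r 1 (J i) (dJ i r).
  rewrite in_itv/= => /andP[sr _]; apply: is_deriveB.
    exact: (drift_diff_derive K0 lip sol' sol i (le_lt_trans s10 sr)).
  exact: (linearized_derive hE v i s00 (le_lt_trans s01 sr)).
have Jl i r : r \in `]s1, s2[ -> `|dJ i r| <= d.+1%:R * K * `|u r| + e.
  rewrite in_itv/= => /andP[sr rs].
  have srs : s1 <= r <= s2 by rewrite !ltW.
  have -> : dJ i r = (Da (p r) *m u r) i 0 +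
     (a (p' r) - a (p r) - Da (p r) *m (p' r - p r)) i 0.
    by rewrite /dJ /u mulmxBr !linmxE; ring.
  apply: le_trans (ler_normD _ _) _; apply: lerD.
    by apply: (linearized_derive_le DpK); rewrite (le_trans s10)// ltW.
  exact: le_trans (ler_mx_entry _ _ _) (rem r srs).
have H := @gronwall R d.+1 u J dJ s1 s2 (d.+1%:R * K) `|u s1| e s12 nK (normr_ge0 _) e0 ub Jc Jd Jl.
have ss : s1 <= s2 <= s2 by rewrite s12 lexx.
apply: H ss => r B srs B0 JB; have [sr rs] := andP srs.
have r0 := le_trans s10 sr.
apply: mx_norm_le => [|i j]; first by rewrite addr_ge0// mulr_ge0.
rewrite ord1.
have -> : u r i 0 = u s1 i 0 + (J i r - J i s1).
  rewrite /u /J !linmxE (path_eq sol i r0) (path_eq sol' i r0) (path_eq sol i s10) (path_eq sol' i s10).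
  by rewrite lc ?lc'//; ring.
have := JB r i; rewrite sr lexx => /(_ isT) h.
apply: le_trans (ler_normD _ _) _.
by have := ler_mx_entry (u s1) i 0; lra.
Qed.

End FirstOrder.

Section TangentProjection.
Context {R : realType} {d : nat}.
Implicit Types u v : 'cV[R]_d.+1.

Lemma tangent_proj_entry u i : (tangent_proj *m u) i 0 = (i != ord_max)%:R * u i 0.
Proof. by rewrite /tangent_proj mul_diag_mx !mxE. Qed.

Lemma norm_tangent_proj_le u : `|tangent_proj *m u| <= `|u|.
Proof.
apply: mx_norm_le => // i j; rewrite ord1 tangent_proj_entry normrM.
apply: le_trans (ler_mx_entry u i 0).
by rewrite -[leRHS]mul1r ler_wpM2r//; case: (i != _); rewrite ?normr1// normr0.
Qed.

Lemma tangent_proj_idem : tangent_proj *m tangent_proj = tangent_proj :> 'M[R]_d.+1.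
Proof.
by apply/matrixP => i j; rewrite /tangent_proj mul_diag_mx !mxE;
  case: (i != ord_max); rewrite ?mul1r ?mul0r// mul0rn.
Qed.

End TangentProjection.

Section NearStart.
Context {R : realType} {d : nat}.
Implicit Types x : 'cV[R]_d.+1.

Lemma near_dist_le x (e : R) : 0 < e -> \forall y \near x, `|y - x| <= e.
Proof.
move=> e0; near=> y; rewrite distrC; near: y.
by apply: cvgr_dist_le e0; exact: cvg_id.
Unshelve. all: by end_near.
Qed.

Lemma near_scale_le x (c e : R) : 0 <= c -> 0 < e -> \forall y \near x, c * `|y - x| <= e.
Proof.
move=> c0 e0; have e1 : 0 < e / (c + 1) by rewrite divr_gt0// ltr_wpDl.
near=> y; have : `|y - x| <= e / (c + 1) by near: y; exact: near_dist_le.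
rewrite ler_pdivlMr ?ltr_wpDl// mulrDr mulr1 mulrC.
by have := normr_ge0 (y - x); lra.
Unshelve. all: by end_near.
Qed.

Lemma near_halfspace x : halfspace_int x -> \forall y \near x, halfspace y.
Proof.
move=> x0; near=> y.
have : `|y - x| <= x ord_max 0 by near: y; exact: near_dist_le.
move=> /(le_trans (ler_mx_entry _ ord_max 0)); rewrite !linmxE ler_norml => /andP[h _].
by rewrite /halfspace /=; lra.
Unshelve. all: by end_near.
Qed.

End NearStart.

(** * Displacement of nearby solutions along one excursion *)

Section FlowDerivative.
Context {R : realType} {d : nat}.
Variables (a : 'cV[R]_d.+1 -> 'cV[R]_d.+1) (Da : 'cV[R]_d.+1 -> 'M[R]_d.+1) (K : R).
Hypothesis K0 : 0 < K.
Hypothesis aD : forall x, halfspace x -> is_diff_in halfspace a x (mulmx (Da x)).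
Hypothesis Dac : {within halfspace, continuous Da}.
Hypothesis DaK : forall x, halfspace x -> `|Da x| <= K.
Hypothesis lip : forall x y, halfspace x -> halfspace y -> `|a x - a y| <= K * `|x - y|.
Variables (w : R -> 'cV[R]_d.+1) (phi : 'cV[R]_d.+1 -> R -> 'cV[R]_d.+1).
Variable l : 'cV[R]_d.+1 -> R -> R.
Hypothesis w0 : w 0 = 0.
Hypothesis sol : forall y, halfspace y -> reflected_solution a w y (phi y) (l y).
Variable x : 'cV[R]_d.+1.
Hypothesis hx : halfspace_int x.
Variable E : R -> R -> 'M[R]_d.+1.
Hypothesis hE : linearized_solution Da (phi x) E.
Variable T : R.
Hypothesis T0 : 0 <= T.

Local Notation P := (@tangent_proj R d).

Definition displacement y s := phi y s - phi x s.
Local Notation psi := displacement.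

Let hsx : halfspace x.
Proof. by rewrite /halfspace /= ltW. Qed.

Let solx := sol hsx.

(** The constant of [solution_lipschitz] on [[0, T]] for equal noises. *)
Definition lipschitz_cst : R := 4 * expR (4 * K * T).
Local Notation C := lipschitz_cst.

Let C0 : 0 < C.
Proof. by rewrite mulr_gt0// expR_gt0. Qed.

(** Bounds the linear flow on [[0, T]] and also the Gronwall factor of [ode_compare]. *)
Definition linear_cst : R := 2 * expR (4 * (d.+1%:R * K) * T).
Local Notation X := linear_cst.

Let X0 : 0 < X.
Proof. by rewrite mulr_gt0// expR_gt0. Qed.

Let nK : 0 < d.+1%:R * K.
Proof. by rewrite mulr_gt0. Qed.

Let DpK r : 0 <= r -> `|Da (phi x r)| <= K.
Proof. by move=> r0; apply: DaK; exact: (refl_halfspace solx). Qed.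

Lemma flow_start y : halfspace y -> phi y 0 = y.
Proof.
move=> hy; apply/matrixP => i j; rewrite ord1 (path_eq (sol hy) i (lexx 0)).
by rewrite (drift0 a (phi y)) w0 mxE (refl_local0 (sol hy)) mulr0 !addr0.
Qed.

Lemma displacement_le y s : halfspace y -> 0 <= s <= T -> `|psi y s| <= C * `|y - x|.
Proof.
move=> hy sT.
have := solution_lipschitz K0 lip (e := 0) (sol hy) solx T0.
move=> /(_ (fun r _ => _)) H; apply: le_trans (H _ s sT) _.
  by move=> r; rewrite subrr normr0.
rewrite addr0 mulrAC ler_wpM2r// /C ler_wpM2l// ler_expR ler_wpM2l//.
  by rewrite mulr_ge0// ltW.
by case/andP: sT.
Qed.

Lemma drift_displacement_le y i s t : halfspace y -> 0 <= s -> s <= t -> t <= T ->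
  `|(drift a (phi y) i t - drift a (phi x) i t) - (drift a (phi y) i s - drift a (phi x) i s)|
    <= K * (C * `|y - x|) * (t - s).
Proof.
move=> hy s0 st tT; apply: (drift_diff_increment_le K0 lip (sol hy) solx i s0 st).
move=> r /andP[sr rt]; apply: displacement_le => //.
by rewrite (le_trans s0 sr) (le_trans rt).
Qed.

Lemma tangent_increment_le y s t : halfspace y -> 0 <= s -> s <= t -> t <= T ->
  `|P *m psi y t - P *m psi y s| <= K * C * (t - s) * `|y - x|.
Proof.
move=> hy s0 st tT; have t0 := le_trans s0 st.
have KC : 0 <= K * (C * `|y - x|) * (t - s).
  by rewrite mulr_ge0 ?subr_ge0// !mulr_ge0// ltW.
have -> : K * C * (t - s) * `|y - x| = K * (C * `|y - x|) * (t - s) by ring.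
apply: mx_norm_le => // i j; rewrite ord1 -mulmxBr tangent_proj_entry.
have [im|im] := eqVneq i ord_max; first by rewrite mul0r normr0.
rewrite mul1r; apply: le_trans (drift_displacement_le i hy s0 st tT).
rewrite /psi !linmxE (path_eq (sol hy) i t0) (path_eq (sol hy) i s0).
rewrite (path_eq solx i t0) (path_eq solx i s0) (negbTE im) !mul0r.
by rewrite le_eqVlt; apply/orP; left; apply/eqP; congr (`|_|); ring.
Qed.

Lemma linear_le (s t : R) (v : 'cV[R]_d.+1) : 0 <= s -> s <= t -> t <= T -> `|E s t *m v| <= X * `|v|.
Proof.
move=> s0 st tT; apply: le_trans (linearized_le hE K0 DpK v s0 st) _.
rewrite mulrAC ler_wpM2r// ler_wpM2l// ler_expR ler_wpM2l//; last by lra.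
by rewrite mulr_ge0// ltW.
Qed.

Lemma linear_increment_le (s r t : R) (v : 'cV[R]_d.+1) : 0 <= s -> s <= r -> r <= t -> t <= T ->
  `|E s t *m v - E s r *m v| <= d.+1%:R * K * X * (t - r) * `|v|.
Proof.
move=> s0 sr rt tT; apply: le_trans (linearized_increment_le hE K0 DpK v s0 sr rt) _.
have -> : d.+1%:R * K * X * (t - r) * `|v| = d.+1%:R * K * (X * `|v|) * (t - r) by ring.
apply: ler_wpM2r; first by rewrite subr_ge0.
apply: ler_wpM2l; first exact: ltW.
rewrite mulrAC ler_wpM2r// ler_wpM2l// ler_expR ler_wpM2l//; last by lra.
by rewrite mulr_ge0// ltW.
Qed.

Lemma local_displacement_le y s : halfspace y -> 0 <= s <= T ->
  `|l y s - l x s| <= (1 + K * C * T) * `|y - x|.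
Proof.
move=> hy /andP[s0 sT]; apply: (local_diff_le (sol hy) solx s0).
  by rewrite mulr_ge0// addr_ge0// !mulr_ge0// ltW.
move=> r /andP[r0 rs]; rewrite (path_eq (sol hy) _ r0) (path_eq solx _ r0) eqxx !mul1r.
have rT : r <= T by exact: le_trans sT.
have := drift_displacement_le ord_max hy (lexx 0) r0 rT.
rewrite (drift0 a (phi x)) (drift0 a (phi y)) !subr0 => h.
have h2 := ler_mx_entry (y - x) ord_max 0; rewrite !linmxE in h2.
have -> : y ord_max 0 + drift a (phi y) ord_max r + w r ord_max 0 + l y r - l y r
  - (x ord_max 0 + drift a (phi x) ord_max r + w r ord_max 0 + l x r - l x r) =
  (y ord_max 0 - x ord_max 0) + (drift a (phi y) ord_max r - drift a (phi x) ord_max r) by ring.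
apply: le_trans (ler_normD _ _) _; rewrite mulrDl mul1r; apply: lerD => //.
apply: le_trans h _.
have -> : K * C * T * `|y - x| = K * (C * `|y - x|) * T by ring.
by rewrite ler_wpM2l// !mulr_ge0// ltW.
Qed.

(* If the local time was still growing at the zero [al], then the last zero of a
   nearby solution before [s1] cannot be much older than [al]. *)
Lemma normal_displacement_near al s1 : 0 < al -> al <= s1 -> s1 <= T ->
  phi x al ord_max 0 = 0 ->
  (forall r, 0 <= r -> r < al -> l x r < l x al) -> l x s1 = l x al -> al < s1 ->
  \forall y \near x, `|psi y s1 ord_max 0| <= 2 * K * C * (s1 - al) * `|y - x|.
Proof.
move=> al0 als1 s1T pal strict lc als1'.
have s10 : 0 <= s1 by rewrite (le_trans _ als1)// ltW.
(* The mirror image of [s1] in [al], cut off at 0. Thus [s1 - r0] is at most twice [s1 - al], the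
   origin of the factor 2 in the bound. *)
pose r0 := Num.max 0 (2 * al - s1).
have r00 : 0 <= r0 by rewrite le_max lexx.
have r0al : r0 < al by rewrite gt_max al0 /=; lra.
have r0s1 : r0 <= s1 by rewrite ltW// (lt_le_trans r0al).
have r0ge : s1 - r0 <= 2 * (s1 - al).
  have : 2 * al - s1 <= r0 by rewrite le_max lexx orbT.
  by lra.
(* One third for the error at each end: for [y] this close, the local time of [y] still grows
   between [r0] and [s1], so its path meets the boundary in between. *)
have gap : 0 < (l x al - l x r0) / 3 by rewrite divr_gt0// subr_gt0 strict.
have C20 : 0 <= 1 + K * C * T by rewrite addr_ge0// !mulr_ge0// ltW.
near=> y.
have hy : halfspace y by near: y; exact: near_halfspace.
have small : (1 + K * C * T) * `|y - x| <= (l x al - l x r0) / 3.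
  by near: y; exact: near_scale_le.
have s1T' : 0 <= s1 <= T by rewrite s10.
have r0T : 0 <= r0 <= T by rewrite r00 (le_trans r0s1).
have ls1 := le_trans (local_displacement_le hy s1T') small.
have lr0 := le_trans (local_displacement_le hy r0T) small.
have KCy : 0 <= K * (C * `|y - x|) by rewrite !mulr_ge0// ltW.
have zdiff r t : 0 <= r -> r <= t -> t <= T -> 
   `|((phi y t ord_max 0 - l y t) - (phi x t ord_max 0 - l x t)) -
     ((phi y r ord_max 0 - l y r) - (phi x r ord_max 0 - l x r))| <=
   K * (C * `|y - x|) * (t - r).
  move=> rr rt tT; have t0 := le_trans rr rt.
  apply: le_trans (drift_displacement_le ord_max hy rr rt tT).
  rewrite (path_eq (sol hy) _ t0) (path_eq solx _ t0) (path_eq (sol hy) _ rr) (path_eq solx _ rr).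
  rewrite eqxx !mul1r.
  by rewrite le_eqVlt; apply/orP; left; apply/eqP; congr (`|_|); ring.
have al00 : 0 <= al := ltW al0.
have RHSE : 2 * K * C * (s1 - al) * `|y - x| = K * (C * `|y - x|) * (2 * (s1 - al)) by ring.
rewrite /psi !linmxE RHSE ler_norml; apply/andP; split.
  have := zdiff al s1 al00 als1 s1T; rewrite pal lc ler_norml => /andP[h _].
  have := normal_coord_ge0 (sol hy) al00.
  have := refl_local_nondecreasing (sol hy) al00 als1.
  have : 0 <= K * (C * `|y - x|) * (s1 - al) by rewrite mulr_ge0// subr_ge0.
  by move: h; move: (K * _); move=> k; lra.
have [[r [/andP[r0r rs1] pr lr _]]|[lc' _]] := last_zero_or_constant (sol hy) r00 r0s1.
  have rr : 0 <= r by exact: le_trans r0r.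
  have := zdiff r s1 rr rs1 s1T; rewrite pr lr ler_norml => /andP[_ h].
  have := normal_coord_ge0 solx rr.
  have := refl_local_nondecreasing solx rr rs1.
  have : K * (C * `|y - x|) * (s1 - r) <= K * (C * `|y - x|) * (2 * (s1 - al)).
    by rewrite ler_wpM2l//; lra.
  by move: h; move: (K * _ * (s1 - r)) (K * _ * (2 * _)) => k1 k2; lra.
exfalso; move: ls1 lr0; rewrite lc lc' !ler_norml => /andP[h1 h2] /andP[h3 h4].
by have := gap; lra.
Unshelve. all: by end_near.
Qed.

(** On [[s1, s2]] the normal coordinate of [phi x] has a positive minimum, so nearby solutions stay
    off the boundary as well. Both local times are frozen and [ode_compare] applies. The initial
    vector may depend on [y], since it will be the projected displacement at [al]. *)
Lemma interior_near al s1 s2 e (v : 'cV[R]_d.+1 -> 'cV[R]_d.+1) :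
  0 <= al -> al <= s1 -> s1 <= s2 -> s2 <= T -> 0 < e ->
  (forall r, s1 <= r <= s2 -> phi x r ord_max 0 <> 0) ->
  \forall y \near x, `|psi y s2 - E al s2 *m v y| <=
    X * `|psi y s1 - E al s1 *m v y| + e * `|y - x|.
Proof.
move=> al0 als1 s12 s2T e0 nz.
have s10 : 0 <= s1 by exact: le_trans als1.
have pos r : s1 <= r <= s2 -> 0 < phi x r ord_max 0.
  move=> srs; rewrite lt_neqAle eq_sym; apply/andP; split; first by apply/eqP; exact: nz.
  by apply: (normal_coord_ge0 solx); case/andP: srs => sr _; exact: le_trans sr.
have [|c cs Hc] := @EVT_min R (fun r => phi x (Num.max r 0) ord_max 0) s1 s2 s12.
  by apply: continuous_subspaceT; exact: (@clamped_entry_continuous _ _ _ _ _ _ _ solx ord_max).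
have c00 : 0 <= c by move: cs; rewrite in_itv/= => /andP[h _]; exact: le_trans h.
have pc : 0 < phi x c ord_max 0 by apply: pos; move: cs; rewrite in_itv.
rewrite (max_l c00) in Hc.
have T1 : 0 < T + 1 by rewrite ltr_wpDl.
pose e1 := e / (2 * X * C * (T + 1)).
have XCT : 0 < 2 * X * C * (T + 1).
  by have X2 := mulr_gt0 (ltr0n R 2) X0; exact: mulr_gt0 (mulr_gt0 X2 C0) T1.
have e10 : 0 < e1 by exact: divr_gt0 e0 XCT.
have [del del0 Hd] := uniform_remainder aD Dac T solx e10.
have pc2 : 0 < phi x c ord_max 0 / 2 by rewrite divr_gt0.
near=> y.
have hy : halfspace y by near: y; exact: near_halfspace.
have small1 : C * `|y - x| <= phi x c ord_max 0 / 2.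
  by near: y; apply: near_scale_le => //; exact: ltW.
have small2 : C * `|y - x| <= del by near: y; apply: near_scale_le => //; exact: ltW.
have rT r : s1 <= r <= s2 -> 0 <= r <= T.
  by move=> /andP[sr rs]; rewrite (le_trans s10 sr) (le_trans rs).
have posy r : s1 <= r <= s2 -> phi y r ord_max 0 <> 0.
  move=> srs; have [r0 _] := andP (rT r srs).
  have := le_trans (displacement_le hy (rT r srs)) small1.
  move=> /(le_trans (ler_mx_entry _ ord_max 0)); rewrite /psi !linmxE ler_norml => /andP[h _].
  have := Hc r; rewrite in_itv/= (max_l r0) => /(_ srs) h2.
  by move=> E0; move: h; rewrite E0; move: pc h2; lra.
have lcst q (hq : halfspace q) : (forall r, s1 <= r <= s2 -> phi q r ord_max 0 <> 0) ->
    forall r, s1 <= r <= s2 -> l q r = l q s1.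
  move=> nzq r /andP[sr rs]; apply: (local_constant (sol hq) s10 sr) => r' h1 h2.
  by apply: nzq; rewrite ltW// (le_trans h2).
have rem r : s1 <= r <= s2 -> `|a (phi y r) - a (phi x r) - Da (phi x r) *m (phi y r - phi x r)|
    <= e1 * (C * `|y - x|).
  move=> srs; have h := displacement_le hy (rT r srs).
  apply: le_trans (Hd r (phi y r) (rT r srs) _ (le_trans h small2)) _.
    by apply: (refl_halfspace (sol hy)); case/andP: (rT r srs).
  by rewrite ler_wpM2l// ltW.
have e2 : 0 <= e1 * (C * `|y - x|) by apply: mulr_ge0 (ltW e10) _; exact: mulr_ge0 (ltW C0) (normr_ge0 _).
have := ode_compare K0 DaK lip (v y) solx (sol hy) hE al0 als1 s12 e2
  (lcst x hsx nz) (lcst y hy posy) rem.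
move=> /le_trans; apply.
set A := `|_ - _|; rewrite mulrAC.
have EX : 2 * expR (4 * (d.+1%:R * K) * (s2 - s1)) <= X.
  rewrite ler_wpM2l// ler_expR ler_wpM2l//; last by lra.
  by rewrite mulr_ge0// ltW.
have A0 : 0 <= A + 2 * (e1 * (C * `|y - x|) * (s2 - s1)).
  by apply: addr_ge0; [exact: normr_ge0|rewrite mulr_ge0// mulr_ge0// subr_ge0].
apply: le_trans (ler_wpM2r A0 EX) _; rewrite mulrDr lerD2l.
have -> : X * (2 * (e1 * (C * `|y - x|) * (s2 - s1))) =
  (2 * X * C * (s2 - s1) * e1) * `|y - x| by ring.
rewrite ler_wpM2r// /e1 mulrCA ler_piMr ?(ltW e0)// ler_pdivrMr// mul1r.
have XC : 0 < 2 * X * C by have X2 := mulr_gt0 (ltr0n R 2) X0; exact: mulr_gt0 X2 C0.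
by rewrite ler_pM2l//; lra.
Unshelve. all: by end_near.
Qed.

Lemma flow_near_before_hit t e : 0 <= t -> t <= T -> 0 < e ->
  (forall r, 0 <= r <= t -> phi x r ord_max 0 <> 0) ->
  \forall y \near x, `|psi y t - E 0 t *m (y - x)| <= e * `|y - x|.
Proof.
move=> t0 tT e0 nz.
have H := @interior_near 0 0 t e (fun y => y - x) (lexx 0) (lexx 0) t0 tT e0 nz.
near=> y.
have hy : halfspace y by near: y; exact: near_halfspace.
have : `|psi y t - E 0 t *m (y - x)| <= X * `|psi y 0 - E 0 0 *m (y - x)| + e * `|y - x|.
  by near: y.
have [-> _] := hE (lexx 0).
by rewrite /psi !flow_start// mul1mx subrr normr0 mulr0 add0r.
Unshelve. all: by end_near.
Qed.

(** The hitting time is itself a zero, so the interior estimate is used up to [s - eta]. Over the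
    last stretch the tangential displacement and the linear flow both move by [O(eta) * |y - x|]. *)
Lemma tangent_near_hit s e : 0 < s -> s <= T -> 0 < e ->
  (forall r, 0 <= r -> r < s -> phi x r ord_max 0 <> 0) ->
  \forall y \near x, `|P *m psi y s - P *m (E 0 s *m (y - x))| <= e * `|y - x|.
Proof.
move=> s0 sT e0 nz.
pose A := K * C + d.+1%:R * K * X.
have A0 : 0 < A by exact: addr_gt0 (mulr_gt0 K0 C0) (mulr_gt0 nK X0).
pose eta := Num.min s (e / (2 * A)).
have eta0 : 0 < eta by rewrite lt_min s0 divr_gt0// mulr_gt0.
have etas : eta <= s by rewrite ge_min lexx.
have etae : A * eta <= e / 2.
  have : eta <= e / (2 * A) by rewrite ge_min lexx orbT.
  by rewrite ler_pdivlMr ?mulr_gt0//; lra.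
have s'0 : 0 <= s - eta by lra.
have s's : s - eta <= s by lra.
have e2 : 0 < e / 2 by rewrite divr_gt0.
have H := @flow_near_before_hit (s - eta) (e / 2) s'0 (le_trans s's sT) e2.
have {}H := H (fun r h => nz r (proj1 (andP h)) (le_lt_trans (proj2 (andP h)) _)).
near=> y.
have hy : halfspace y by near: y; exact: near_halfspace.
have h1 : `|psi y (s - eta) - E 0 (s - eta) *m (y - x)| <= e / 2 * `|y - x|.
  by near: y; apply: H; lra.
have h2 := tangent_increment_le hy s'0 s's sT.
have h3 := linear_increment_le (y - x) (lexx 0) s'0 s's sT.
have -> : P *m psi y s - P *m (E 0 s *m (y - x)) =
  (P *m psi y s - P *m psi y (s - eta))
  + P *m (psi y (s - eta) - E 0 (s - eta) *m (y - x))
  - P *m (E 0 s *m (y - x) - E 0 (s - eta) *m (y - x)).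
  rewrite !mulmxBr; apply/matrixP => i j; rewrite !linmxE; ring.
apply: le_trans (ler_normB _ _) _.
apply: le_trans (lerD (ler_normD _ _) (norm_tangent_proj_le _)) _.
apply: le_trans (lerD (lerD h2 (le_trans (norm_tangent_proj_le _) h1)) h3) _.
have -> : s - (s - eta) = eta by ring.
have -> : K * C * eta * `|y - x| + e / 2 * `|y - x| + d.+1%:R * K * X * eta * `|y - x| =
   (A * eta + e / 2) * `|y - x| by rewrite /A; ring.
by rewrite ler_wpM2r//; lra.
Unshelve. all: by end_near.
Qed.

(** The interior comparison starts at [s1 = al + eta]. Up to then the tangential displacement and
    the linear flow move by [O(eta) * |y - x|], and at [s1] the normal displacement is of that order
    by [normal_displacement_near]; hence the projection of the initial vector. *)
Lemma excursion_near al t e : 0 < al -> al < t -> t <= T -> 0 < e ->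
  phi x al ord_max 0 = 0 ->
  (forall r, 0 <= r -> r < al -> l x r < l x al) ->
  (forall r, al < r -> r <= t -> phi x r ord_max 0 <> 0) ->
  \forall y \near x, `|psi y t - E al t *m (P *m psi y al)| <= e * `|y - x|.
Proof.
move=> al0 alt tT e0 pal strict nz.
(* The term [3 * K * C] covers the tangential and normal errors at [s1]; the other one is the motion
   of the linear flow from its start. *)
pose A := 3 * K * C + d.+1%:R * K * X * C.
have A0 : 0 < A.
  have K3 : 0 < 3 * K by rewrite mulr_gt0.
  by exact: addr_gt0 (mulr_gt0 K3 C0) (mulr_gt0 (mulr_gt0 nK X0) C0).
have X2 : 0 < 2 * X by rewrite pmulr_rgt0.
have XA : 0 < 2 * X * A by rewrite mulr_gt0.
pose eta := Num.min (t - al) (e / (2 * X * A)).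
have eta0 : 0 < eta by rewrite lt_min subr_gt0 alt divr_gt0.
have etat : eta <= t - al by rewrite ge_min lexx.
have etae : X * (A * eta) <= e / 2.
  have : eta <= e / (2 * X * A) by rewrite ge_min lexx orbT.
  by rewrite ler_pdivlMr//; lra.
pose s1 := al + eta.
have als1' : al < s1 by rewrite ltrDl.
have als1 := ltW als1'.
have s1t : s1 <= t by rewrite /s1; lra.
have al00 := ltW al0.
have s1T := le_trans s1t tT.
have nz1 r : s1 <= r <= t -> phi x r ord_max 0 <> 0.
  by move=> /andP[sr rt]; apply: nz => //; exact: lt_le_trans sr.
have lc : l x s1 = l x al.
  apply: (local_constant solx al00 als1) => r h1 h2; apply: nz => //; exact: le_trans s1t.
have e2 : 0 < e / 2 by rewrite divr_gt0.
have H1 := @interior_near al s1 t (e / 2) (fun y => P *m psi y al) al00 als1 s1t tT e2 nz1.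
have H2 := normal_displacement_near al0 als1 s1T pal strict lc als1'.
near=> y.
have hy : halfspace y by near: y; exact: near_halfspace.
have h1 : `|psi y t - E al t *m (P *m psi y al)| <=
    X * `|psi y s1 - E al s1 *m (P *m psi y al)| + e / 2 * `|y - x| by near: y.
have h2 : `|psi y s1 ord_max 0| <= 2 * K * C * (s1 - al) * `|y - x| by near: y.
apply: le_trans h1 _.
have s1al : s1 - al = eta by rewrite /s1; ring.
have alT : 0 <= al <= T by rewrite al00 (le_trans als1).
have vle : `|P *m psi y al| <= C * `|y - x|.
  exact: le_trans (norm_tangent_proj_le _) (displacement_le hy alT).
have h3 := tangent_increment_le hy al00 als1 s1T.
have h4 := linear_increment_le (P *m psi y al) al00 (lexx al) als1 s1T.
have [Eal _] := hE al00.
rewrite Eal mul1mx s1al in h4; rewrite s1al in h2 h3.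
have h5 : `|E al s1 *m (P *m psi y al) - P *m psi y al| <= d.+1%:R * K * X * C * eta * `|y - x|.
  apply: le_trans h4 _.
  have -> : d.+1%:R * K * X * C * eta * `|y - x| = d.+1%:R * K * X * eta * (C * `|y - x|) by ring.
  by rewrite ler_wpM2l// !mulr_ge0// ?(ltW X0) ?(ltW eta0) ?(ltW K0).
have dec : `|psi y s1 - E al s1 *m (P *m psi y al)| <= A * eta * `|y - x|.
  apply: mx_norm_le => [|i j]; first by rewrite !mulr_ge0// ltW.
  rewrite ord1.
  have k5 := le_trans (ler_mx_entry _ i 0) h5.
  have k3 := le_trans (ler_mx_entry _ i 0) h3.
  rewrite !linmxE in k3 k5 *.
  have AE : A * eta * `|y - x| = 3 * (K * C * eta * `|y - x|) + d.+1%:R * K * X * C * eta * `|y - x|.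
    by rewrite /A; ring.
  have KCe : 0 <= K * C * eta * `|y - x| by rewrite !mulr_ge0// ltW.
  have h2' : `|psi y s1 ord_max 0| <= 2 * (K * C * eta * `|y - x|).
    by apply: le_trans h2 _; rewrite le_eqVlt; apply/orP; left; apply/eqP; ring.
  rewrite /psi !linmxE in h2'.
  rewrite AE; move: k3 k5; rewrite (tangent_proj_entry (psi y s1)) (tangent_proj_entry (psi y al)).
  have [->|im] := eqVneq i ord_max.
    rewrite !mul0r !subr0 => _ k5.
    apply: le_trans (ler_normB _ _) _; move: h2' k5 KCe.
    by move: (K * C * eta * _) (d.+1%:R * K * X * C * eta * _) => u1 u2; lra.
  rewrite !mul1r => k3 k5.
  have <- : psi y s1 i 0 = phi y s1 i 0 - phi x s1 i 0 by rewrite /psi !linmxE.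
  have -> : psi y s1 i 0 - (E al s1 *m (P *m psi y al)) i 0 =
    (psi y s1 i 0 - psi y al i 0) - ((E al s1 *m (P *m psi y al)) i 0 - psi y al i 0) by ring.
  apply: le_trans (ler_normB _ _) _; move: k3 k5 KCe.
  by move: (K * C * eta * _) (d.+1%:R * K * X * C * eta * _) => u1 u2; lra.
apply: le_trans (lerD (ler_wpM2l (ltW X0) dec) (lexx _)) _.
have -> : X * (A * eta * `|y - x|) + e / 2 * `|y - x| = (X * (A * eta) + e / 2) * `|y - x| by ring.
by rewrite ler_wpM2r//; lra.
Unshelve. all: by end_near.
Qed.

(** At [be] the path is back on the boundary, so [excursion_near] is used up to [be - eta] and the
    last stretch costs [O(eta) * |y - x|] for the tangential part, which the local time does not
    affect. *)
Lemma excursion_tangent_near al be e : 0 < al -> al < be -> be <= T -> 0 < e ->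
  phi x al ord_max 0 = 0 ->
  (forall r, 0 <= r -> r < al -> l x r < l x al) ->
  (forall r, al < r -> r < be -> phi x r ord_max 0 <> 0) ->
  \forall y \near x, `|P *m psi y be - (P *m E al be *m P) *m (P *m psi y al)| <= e * `|y - x|.
Proof.
move=> al0 albe beT e0 pal strict nz.
pose A := K * C + d.+1%:R * K * X * C.
have A0 : 0 < A by exact: addr_gt0 (mulr_gt0 K0 C0) (mulr_gt0 (mulr_gt0 nK X0) C0).
pose eta := Num.min ((be - al) / 2) (e / (2 * A)).
have ba : 0 < be - al by rewrite subr_gt0.
have eta0 : 0 < eta by rewrite lt_min !divr_gt0// mulr_gt0.
have etat : eta <= (be - al) / 2 by rewrite ge_min lexx.
have etae : A * eta <= e / 2.
  have : eta <= e / (2 * A) by rewrite ge_min lexx orbT.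
  by rewrite ler_pdivlMr ?mulr_gt0//; lra.
pose t := be - eta.
have alt : al < t by rewrite /t; lra.
have tbe : t < be by rewrite /t; lra.
have tT : t <= T by exact: le_trans (ltW tbe) beT.
have e2 : 0 < e / 2 by rewrite divr_gt0.
have H := excursion_near al0 alt tT e2 pal strict
  (fun r h1 h2 => nz r h1 (le_lt_trans h2 tbe)).
have al00 := ltW al0.
have t0 : 0 <= t by rewrite (le_trans al00)// ltW.
near=> y.
have hy : halfspace y by near: y; exact: near_halfspace.
have h1 : `|psi y t - E al t *m (P *m psi y al)| <= e / 2 * `|y - x| by near: y.
have alT : 0 <= al <= T by rewrite al00 (le_trans (ltW albe)).
have vle : `|P *m psi y al| <= C * `|y - x|.
  exact: le_trans (norm_tangent_proj_le _) (displacement_le hy alT).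
have h2 := tangent_increment_le hy t0 (ltW tbe) beT.
have h3 := linear_increment_le (P *m psi y al) al00 (ltW alt) (ltW tbe) beT.
have bt : be - t = eta by rewrite /t; ring.
rewrite bt in h2 h3.
have -> : P *m psi y be - (P *m E al be *m P) *m (P *m psi y al) =
  (P *m psi y be - P *m psi y t)
  + P *m (psi y t - E al t *m (P *m psi y al))
  - P *m (E al be *m (P *m psi y al) - E al t *m (P *m psi y al)).
  have PP (u : 'cV[R]_d.+1) : P *m (P *m u) = P *m u by rewrite mulmxA tangent_proj_idem.
  rewrite -!mulmxA PP; move: (psi y al) (psi y be) (psi y t) => u1 u2 u3.
  by rewrite !mulmxBr; apply/matrixP => i j; rewrite !linmxE; ring.
apply: le_trans (ler_normB _ _) _.
apply: le_trans (lerD (ler_normD _ _) (norm_tangent_proj_le _)) _.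
apply: le_trans (lerD (lerD h2 (le_trans (norm_tangent_proj_le _) h1)) h3) _.
have h5 : d.+1%:R * K * X * eta * `|P *m psi y al| <= d.+1%:R * K * X * eta * (C * `|y - x|).
  by rewrite ler_wpM2l// !mulr_ge0// ?(ltW X0) ?(ltW eta0) ?(ltW K0).
apply: le_trans (lerD (lexx _) h5) _.
have -> : K * C * eta * `|y - x| + e / 2 * `|y - x| + d.+1%:R * K * X * eta * (C * `|y - x|) =
   (A * eta + e / 2) * `|y - x| by rewrite /A; ring.
by rewrite ler_wpM2r//; lra.
Unshelve. all: by end_near.
Qed.

End FlowDerivative.

(** * Excursions *)

Lemma connected_component_itv (R : realType) (A : set R) (al be s : R) : al < s -> s < be ->
  `]al, be[%classic `<=` A -> ~ A al -> ~ A be ->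
  connected_component A s = `]al, be[%classic.
Proof.
move=> als sbe sub nal nbe; apply/seteqP; split; last first.
  apply: connected_component_max => //=; first by rewrite in_itv/= als.
  by apply/connected_intervalP; exact: interval_is_interval.
have As : A s by apply: sub; rewrite /= in_itv/= als.
have /connected_intervalP itvC := @component_connected R A s.
have Cs := connected_component_refl As.
have notin z : ~ A z -> ~ connected_component A s z by move=> nz /connected_component_sub.
move=> r Cr /=; rewrite in_itv/=; apply/andP; split; rewrite ltNge; apply/negP => h.
  by apply: (notin al nal); apply: itvC Cr Cs _ _; rewrite h ltW.
by apply: (notin be nbe); apply: itvC Cs Cr _ _; rewrite h ltW.
Qed.

Section Excursions.
Context {R : realType} {d : nat}.
Variable p : R -> 'cV[R]_d.+1.
Hypothesis pc : continuous (fun s : R => p (Num.max s 0) ord_max 0).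
Variable t : R.

Lemma hitting_time_gt (r : R) : (t%:E < hitting_time p)%E -> 0 <= r <= t ->
  p r ord_max 0 <> 0.
Proof.
move=> tp /andP[r0 rt] pr.
have : (hitting_time p <= r%:E)%E by apply: ereal_inf_lbound; exists r.
by move=> /(lt_le_trans tp); rewrite lte_fin ltNge rt.
Qed.

Lemma hitting_time_first (s : R) : 0 <= s -> p s ord_max 0 = 0 ->
  (forall r, 0 <= r -> r < s -> p r ord_max 0 <> 0) -> hitting_time p = s%:E.
Proof.
move=> s0 ps nz; apply/eqP; rewrite eq_le; apply/andP; split.
  by apply: ereal_inf_lbound; exists s.
apply: le_ereal_inf_tmp => _ [r [r0 pr] <-]; rewrite lee_fin leNgt; apply/negP => rs.
exact: nz pr.
Qed.

Lemma hitting_time_attained : (hitting_time p <= t%:E)%E ->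
  exists s, [/\ 0 <= s <= t, p s ord_max 0 = 0,
    forall r, 0 <= r -> r < s -> p r ord_max 0 <> 0 & hitting_time p = s%:E].
Proof.
move=> ht.
(* An infimum at most [t] only yields zeros below any larger bound, hence the search in
   [[0, t + 1]]. The first zero found there turns out to be the infimum, thus at most [t]. *)
have [r /andP[r0 rt] pr] : exists2 r, 0 <= r <= t + 1 & p (Num.max r 0) ord_max 0 = 0.
  have : (hitting_time p < (t + 1)%:E)%E by apply: le_lt_trans ht _; rewrite lte_fin ltrDl.
  move=> /ereal_inf_lt [_ [r [r0 pr] <-]]; rewrite lte_fin => rt.
  by exists r; rewrite ?r0 ?ltW// max_l.
have [|s [/andP[s0 st] ps nz]] := first_zero_in pc (a := 0) (b := t + 1).
  by exists r => //; rewrite r0.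
rewrite (max_l s0) in ps.
have {}nz r' : 0 <= r' -> r' < s -> p r' ord_max 0 <> 0.
  by move=> r'0 r's; have := nz r' r'0 r's; rewrite max_l.
have E := hitting_time_first s0 ps nz.
by exists s; split=> //; rewrite s0; move: ht; rewrite E lee_fin.
Qed.

Variable sig : R.
Hypotheses (sig0 : 0 <= sig) (sigt : sig <= t) (psig : p sig ord_max 0 = 0).
Hypothesis sig1 : forall r, 0 <= r -> r < sig -> p r ord_max 0 <> 0.

Let hit : hitting_time p = sig%:E := hitting_time_first sig0 psig sig1.

Lemma excursion_setE : excursion_set p = [set s | sig < s /\ p s ord_max 0 <> 0].
Proof. by rewrite /excursion_set hit; apply/seteqP; split=> s /=; rewrite lte_fin. Qed.

Lemma last_hitting_time_attained : exists2 tau,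
  last_hitting_time p t = tau & [/\ sig <= tau <= t, p tau ord_max 0 = 0 &
    forall r, tau < r -> r <= t -> p r ord_max 0 <> 0].
Proof.
have [|tau [/andP[stau taut] ptau nz]] := last_zero_in pc (a := sig) (b := t).
  by exists sig; rewrite ?lexx// max_l.
have tau0 := le_trans sig0 stau; rewrite (max_l tau0) in ptau.
have {}nz r : tau < r -> r <= t -> p r ord_max 0 <> 0.
  move=> taur rt; have := nz r taur rt; rewrite max_l//.
  by rewrite (le_trans tau0)// ltW.
exists tau; last by rewrite stau.
have h : [set s : R | s \in `[0, t] /\ halfspace_bd (p s)] tau.
  by rewrite /= in_itv/= tau0.
have ub : ubound [set s : R | s \in `[0, t] /\ halfspace_bd (p s)] tau.
  move=> r /= [+ pr]; rewrite in_itv/= => /andP[r0 rt]; rewrite leNgt; apply/negP => taur.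
  exact: nz pr.
apply/eqP; rewrite eq_le; apply/andP; split; first by apply: ge_sup => //; exists tau.
by apply: ub_le_sup => //; exists tau.
Qed.

(** The end points are zeros because a component is maximal: a nonzero end point beyond [sig] could
    be adjoined to the interval. The left end may also be [sig], which is a zero by hypothesis. *)
Lemma excursionP (k : R * R) : excursions p t k ->
  [/\ sig <= k.1, k.1 < k.2, k.2 <= t, p k.1 ord_max 0 = 0 /\ p k.2 ord_max 0 = 0 &
    forall r, k.1 < r -> r < k.2 -> p r ord_max 0 <> 0].
Proof.
case: k => al be [/= sub [s As Cs]].
have Cs' := connected_component_refl As; rewrite Cs /= in_itv/= in Cs'.
have [als sbe] := andP Cs'.
have sA : `]al, be[%classic `<=` [set s | sig < s /\ p s ord_max 0 <> 0].
  by rewrite -Cs -excursion_setE; exact: connected_component_sub.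
have ab : al < be by exact: lt_trans sbe.
have sigal : sig <= al.
  apply/ler_addgt0Pr => e e0; have [|sae _] := sA (Num.min s (al + e)); last first.
    by apply: le_trans (ltW sae) _; rewrite ge_min lexx orbT.
  by rewrite /= in_itv/= lt_min als ltrDl e0 /= gt_min sbe.
have bet : be <= t.
  apply/ler_addgt0Pr => e e0; have /sub : `]al, be[%classic (Num.max s (be - e)).
    by rewrite /= in_itv/= gt_max sbe /= ltrBlDr ltrDl e0 lt_max als.
  rewrite /= in_itv/= => /andP[_]; rewrite ge_max => /andP[_].
  by rewrite lerBlDr.
have noext B : B s -> B `<=` excursion_set p -> is_interval B -> B `<=` `]al, be[%classic.
  move=> Bs BA /connected_intervalP cB; rewrite -Cs; exact: connected_component_max.
split=> //; last by move=> r h1 h2; have [] := sA r; rewrite //= in_itv/= h1.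
split; apply: contrapT => nz.
  have [E|nE] := eqVneq al sig; first by rewrite E psig in nz.
  have sal : sig < al by rewrite lt_neqAle sigal andbT eq_sym.
  have : `]al, be[%classic al.
    apply: (noext `[al, be[%classic) => /=.
    - by rewrite in_itv/= ltW.
    - rewrite excursion_setE => r /=; rewrite in_itv/= le_eqVlt => /andP[/orP[/eqP <- _|h1 h2]] //.
      by apply: sA; rewrite /= in_itv/= h1.
    - exact: interval_is_interval.
    - by rewrite in_itv/= lexx.
  by rewrite /= in_itv/= ltxx.
have : `]al, be[%classic be.
  apply: (noext `]al, be]%classic) => /=.
  - by rewrite in_itv/= als ltW.
  - rewrite excursion_setE => r /=; rewrite in_itv/= le_eqVlt => /andP[h1 /orP[/eqP -> |h2]].
      by split=> //; exact: le_lt_trans ab.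
    by apply: sA; rewrite /= in_itv/= h1.
  - exact: interval_is_interval.
  - by rewrite in_itv/= ab lexx.
by rewrite /= in_itv/= ltxx andbF.
Qed.

Lemma excursion_le_last (tau : R) (k : R * R) : 
  (forall r, tau < r -> r <= t -> p r ord_max 0 <> 0) -> excursions p t k -> k.2 <= tau.
Proof.
move=> nz /excursionP [_ _ k2t [_ pk2] _]; rewrite leNgt; apply/negP => h.
exact: nz pk2.
Qed.

(** The ends are the last zero before [s] and the first one after it; the zeros [sig] and [tau]
    guarantee that both exist. *)
Lemma excursion_exists (tau s : R) : tau <= t -> p tau ord_max 0 = 0 -> sig <= s -> s <= tau ->
  p s ord_max 0 <> 0 -> exists2 k, excursions p t k & k.1 < s < k.2.
Proof.
move=> taut ptau sigs stau ps.
have tau0 : 0 <= tau by rewrite (le_trans sig0)// (le_trans sigs).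
have [|al [/andP[sal als] pal nal]] := last_zero_in pc (a := sig) (b := s).
  by exists sig; rewrite ?lexx// max_l.
have [|be [/andP[sbe bet] pbe nbe]] := first_zero_in pc (a := s) (b := tau).
  by exists tau; rewrite ?lexx ?stau// max_l.
have al0 := le_trans sig0 sal; have s0 := le_trans al0 als; have be0 := le_trans s0 sbe.
rewrite (max_l al0) in pal; rewrite (max_l be0) in pbe.
have als' : al < s by rewrite lt_neqAle als andbT; apply: contra_notN ps => /eqP <-.
have sbe' : s < be by rewrite lt_neqAle sbe andbT; apply: contra_notN ps => /eqP ->.
exists (al, be); rewrite /= ?als'//.
have nz r : al < r -> r < be -> p r ord_max 0 <> 0.
  move=> alr rbe; have r0 : 0 <= r by rewrite (le_trans al0)// ltW.
  have [rs|sr] := leP r s; first by have := nal r alr rs; rewrite max_l.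
  by have := nbe r (ltW sr) rbe; rewrite max_l.
split=> /=.
  move=> r /=; rewrite !in_itv/= => /andP[h1 h2].
  by rewrite (le_trans al0 (ltW h1)) (le_trans (ltW h2))// (le_trans bet).
exists s; rewrite excursion_setE; first by split=> //; exact: le_lt_trans als'.
apply: connected_component_itv => //=; try by move=> [].
move=> r /=; rewrite in_itv/= => /andP[h1 h2]; split; last exact: nz.
exact: le_lt_trans h1.
Qed.

Lemma excursion_eq (k k' : R * R) (r : R) : excursions p t k -> excursions p t k' ->
  k.1 < r < k.2 -> k'.1 < r < k'.2 -> k = k'.
Proof.
case: k k' => [al be] [al' be'] /= /excursionP [/= _ _ _ [pal pbe] nz].
move=> /excursionP [/= _ _ _ [pal' pbe'] nz'] /andP[alr rbe] /andP[alr' rbe'].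
congr pair; apply/eqP; rewrite eq_le; apply/andP; split; rewrite leNgt; apply/negP => h.
- by apply: (nz' al) pal => //; exact: lt_trans rbe'.
- by apply: (nz al') pal' => //; exact: lt_trans rbe.
- by apply: (nz be') pbe' => //; exact: lt_trans rbe'.
- by apply: (nz' be) pbe => //; exact: lt_trans rbe.
Qed.

Lemma excursion_left_of (k k' : R * R) : excursions p t k -> excursions p t k' ->
  left_of k k' -> k = k' \/ k.2 <= k'.1.
Proof.
rewrite /left_of => hk hk' kk'; have [h|h] := leP k.2 k'.1; [by right|left].
have [_ k12 _ _ nz] := excursionP hk; have [_ k12' _ [pk' _] _] := excursionP hk'.
have E : k.1 = k'.1.
  apply/eqP; rewrite eq_le kk' leNgt; apply/negP => lt; exact: nz pk'.
pose r := (k.1 + Num.min k.2 k'.2) / 2.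
have m1 : k.1 < Num.min k.2 k'.2 by rewrite lt_min k12 E.
have m2 : Num.min k.2 k'.2 <= k.2 by rewrite ge_min lexx.
have m3 : Num.min k.2 k'.2 <= k'.2 by rewrite ge_min lexx orbT.
by apply: (@excursion_eq k k' r) => //; rewrite /r -?E; lra.
Qed.

End Excursions.

(** * Ordered products *)

Section ProductEstimates.
Context {R : realType} {n : nat}.
Variables (I : choiceType) (M : I -> 'M[R]_n.+1).
Local Notation r k := (n.+1%:R * `|M k|).

Let r0 k : 0 <= r k.
Proof. by rewrite mulr_ge0. Qed.

Local Notation prodm s := (\prod_(k <- s) (1 + M k)).

Let mulM k (A : 'M[R]_n.+1) : `|M k * A| <= r k * `|A|.
Proof. exact: norm_mulmx. Qed.

Lemma norm_prod_le s : `|prodm s| <= expR (\sum_(k <- s) r k).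
Proof.
elim: s => [|k s IH].
  rewrite !big_nil expR0; apply: mx_norm_le => // i j.
  by rewrite mxE; case: eqP => _; rewrite ?normr1// mulr0n normr0.
rewrite !big_cons mulrDl mul1r expRD; apply: le_trans (ler_normD _ _) _.
apply: le_trans (lerD (lexx _) (mulM _ _)) _.
rewrite -[X in X + _]mul1r -mulrDl; apply: ler_pM => //.
exact: expR_ge1Dx.
Qed.

(** Omitting a factor changes the product by [M k] placed between its neighbours, at a cost of [r k]
    times the exponential bound for the product. These costs add up to the difference of the two
    sums. *)
Lemma norm_prod_subseq_le s s' : subseq s s' ->
  `|prodm s' - prodm s| <=
    expR (\sum_(k <- s') r k) * (\sum_(k <- s') r k - \sum_(k <- s) r k).
Proof.
elim: s' s => [|k s' IH] s.
  by rewrite subseq0 => /eqP ->; rewrite !big_nil !subrr normr0 mulr0.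
have S0 : 0 <= \sum_(k <- s') r k by rewrite sumr_ge0.
have ek : 1 <= expR (r k) by rewrite -expR0 ler_expR.
have case2 : subseq s s' -> `|prodm (k :: s') - prodm s| <=
    expR (\sum_(k <- k :: s') r k) * (\sum_(k <- k :: s') r k - \sum_(k <- s) r k).
  move=> ss; rewrite !big_cons mulrDl mul1r addrAC expRD.
  have h1 := IH _ ss; have h2 := norm_prod_le s'.
  apply: le_trans (ler_normD _ _) _; apply: le_trans (lerD h1 (mulM _ _)) _.
  apply: le_trans (lerD (lexx _) (ler_wpM2l (r0 k) h2)) _.
  have d0 : 0 <= \sum_(k <- s') r k - \sum_(k <- s) r k.
    have := le_trans (normr_ge0 _) h1; rewrite pmulr_rge0//; exact: expR_gt0.
  set e := expR (\sum_(_ <- _) _); set D := _ - _ in d0 *.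
  have -> : r k + \sum_(j <- s') r j - \sum_(j <- s) r j = r k + D by rewrite /D addrA.
  have -> : e * D + r k * e = 1 * (e * (r k + D)) by ring.
  by rewrite -mulrA; apply: ler_wpM2r => //; apply: mulr_ge0; [exact: expR_ge0|exact: addr_ge0].
case: s case2 => [|k' s] case2 /=; first by move=> _; apply: case2; exact: sub0seq.
case: eqP => [->|_] ss; last exact: case2.
rewrite !big_cons -mulrBr mulrDl mul1r expRD.
have h1 := IH _ ss; apply: le_trans (ler_normD _ _) _.
apply: le_trans (lerD h1 (le_trans (mulM _ _) (ler_wpM2l (r0 k) h1))) _.
set e := expR (\sum_(_ <- _) _); set D := _ - _.
have d0 : 0 <= D by have := le_trans (normr_ge0 _) h1; rewrite pmulr_rge0//; exact: expR_gt0.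
have -> : r k + \sum_(j <- s') r j - (r k + \sum_(j <- s) r j) = D by rewrite /D; ring.
have -> : e * D + r k * (e * D) = (1 + r k) * (e * D) by ring.
rewrite -mulrA ler_wpM2r ?mulr_ge0 ?expR_ge0//; exact: expR_ge1Dx.
Qed.

Variable le : rel I.
Hypotheses (leT_total : total le) (leT_trans : transitive le).
Variable K : set I.
Hypothesis le_anti : forall k k', K k -> K k' -> le k k' -> le k' k -> k = k'.

(** Sorting is canonical only up to ties, and [left_of] compares left ends alone. Antisymmetry on
    [K] excludes ties, so sorting [L] amounts to filtering the sorted [L']. *)
Lemma subseq_sort_fset (L L' : {fset I}) : (L `<=` L')%fset -> [set` L'] `<=` K ->
  subseq (sort le L) (sort le L').
Proof.
move=> LL' L'K; have -> : sort le L = [seq k <- sort le L' | k \in L].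
  have mem k : k \in sort le L -> K k.
    by rewrite mem_sort => kL; apply: L'K; exact: (fsubsetP LL').
  apply: (sorted_eq_in (leT := le)); first by move=> ? ? ? _ _ _; exact: leT_trans.
  - by move=> k k' /mem kK /mem kK' /andP[]; exact: le_anti.
  - exact: sort_sorted.
  - by apply: sorted_filter => //; exact: sort_sorted.
  - apply: uniq_perm; rewrite ?filter_uniq ?sort_uniq ?fset_uniq// => k.
    rewrite mem_filter !mem_sort; have [kL|//] := boolP (k \in L).
    by rewrite (fsubsetP LL').
exact: filter_subseq.
Qed.

Variable C : R.
Hypothesis sumC : forall L : {fset I}, [set` L] `<=` K -> \sum_(k <- L) r k <= C.

Local Notation oprod L := (\prod_(k <- rev (sort le L)) (1 + M k)).

Lemma ordered_prod_dist (L L' : {fset I}) : (L `<=` L')%fset -> [set` L'] `<=` K ->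
  `|oprod L' - oprod L| <= expR C * (\sum_(k <- L') r k - \sum_(k <- L) r k).
Proof.
move=> LL' L'K.
have sumE (L1 : {fset I}) : \sum_(k <- rev (sort le L1)) r k = \sum_(k <- L1) r k.
  by apply: perm_big; rewrite perm_rev perm_sort.
have /norm_prod_subseq_le : subseq (rev (sort le L)) (rev (sort le L')).
  by rewrite subseq_rev; exact: subseq_sort_fset.
rewrite !sumE => h; apply: (le_trans h).
have := le_trans (normr_ge0 _) h; rewrite pmulr_rge0 ?expR_gt0// => d0.
by rewrite ler_wpM2r// ler_expR; exact: sumC.
Qed.

(** Choose [Lj j] with a sum within [1 / j.+1] of the supremum of all finite sums. By
    [ordered_prod_dist] any larger finite set changes the product by at most [expR C / j.+1];
    comparison with unions shows that these products form a Cauchy sequence. *)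
Lemma ordered_prod_cvg_exists : exists U : 'M[R]_n.+1, forall e : R, 0 < e ->
  exists2 L0 : {fset I}, [set` L0] `<=` K & forall L : {fset I}, (L0 `<=` L)%fset ->
    [set` L] `<=` K -> `|oprod L - U| <= e.
Proof.
pose S := [set \sum_(k <- L) r k | L in [set L : {fset I} | [set` L] `<=` K]].
have hS : has_sup S.
  split; first by exists (\sum_(k <- (fset0 : {fset I})) r k); exists fset0.
  by exists C => _ [L LK <-]; exact: sumC.
have H (j : nat) : exists L : {fset I}, [set` L] `<=` K /\
    sup S - j.+1%:R^-1 < \sum_(k <- L) r k.
  have j0 : 0 < j.+1%:R^-1 :> R by rewrite invr_gt0.
  by have [_ [L LK <-] h] := sup_adherent j0 hS; exists L.
have [Lj HL] := choice H.
have near_Lj j (L : {fset I}) : (Lj j `<=` L)%fset -> [set` L] `<=` K ->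
    `|oprod L - oprod (Lj j)| <= expR C * j.+1%:R^-1.
  move=> jL LK; apply: le_trans (ordered_prod_dist jL LK) _.
  rewrite ler_wpM2l ?expR_ge0//; have [_ h] := HL j.
  have : \sum_(k <- L) r k <= sup S by apply: sup_upper_bound => //; exists L.
  by rewrite lerBlDl => /le_trans; apply; rewrite -lerBlDr ltW.
pose u j := oprod (Lj j).
have small (e : R) : 0 < e -> \forall j \near \oo, expR C * j.+1%:R^-1 <= e.
  move=> e0; have e1 : 0 < e / expR C by rewrite divr_gt0 ?expR_gt0.
  have := near_infty_natSinv_lt (PosNum e1); apply: filterS => j /= h.
  by rewrite mulrC -ler_pdivlMr ?expR_gt0// ltW.
have cu : cvg (u @ \oo).
  apply: cauchy_cvg; apply: cauchy_exP => e e0.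
  have e3 : 0 < e / 3 by rewrite divr_gt0.
  have small3 := small _ e3.
  near \oo => N; exists (u N).
  suff : \forall j \near \oo, ball (u N) e (u j) by [].
  near=> j.
  have hN : expR C * N.+1%:R^-1 <= e / 3 by near: N.
  have hj : expR C * j.+1%:R^-1 <= e / 3 by near: j.
  have UK : [set` (Lj N `|` Lj j)%fset] `<=` K.
    move=> k /=; rewrite inE => /orP[]; [have [h _] := HL N|have [h _] := HL j]; exact: h.
  have h1 := near_Lj N _ (fsubsetUl _ _) UK; have h2 := near_Lj j _ (fsubsetUr _ _) UK.
  rewrite -ball_normE /ball_ /= /u.
  have -> : oprod (Lj N) - oprod (Lj j) =
     (oprod (Lj N `|` Lj j)%fset - oprod (Lj j)) - (oprod (Lj N `|` Lj j)%fset - oprod (Lj N)).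
    by rewrite opprB [RHS]addrC subrKA.
  apply: le_lt_trans (le_trans (ler_normB _ _) (lerD (le_trans h2 hj) (le_trans h1 hN))) _.
  by lra.
exists (lim (u @ \oo)) => e e0.
have e2 : 0 < e / 2 by rewrite divr_gt0.
have limu : \forall j \near \oo, `|lim (u @ \oo) - u j| <= e / 2.
  by have /cvgrPdist_le /(_ _ e2) := cu.
near \oo => j.
have hj : expR C * j.+1%:R^-1 <= e / 2 by near: j; exact: small.
have hU : `|lim (u @ \oo) - u j| <= e / 2.
  by near: j.
exists (Lj j); first by case: (HL j).
move=> L jL LK; have h := near_Lj j L jL LK.
have -> : oprod L - lim (u @ \oo) = (oprod L - u j) - (lim (u @ \oo) - u j).
  by rewrite opprB addrA subrK.
apply: (le_trans (ler_normB _ _)); apply: (le_trans (lerD (le_trans h hj) hU)).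
by lra.
Unshelve. all: by end_near.
Qed.

End ProductEstimates.

Section ProjectedProduct.
Context {R : realType} {n : nat}.
Variables (I : choiceType) (P : 'M[R]_n.+1) (E : I -> 'M[R]_n.+1).
Hypothesis PP : P *m P = P.

(* Unlike [P *m E k *m P], the factor [1 + P *m (E k - 1) *m P] is close to the
   identity when the excursion is short. *)
Lemma projected_prod (s : seq I) : s != [::] ->
  \prod_(k <- s) (P *m E k *m P) = P *m \prod_(k <- s) (1 + P *m (E k - 1) *m P).
Proof.
have PM k : P *m (1 + P *m (E k - 1) *m P) = P *m E k *m P.
  by rewrite mulmxDr !mulmxA PP mulmxBr mulmxBl !mulmx1 PP addrC subrK.
elim: s => // k [|k' s] IH _.
  by rewrite !big_cons !big_nil !mulr1 PM.
rewrite big_cons IH// [in RHS]big_cons.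
set Q := \prod_(_ <- _) _.
by rewrite -[_ * Q]/(_ *m Q) [RHS]mulmxA PM -[LHS]/(_ *m _ *m _ *m (_ *m _)) -!mulmxA
  [P *m (P *m Q)]mulmxA PP.
Qed.

Variables (le : rel I) (K : set I) (C : R).
Hypotheses (leT_total : total le) (leT_trans : transitive le).
Hypothesis le_anti : forall k k', K k -> K k' -> le k k' -> le k' k -> k = k'.
Hypothesis sumC : forall L : {fset I}, [set` L] `<=` K ->
  \sum_(k <- L) (n.+1%:R * `|P *m (E k - 1) *m P|) <= C.

Lemma projected_ordered_prod_cvg :
  exists U, ordered_prod_cvg le K (fun k => P *m E k *m P) U.
Proof.
(* The empty index set is treated apart: its product is the identity, whereas the limit found in the
   other case has a factor [P] in front. *)
have [K0|/set0P [k0 Kk0]] := eqVneq K set0.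
  exists 1 => e e0; exists fset0 => // L _; rewrite K0 => LK.
  have -> : L = fset0 by apply/fsetP => k; rewrite inE; apply/negP => /LK.
  rewrite -[enum_fset _]/[::] /= big_nil subrr.
  by apply: le_lt_trans (opnorm_le_norm _) _; rewrite normr0 mulr0.
have [U HU] := ordered_prod_cvg_exists leT_total leT_trans le_anti sumC.
exists (P *m U) => e e0.
pose c := Num.sqrt n.+1%:R * n.+1%:R * (n.+1%:R * `|P|).
have c0 : 0 <= c by rewrite !mulr_ge0// sqrtr_ge0.
have e1 : 0 < e / (c + 1) by rewrite divr_gt0// ltr_wpDl.
have [L0 L0K HL] := HU _ e1.
(* With [k0] included every admissible product is non-empty, as [projected_prod] demands. *)
exists (k0 |` L0)%fset.
  by move=> k /=; rewrite inE => /orP[]; [rewrite inE => /eqP ->|exact: L0K].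
move=> L L0L LK.
have k0L : k0 \in L by apply: (fsubsetP L0L); rewrite inE inE eqxx.
rewrite projected_prod; last first.
  have : k0 \in rev (sort le L) by rewrite mem_rev mem_sort.
  by case: (rev _).
rewrite -mulmxBr; apply: le_lt_trans (opnorm_le_norm _) _.
have h := HL L (fsubset_trans (fsubsetU1 _ _) L0L) LK.
have h2 := norm_mulmx P (\prod_(k <- rev (sort le L)) (1 + P *m (E k - 1) *m P) - U).
have s0 : 0 <= Num.sqrt n.+1%:R * n.+1%:R :> R by rewrite mulr_ge0// sqrtr_ge0.
apply: le_lt_trans (ler_wpM2l s0 h2) _; rewrite mulrA -/c.
apply: le_lt_trans (ler_wpM2l c0 h) _.
by rewrite mulrCA gtr_pMr// ltr_pdivrMr ?ltr_wpDl// mul1r ltrDl.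
Qed.

End ProjectedProduct.

Lemma disjoint_length_le (R : realDomainType) (s : seq (R * R)) (lo hi : R) : lo <= hi ->
  pairwise (fun k k' => k.2 <= k'.1) s ->
  {in s, forall k, lo <= k.1 <= k.2 /\ k.2 <= hi} -> \sum_(k <- s) (k.2 - k.1) <= hi - lo.
Proof.
elim/last_ind: s hi => [|s k IH] hi lohi; first by rewrite big_nil subr_ge0.
rewrite pairwise_rcons => /andP[/allP sk ps] Hs.
have [/andP[lok k12] k2] : lo <= k.1 <= k.2 /\ k.2 <= hi by apply: Hs; rewrite mem_rcons inE eqxx.
have /(_ k.1 lok ps) {}IH := IH.
rewrite -cats1 big_cat big_seq1 /=.
have : \sum_(j <- s) (j.2 - j.1) <= k.1 - lo.
  apply: IH => j js; have [-> _] : lo <= j.1 <= j.2 /\ j.2 <= hi.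
    by apply: Hs; rewrite mem_rcons inE js orbT.
  by split=> //; exact: sk.
by move: (\sum_(_ <- _) _) => S; lra.
Qed.

(** * Total length of the excursions *)

Section ExcursionLengths.
Context {R : realType} {d : nat}.
Variable p : R -> 'cV[R]_d.+1.
Hypothesis pc : continuous (fun s : R => p (Num.max s 0) ord_max 0).
Variables (t sig tau : R).
Hypotheses (sig0 : 0 <= sig) (psig : p sig ord_max 0 = 0).
Hypothesis sig1 : forall r, 0 <= r -> r < sig -> p r ord_max 0 <> 0.
Hypotheses (sigtau : sig <= tau) (taut : tau <= t) (ptau : p tau ord_max 0 = 0).
Hypothesis tau1 : forall r, tau < r -> r <= t -> p r ord_max 0 <> 0.

Let K := excursions p t.
Let KP := @excursionP R d p t sig sig0 psig sig1.
Let Keq := @excursion_eq R d p t sig sig0 psig sig1.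
Let Kleft := @excursion_left_of R d p t sig sig0 psig sig1.
Let Klast k := @excursion_le_last R d p t sig sig0 psig sig1 tau k tau1.

Lemma left_of_total : total (@left_of R).
Proof. by move=> k k'; exact: le_total. Qed.

Lemma left_of_trans : transitive (@left_of R).
Proof. by move=> k k' k''; exact: le_trans. Qed.

Lemma excursion_left_of_anti k k' : K k -> K k' -> left_of k k' -> left_of k' k -> k = k'.
Proof.
move=> hk hk' h h'; have [//|h2] := Kleft hk hk' h.
have [_ k12 _ _ _] := KP hk.
by have := lt_le_trans k12 (le_trans h2 h'); rewrite ltxx.
Qed.

Lemma excursions_sorted (L : {fset R * R}) : [set` L] `<=` K ->
  pairwise (fun k k' => k.2 <= k'.1) (sort (@left_of R) L).
Proof.
move=> LK; have : pairwise (fun k k' : R * R => left_of k k' && (k != k')) (sort (@left_of R) L).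
  rewrite pairwise_relI -uniq_pairwise sort_uniq fset_uniq andbT -sorted_pairwise.
    by apply: sort_sorted; exact: left_of_total.
  exact: left_of_trans.
apply: (@sub_in_pairwise _ (mem L)) => [k k' kL k'L /= /andP[h /eqP nk]|].
  by have [] := Kleft (LK k kL) (LK k' k'L) h.
by apply/allP => k; rewrite mem_sort.
Qed.

Lemma excursions_length_le (L : {fset R * R}) : [set` L] `<=` K ->
  \sum_(k <- L) (k.2 - k.1) <= tau - sig.
Proof.
move=> LK; rewrite -(perm_big _ (permEl (perm_sort (@left_of R) L))) /=.
apply: disjoint_length_le => //; first exact: excursions_sorted.
move=> k; rewrite mem_sort => /LK Kk; have [sk k12 _ _ _] := KP Kk.
by rewrite sk ltW//; split=> //; exact: Klast Kk.
Qed.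

Let pt (i : nat) : R := ratr (odflt 0 (choice.pickle_inv i) : rat).
(** Exhausts the excursions by finite families: each excursion contains a rational, and by
    disjointness a rational lies in at most one of them. *)
Let meets (N : nat) (k : R * R) := K k /\ exists2 i, (i < N)%N & k.1 < pt i < k.2.

Lemma finite_meets N : exists2 L : {fset R * R}, [set` L] `<=` K &
  forall k, meets N k -> k \in L.
Proof.
elim: N => [|N [L LK HL]]; first by exists fset0 => // k [_ []].
have [[k0 [Kk0 k0N]]|no] := pselect (exists k, K k /\ k.1 < pt N < k.2).
  exists (k0 |` L)%fset.
    by move=> k /=; rewrite inE => /orP[]; [rewrite inE => /eqP ->|exact: LK].
  move=> k [Kk [i]]; rewrite ltnS leq_eqVlt => /orP[/eqP -> kN|iN ki].
    by rewrite (Keq Kk Kk0 kN k0N) fset1U1.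
  by rewrite inE HL ?orbT//; split=> //; exists i.
exists L => // k [Kk [i]]; rewrite ltnS leq_eqVlt => /orP[/eqP -> kN|iN ki].
  by case: no; exists k.
by apply: HL; split=> //; exists i.
Qed.

Lemma measure_excursions_le (L : {fset R * R}) : [set` L] `<=` K ->
  (lebesgue_measure (\bigcup_(k in [set` L]) `]k.1, k.2[%classic) <=
    (\sum_(k <- L) (k.2 - k.1))%:E)%E.
Proof.
move=> LK; rewrite bigcup_seq.
have : {in enum_fset L, forall k, k.1 <= k.2}.
  by move=> k /LK /KP [_ /ltW].
elim: (enum_fset L) => [|k s IH] Hs; first by rewrite !big_nil measure0.
rewrite !big_cons EFinD; apply: (@le_trans _ _ (lebesgue_measure `]k.1, k.2[%classic +
    lebesgue_measure (\big[setU/set0]_(j <- s) `]j.1, j.2[%classic))%E).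
  apply: measureU2; first exact: measurable_itv.
  by apply: bigsetU_measurable => j _; exact: measurable_itv.
apply: leeD; last by apply: IH => j js; apply: Hs; rewrite inE js orbT.
rewrite lebesgue_measure_itv /= lte_fin; case: ltP => _; first by rewrite EFinB.
by rewrite lee_fin subr_ge0 Hs// inE eqxx.
Qed.

Hypothesis null : (@lebesgue_measure R).-negligible
  [set s | sig < s < tau /\ p s ord_max 0 = 0].

(** The unions [F N] increase to the union of all excursions before [tau], which has full measure in
    []sig, tau[] because the zeros are negligible. Continuity from below selects [N], and the finite
    family that covers [F N] is long enough. *)
Lemma excursions_nearly_full (eta : R) : 0 < eta ->
  exists2 L : {fset R * R}, [set` L] `<=` K &
    tau - sig - eta < \sum_(k <- L) (k.2 - k.1).
Proof.
move=> eta0.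
pose F N := \bigcup_(k in meets N) `]k.1, k.2[%classic.
have oF A : open (\bigcup_(k in A) `]k.1, k.2[%classic : set R).
  by apply: bigcup_open => k _; exact: interval_open.
have mF N : measurable (F N : set (measurableTypeR R)) by apply: measurable_realfun.open_measurable; exact: oF.
have mUF : measurable (\bigcup_N F N : set (measurableTypeR R)).
  by apply: bigcup_measurable => N _; exact: mF.
have ndF : nondecreasing_seq F.
  move=> N N' NN'; apply/subsetPset => r [k [Kk [i iN ki]] kr].
  by exists k => //; split=> //; exists i => //; exact: leq_trans NN'.
have [Z [mZ Z0 nullZ]] := null.
have full : ((tau - sig)%:E <= lebesgue_measure (\bigcup_N F N))%E.
  have -> : (tau - sig)%:E = lebesgue_measure (`]sig, tau[%classic : set R).
    rewrite lebesgue_measure_itv /= lte_fin; case: ltP => h; first by rewrite EFinB.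
    by have -> : tau = sig; [apply/eqP; rewrite eq_le h|rewrite subrr].
  have -> : lebesgue_measure (\bigcup_N F N) = (lebesgue_measure (\bigcup_N F N) + lebesgue_measure Z)%E.
    by rewrite Z0 adde0.
  apply: le_trans (measureU2 _ mUF mZ).
  apply: le_measure; rewrite ?inE; [exact: measurable_itv|exact: measurableU|].
  move=> s /=; rewrite in_itv/= => /andP[sigs stau].
  have [ps|ps] := pselect (p s ord_max 0 = 0); [right|left].
    by apply: nullZ; rewrite /= sigs stau.
  have [k Kk /andP[k1s sk2]] := excursion_exists pc sig0 psig sig1 taut ptau (ltW sigs) (ltW stau) ps.
  have k12 : k.1 < k.2 by exact: lt_trans sk2.
  have [q] := rat_in_itvoo k12; rewrite in_itv/= => kq.
  exists (choice.pickle q).+1 => //; exists k; last by rewrite /= in_itv/= k1s.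
  by split=> //; exists (choice.pickle q); rewrite ?ltnSn// /pt choice.pickleK_inv.
have cF := nondecreasing_cvg_mu (mu := @lebesgue_measure R) mF mUF ndF.
have [N HN] : exists N, ((tau - sig - eta)%:E < lebesgue_measure (F N))%E.
  have : ((tau - sig - eta)%:E < lebesgue_measure (\bigcup_N F N))%E.
    by apply: lt_le_trans full; rewrite lte_fin; lra.
  move=> h; apply: contrapT => no; move: h; rewrite ltNge => /negP; apply.
  apply: (cvge_le _ cF); near=> N.
  by rewrite leNgt; apply/negP => h; apply: no; exists N.
have [L LK HL] := finite_meets N.
exists L => //; rewrite -lte_fin; apply: lt_le_trans HN _.
apply: le_trans (measure_excursions_le LK).
apply: le_measure; rewrite ?inE; [exact: mF|by apply: measurable_realfun.open_measurable; exact: oF|].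
by move=> r [k kN kr]; exists k => //; exact: HL.
Unshelve. all: by end_near.
Qed.

End ExcursionLengths.

(** * Differentiability of the flow *)

Lemma is_diff_mulmx (R : realType) n (f : 'cV[R]_n.+1 -> 'cV[R]_n.+1) x (M : 'M[R]_n.+1) :
  (forall e : R, 0 < e -> \forall y \near x, `|f y - f x - M *m (y - x)| <= e * `|y - x|) ->
  is_diff x f (mulmx M).
Proof.
move=> H; pose df : {linear 'cV[R]_n.+1 -> 'cV[R]_n.+1} := mulmx M.
have dfc : continuous df.
  move=> u; apply: (iffRL (@cvgrPdist_le _ _ _ (nbhs u) _ df (df u))) => e e0; near=> v.
  rewrite /df /= -mulmxBr; apply: le_trans (norm_mulmx _ _) _.
  rewrite distrC; near: v; apply: near_scale_le => //; exact: mulr_ge0.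
have dxf : f \o shift x = cst (f x) + df +o_ (0 : 'cV[R]_n.+1) id.
  apply/eqaddoP => e e0; have := H e e0.
  rewrite (near_shift (0 : 'cV[R]_n.+1)) subr0 => H0; near=> h.
  have : `|f (h + x) - f x - M *m (h + x - x)| <= e * `|h + x - x|.
    by near: h; exact: H0.
  rewrite addrK => h1.
  have -> : (f \o shift x - (cst (f x) + df)) h = f (h + x) - f x - M *m h.
    by rewrite -[LHS]/(f (h + x) - (f x + M *m h)) opprD addrA.
  exact: h1.
have E := diff_unique dfc dxf.
by split; [apply/diff_locallyP; rewrite E|exact: E].
Unshelve. all: by end_near.
Qed.

Lemma norm_le_mulmx (R : realType) n (A : 'M[R]_n.+1) (c : R) :
  (forall v : 'cV[R]_n.+1, `|A *m v| <= c * `|v|) -> `|A| <= c.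
Proof.
move=> H.
have D (j : 'I_n.+1) : `|delta_mx j 0 : 'cV[R]_n.+1| = 1.
  apply/eqP; rewrite eq_le; apply/andP; split.
    by apply: mx_norm_le => // i k; rewrite mxE; case: (_ && _); rewrite ?normr1 ?normr0.
  apply: le_trans (ler_mx_entry _ j 0); by rewrite mxE !eqxx normr1.
apply: mx_norm_le => [|i j].
  by have := le_trans (normr_ge0 _) (H (delta_mx 0 0)); rewrite D mulr1.
have := le_trans (ler_mx_entry _ i 0) (H (delta_mx j 0)).
by rewrite -colE mxE D mulr1.
Qed.

(** The rightmost factor already ends in [P], and for the empty product [P *m P = P]. This removes
    the projection of the displacement at [sig] from the final formula. *)
Lemma projected_prod_proj (R : realType) n (P : 'M[R]_n.+1) (I : Type) (E : I -> 'M[R]_n.+1) s :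
  P *m P = P ->
  P *m \prod_(k <- s) (P *m E k *m P) *m P = P *m \prod_(k <- s) (P *m E k *m P).
Proof.
move=> PP; elim/last_ind: s => [|s k _]; first by rewrite big_nil mulmx1 PP.
rewrite -cats1 big_cat big_seq1 /=; set Q := \prod_(_ <- s) _.
by rewrite -[Q * _]/(Q *m _) -!mulmxA PP.
Qed.

Lemma scaled_le (R : realFieldType) (c e : R) : 0 <= c -> 0 < e ->
  exists2 e', 0 < e' & c * e' <= e.
Proof.
move=> c0 e0; exists (e / (c + 1)); first by rewrite divr_gt0// ltr_wpDl.
by rewrite mulrCA ler_piMr ?(ltW e0)// ler_pdivrMr ?ltr_wpDl// mul1r lerDl.
Qed.

(** * Tracking the displacement through the excursions *)

Section Tracking.
Context {R : realType} {d : nat}.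
Variables (a : 'cV[R]_d.+1 -> 'cV[R]_d.+1) (Da : 'cV[R]_d.+1 -> 'M[R]_d.+1) (K : R).
Hypothesis K0 : 0 < K.
Hypothesis aD : forall x, halfspace x -> is_diff_in halfspace a x (mulmx (Da x)).
Hypothesis Dac : {within halfspace, continuous Da}.
Hypothesis DaK : forall x, halfspace x -> `|Da x| <= K.
Hypothesis lip : forall x y, halfspace x -> halfspace y -> `|a x - a y| <= K * `|x - y|.
Variables (w : R -> 'cV[R]_d.+1) (phi : 'cV[R]_d.+1 -> R -> 'cV[R]_d.+1).
Variable l : 'cV[R]_d.+1 -> R -> R.
Hypothesis w0 : w 0 = 0.
Hypothesis sol : forall y, halfspace y -> reflected_solution a w y (phi y) (l y).
Variable x : 'cV[R]_d.+1.
Hypothesis hx : halfspace_int x.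
Variable E : R -> R -> 'M[R]_d.+1.
Hypothesis hE : linearized_solution Da (phi x) E.
Variable t : R.
Hypothesis t0 : 0 <= t.

Local Notation P := (@tangent_proj R d).
Local Notation psi := (displacement phi x).
Local Notation C := (lipschitz_cst K t).
Local Notation X := (@linear_cst R d K t).

Let hsx : halfspace x.
Proof. by rewrite /halfspace /= ltW. Qed.

Let solx := sol hsx.

Let C0 : 0 < C.
Proof. by rewrite mulr_gt0// expR_gt0. Qed.

Let X0 : 0 < X.
Proof. by rewrite mulr_gt0// expR_gt0. Qed.

Let c := d.+1%:R * K * X.

Let c0 : 0 < c.
Proof. by rewrite mulr_gt0// mulr_gt0. Qed.

Let tang := tangent_increment_le K0 lip sol hx t0.
Let lin := linear_increment_le K0 DaK sol hx hE.
Let lin1 := linear_le K0 DaK sol hx hE.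

Variables (sig tau : R).
Hypotheses (psig : phi x sig ord_max 0 = 0) (sig0 : 0 <= sig).
Hypothesis sig1 : forall r, 0 <= r -> r < sig -> phi x r ord_max 0 <> 0.
Hypotheses (sigtau : sig <= tau) (taut : tau < t) (ptau : phi x tau ord_max 0 = 0).
Hypothesis tau1 : forall r, tau < r -> r <= t -> phi x r ord_max 0 <> 0.
Hypothesis strict : forall al be, sig <= al -> al < be -> be <= t ->
  phi x al ord_max 0 = 0 -> (forall r, al < r -> r < be -> phi x r ord_max 0 <> 0) ->
  forall r, 0 <= r -> r < al -> l x r < l x al.
Hypothesis null : (@lebesgue_measure R).-negligible
  [set s | sig < s < tau /\ phi x s ord_max 0 = 0].

Let exc := excursions (phi x) t.
Let excP := @excursionP R d (phi x) t sig sig0 psig sig1.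
Let pc := @clamped_entry_continuous _ _ _ _ _ _ _ solx ord_max.

Let sig_gt0 : 0 < sig.
Proof.
rewrite lt_neqAle sig0 andbT; apply/eqP => E0.
by have := flow_start w0 sol hsx; move: psig hx; rewrite -E0 /halfspace_int /= => h1 + h2; rewrite -h2 h1 ltxx.
Qed.

Local Notation B k := (P *m E k.1 k.2 *m P).

Lemma excursion_factor_le k (u : 'cV[R]_d.+1) : exc k ->
  `|B k *m u| <= expR (c * (k.2 - k.1)) * `|u|.
Proof.
move=> /excP [sk k12 k2t _ _]; have k0 := le_trans sig0 sk.
have h := lin (P *m u) k0 (lexx _) (ltW k12) k2t; have [Ek _] := hE k0.
rewrite Ek mul1mx -/c in h.
rewrite -!mulmxA; apply: le_trans (norm_tangent_proj_le _) _.
rewrite -[E _ _ *m _](subrK (P *m u)); apply: le_trans (ler_normD _ _) _.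
apply: le_trans (lerD h (lexx _)) _; rewrite -[X in _ + X]mul1r -mulrDl.
apply: ler_pM => //; last exact: norm_tangent_proj_le.
  by rewrite addr_ge0// mulr_ge0 ?(ltW c0)// subr_ge0 ltW.
by rewrite addrC; exact: expR_ge1Dx.
Qed.

Lemma excursion_residual_le k : exc k ->
  `|P *m (E k.1 k.2 - 1) *m P| <= c * (k.2 - k.1).
Proof.
move=> /excP [sk k12 k2t _ _]; have k0 := le_trans sig0 sk.
apply: norm_le_mulmx => v.
have h := lin (P *m v) k0 (lexx _) (ltW k12) k2t; have [Ek _] := hE k0.
rewrite Ek mul1mx -/c in h.
have -> : P *m (E k.1 k.2 - 1) *m P *m v = P *m (E k.1 k.2 *m (P *m v) - P *m v).
  by rewrite -!mulmxA mulmxBl mul1mx.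
apply: le_trans (norm_tangent_proj_le _) _; apply: le_trans h _.
apply: ler_wpM2l; last exact: norm_tangent_proj_le.
by apply: mulr_ge0; [exact: ltW|rewrite subr_ge0 ltW].
Qed.

(* Each excursion multiplies the error made on the gaps before it by at most
   [expR (c * length)], whence the weight. *)
Lemma tangent_near_tracked (s : seq (R * R)) b (e : R) :
  pairwise (fun k k' : R * R => k.2 <= k'.1) s ->
  {in s, forall k, exc k /\ k.2 <= b} -> sig <= b -> b <= t -> 0 < e ->
  \forall y \near x,
    `|P *m psi y b - \prod_(k <- rev s) B k *m (P *m psi y sig)| <=
    (K * C * expR (c * (b - sig)) * (b - sig - \sum_(k <- s) (k.2 - k.1)) + e) * `|y - x|.
Proof.
elim/last_ind: s b e => [|s k IH] b e.
  move=> _ _ sb bt e0; near=> y.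
  have hy : halfspace y by near: y; exact: near_halfspace.
  rewrite /= !big_nil mul1mx subr0.
  apply: le_trans (tang hy sig0 sb bt) _; apply: ler_wpM2r => //.
  apply: le_trans (_ : _ <= K * C * expR (c * (b - sig)) * (b - sig)) _; last by rewrite lerDl ltW.
  apply: ler_wpM2r; first by rewrite subr_ge0.
  rewrite ler_peMr//; first by rewrite ltW// mulr_gt0.
  by rewrite -expR0 ler_expR mulr_ge0 ?subr_ge0// ltW.
rewrite pairwise_rcons => /andP[/allP sk ps] Hs sb bt e0.
have [Kk k2b] : exc k /\ k.2 <= b by apply: Hs; rewrite mem_rcons inE eqxx.
have [sk1 k12 k2t [pk1 _] nzk] := excP Kk.
have k1t : k.1 <= t by rewrite (le_trans (ltW k12)).
set q := expR (c * (k.2 - k.1)).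
have q0 : 0 < q by exact: expR_gt0.
have e2 : 0 < e / 2 by rewrite divr_gt0.
(* The error inherited from the earlier excursions is multiplied by [q], so this share becomes
   [e / 2]. *)
have e3 : 0 < e / (2 * q) by rewrite divr_gt0// mulr_gt0.
have Hs' : {in s, forall j, exc j /\ j.2 <= k.1}.
  move=> j js; have [Kj _] : exc j /\ j.2 <= b by apply: Hs; rewrite mem_rcons inE js orbT.
  by split=> //; exact: sk.
have H1 := IH k.1 (e / (2 * q)) ps Hs' sk1 k1t e3.
have al0 : 0 < k.1 by exact: lt_le_trans sk1.
have H2 := excursion_tangent_near K0 aD Dac DaK lip sol hx hE t0 al0 k12 k2t e2 pk1
  (strict sk1 k12 k2t pk1 nzk) nzk.
near=> y.
have hy : halfspace y by near: y; exact: near_halfspace.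
have h1 : `|P *m psi y k.1 - \prod_(k <- rev s) B k *m (P *m psi y sig)| <=
    (K * C * expR (c * (k.1 - sig)) * (k.1 - sig - \sum_(k <- s) (k.2 - k.1)) + e / (2 * q)) * `|y - x|.
  by near: y.
rewrite rev_rcons big_cons; set Q := \prod_(_ <- rev s) _ in h1 *.
rewrite -[B k * Q]/(B k *m Q) -mulmxA.
have h2 : `|P *m psi y k.2 - B k *m (P *m psi y k.1)| <= e / 2 * `|y - x| by near: y.
have k20 : 0 <= k.2 by rewrite (le_trans (ltW al0))// ltW.
have h3 := tang hy k20 k2b bt.
have h4 := le_trans (excursion_factor_le _ Kk) (ler_wpM2l (ltW q0) h1).
have -> : P *m psi y b - B k *m (Q *m (P *m psi y sig)) =
  (P *m psi y b - P *m psi y k.2) + (P *m psi y k.2 - B k *m (P *m psi y k.1))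
  + B k *m (P *m psi y k.1 - Q *m (P *m psi y sig)).
  rewrite (mulmxBr (B k)); move: (P *m psi y b) (P *m psi y k.2) (B k *m (P *m psi y k.1)) => u1 u2 u3.
  by rewrite !subrKA.
apply: le_trans (ler_normD _ _) _.
apply: le_trans (lerD (le_trans (ler_normD _ _) (lerD h3 h2)) h4) _.
rewrite [q * (_ * _)]mulrA -!mulrDl; apply: ler_wpM2r => //.
rewrite -cats1 big_cat big_seq1 /=; set S := \sum_(_ <- s) _.
have gap : 0 <= k.1 - sig - S.
  rewrite subr_ge0; apply: disjoint_length_le => // j js.
  have [Kj j2] := Hs' j js; have [sj j12 _ _ _] := excP Kj.
  by rewrite sj ltW.
have KC : 0 < K * C by rewrite mulr_gt0.
have exp1 : q * expR (c * (k.1 - sig)) <= expR (c * (b - sig)).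
  rewrite /q -expRD ler_expR -mulrDr ler_pM2l//; lra.
have exp0 : 1 <= expR (c * (b - sig)).
  by rewrite -expR0 ler_expR mulr_ge0 ?subr_ge0// ltW.
have qe : q * (e / (2 * q)) = e / 2 by field; rewrite gt_eqF.
have m1 : K * C * (b - k.2) <= K * C * (expR (c * (b - sig)) * (b - k.2)).
  by rewrite ler_pM2l// ler_peMl// subr_ge0.
have m2 : K * C * (q * expR (c * (k.1 - sig)) * (k.1 - sig - S)) <=
    K * C * (expR (c * (b - sig)) * (k.1 - sig - S)).
  by rewrite ler_pM2l// ler_wpM2r.
rewrite [q * (_ + _)]mulrDr qe.
have -> : q * (K * C * expR (c * (k.1 - sig)) * (k.1 - sig - S)) =
  K * C * (q * expR (c * (k.1 - sig)) * (k.1 - sig - S)) by ring.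
have -> : K * C * expR (c * (b - sig)) * (b - sig - (S + (k.2 - k.1))) =
  K * C * (expR (c * (b - sig)) * (b - k.2)) + K * C * (expR (c * (b - sig)) * (k.1 - sig - S)) by ring.
lra.
Unshelve. all: by end_near.
Qed.

(** The distance of each factor from the identity, on the range of [P], is at most [c] times the
    length of the excursion, and the lengths sum to at most [tau - sig]. *)
Lemma excursions_prod_cvg :
  exists U, ordered_prod_cvg (@left_of R) exc (fun k => B k) U.
Proof.
apply: (@projected_ordered_prod_cvg R d _ P (fun k => E k.1 k.2) (@tangent_proj_idem R d)
  _ _ (d.+1%:R * (c * (tau - sig)))).
- exact: left_of_total.
- exact: left_of_trans.
- exact: (excursion_left_of_anti sig0 psig sig1).
move=> L LK.
have h := excursions_length_le sig0 psig sig1 sigtau tau1 LK.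
apply: le_trans (_ : _ <= \sum_(k <- L) d.+1%:R * (c * (k.2 - k.1))) _.
  rewrite big_seq [leRHS]big_seq; apply: ler_sum => k kL.
  by apply: ler_wpM2l => //; exact: excursion_residual_le (LK k kL).
by rewrite -!mulr_sumr !ler_wpM2l// ltW.
Qed.

(** Four errors of size [e / 4]: the approximations on the last excursion and in the tracking
    ([e1]), the gaps between the tracked excursions ([eta]), the approach to the first hit ([e3]),
    and the truncation of the product ([e2]). *)
Lemma flow_near_after_hit (U : 'M[R]_d.+1) (e : R) :
  ordered_prod_cvg (@left_of R) exc (fun k => B k) U -> 0 < e ->
  \forall y \near x,
    `|psi y t - E tau t *m P *m U *m E 0 sig *m (y - x)| <= e * `|y - x|.
Proof.
move=> HU e0.
have tau0 := le_trans sig0 sigtau.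
have sigt := le_trans sigtau (ltW taut).
have e4 : 0 < e / 4 by rewrite divr_gt0.
pose G := K * C * expR (c * (tau - sig)).
have G0 : 0 <= G by rewrite !mulr_ge0 ?expR_ge0// ltW.
have [eta eta0 Heta] := scaled_le (mulr_ge0 (ltW X0) G0) e4.
have n0 : 0 <= X * (d.+1%:R * X) by rewrite !mulr_ge0// ltW.
have [e2 e20 He2] := scaled_le n0 e4.
have [L1 L1K HL1] := HU e2 e20.
have [L2 L2K HL2] := excursions_nearly_full pc sig0 psig sig1 sigtau (ltW taut) ptau null eta0.
(* [L1] brings the product close to [U] and [L2] fills [[sig, tau]] up to [eta]; both properties
   survive enlargement, so the union has them together. *)
pose L := (L1 `|` L2)%fset.
have LK : [set` L] `<=` exc.
  by move=> k /=; rewrite inE => /orP[]; [exact: L1K|exact: L2K].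
have PU := HL1 L (fsubsetUl _ _) LK.
set s := sort (@left_of R) L in PU.
have ss : pairwise (fun k k' : R * R => k.2 <= k'.1) s.
  by apply: (excursions_sorted sig0 psig sig1); exact: LK.
have sK : {in s, forall k, exc k /\ k.2 <= tau}.
  move=> k; rewrite mem_sort => /LK Kk; split=> //.
  exact: (excursion_le_last sig0 psig sig1 tau1 Kk).
have gap : tau - sig - \sum_(k <- s) (k.2 - k.1) <= eta.
  rewrite (perm_big _ (permEl (perm_sort (@left_of R) L))) /=.
  have : \sum_(k <- L2) (k.2 - k.1) <= \sum_(k <- L) (k.2 - k.1).
    rewrite (big_fsetID _ (mem L2) L) /=.
    have -> : [fset k in L | k \in L2]%fset = L2.
      by apply/fsetP => k; rewrite !inE /=; case: (k \in L2); rewrite ?orbT ?andbF.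
    rewrite lerDl big_seq sumr_ge0// => k; rewrite !inE /= -in_fsetU => /andP[kL _].
    by have [_ /ltW k12 _ _ _] := excP (LK k kL); rewrite subr_ge0.
  move: HL2; move: (\sum_(k <- L) _) (\sum_(k <- L2) _) => S1 S2; lra.
pose Q := \prod_(k <- rev s) B k.
have XQ0 : 0 <= X * (d.+1%:R * `|Q|) by rewrite !mulr_ge0// ltW.
(* The choice of [e3] has to come after that of [Q], whose norm multiplies the error made at the
   first hit. *)
have [e3 e30 He3] := scaled_le XQ0 e4.
have X1 : 0 <= 1 + X by rewrite addr_ge0// ltW.
have [e1 e10 He1] := scaled_le X1 e4.
have H1 := excursion_near K0 aD Dac DaK lip sol hx hE t0 (lt_le_trans sig_gt0 sigtau) taut (lexx t)
  e10 ptau (strict sigtau taut (lexx t) ptau (fun r h1 h2 => tau1 h1 (ltW h2))) tau1.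
have H2 := tangent_near_tracked ss sK sigtau (ltW taut) e10.
have H3 := tangent_near_hit K0 aD Dac DaK lip w0 sol hx hE t0 sig_gt0 sigt e30 sig1.
near=> y.
have h1 : `|psi y t - E tau t *m (P *m psi y tau)| <= e1 * `|y - x| by near: y.
have h2 : `|P *m psi y tau - Q *m (P *m psi y sig)| <=
  (G * (tau - sig - \sum_(k <- s) (k.2 - k.1)) + e1) * `|y - x| by near: y.
have h3 : `|P *m psi y sig - P *m (E 0 sig *m (y - x))| <= e3 * `|y - x| by near: y.
have PP (u : 'cV[R]_d.+1) : P *m (P *m u) = P *m u by rewrite mulmxA tangent_proj_idem.
have PQP (u : 'cV[R]_d.+1) : P *m (Q *m (P *m u)) = P *m (Q *m u).
  by rewrite !mulmxA (projected_prod_proj _ _ (@tangent_proj_idem R d)).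
set v := E 0 sig *m (y - x) in h3 *.
have vle : `|v| <= X * `|y - x| by exact: lin1 (lexx 0) sig0 sigt.
have -> : psi y t - E tau t *m P *m U *m E 0 sig *m (y - x) =
  (psi y t - E tau t *m (P *m psi y tau))
  + E tau t *m (P *m (P *m psi y tau - Q *m (P *m psi y sig)))
  + E tau t *m (P *m (Q *m (P *m psi y sig - P *m v)))
  + E tau t *m (P *m ((Q - U) *m v)).
  rewrite -!mulmxA -/v; move: (psi y t) (psi y tau) (psi y sig) => u1 u2 u3.
  rewrite (mulmxBl Q U) !mulmxBr PP !PQP.
  by apply/matrixP => i j; rewrite !linmxE; ring.
have Et (u : 'cV[R]_d.+1) : `|E tau t *m u| <= X * `|u|.
  by apply: lin1 => //; exact: ltW.
have PE (u : 'cV[R]_d.+1) : `|E tau t *m (P *m u)| <= X * `|u|.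
  by apply: le_trans (Et _) _; rewrite ler_wpM2l ?(ltW X0)// norm_tangent_proj_le.
have QU : `|(Q - U) *m v| <= d.+1%:R * X * e2 * `|y - x|.
  apply: le_trans (norm_mulmx _ _) _.
  have QU := le_trans (norm_le_opnorm (Q - U)) (ltW PU).
  have -> : d.+1%:R * X * e2 * `|y - x| = d.+1%:R * e2 * (X * `|y - x|) by ring.
  by apply: ler_pM => //; rewrite ler_wpM2l.
have Q3 : `|Q *m (P *m psi y sig - P *m v)| <= d.+1%:R * `|Q| * (e3 * `|y - x|).
  by apply: le_trans (norm_mulmx _ _) _; rewrite ler_wpM2l// mulr_ge0.
have XX := ltW X0.
apply: le_trans (ler_normD _ _) _; apply: le_trans (lerD (ler_normD _ _) (lexx _)) _.
apply: le_trans (lerD (lerD (ler_normD _ _) (lexx _)) (lexx _)) _.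
apply: le_trans (lerD (lerD (lerD h1 (le_trans (PE _) (ler_wpM2l XX h2)))
   (le_trans (PE _) (ler_wpM2l XX Q3))) (le_trans (PE _) (ler_wpM2l XX QU))) _.
have Gg : X * (G * (tau - sig - \sum_(k <- s) (k.2 - k.1))) <= e / 4.
  apply: le_trans Heta; rewrite mulrA ler_wpM2l// mulr_ge0//.
have -> : e1 * `|y - x| + X * ((G * (tau - sig - \sum_(k <- s) (k.2 - k.1)) + e1) * `|y - x|)
  + X * (d.+1%:R * `|Q| * (e3 * `|y - x|)) + X * (d.+1%:R * X * e2 * `|y - x|) =
  ((1 + X) * e1 + X * (G * (tau - sig - \sum_(k <- s) (k.2 - k.1)))
   + X * (d.+1%:R * `|Q|) * e3 + X * (d.+1%:R * X) * e2) * `|y - x| by ring.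
by rewrite ler_wpM2r//; lra.
Unshelve. all: by end_near.
Qed.

End Tracking.

(** * Almost sure properties of the path *)

Section LocalTimeGrowth.
Context {R : realType} {d : nat}.
Variables (a : 'cV[R]_d.+1 -> 'cV[R]_d.+1) (K : R).
Hypothesis K0 : 0 < K.
Variables (w : R -> 'cV[R]_d.+1) (x : 'cV[R]_d.+1) (p : R -> 'cV[R]_d.+1) (l : R -> R).
Hypothesis sol : reflected_solution a w x p l.
Hypothesis null : (@lebesgue_measure R).-negligible [set s | 0 < s /\ p s ord_max 0 = 0].

(** A null set contains no interval, and being off the boundary is an open condition in time, so it
    can be met at a rational time. *)
Lemma rational_off_boundary (lo hi : R) : 0 <= lo -> lo < hi ->
  exists q : rat, lo < ratr q < hi /\ 0 < p (ratr q) ord_max 0.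
Proof.
move=> lo0 lohi.
have [s [/andP[los shi] ps]] : exists s : R, lo < s < hi /\ p s ord_max 0 <> 0.
  apply: contrapT => no; have [Z [mZ Z0 nullZ]] := null.
  have : (lebesgue_measure (`]lo, hi[%classic : set R) <= lebesgue_measure Z)%E.
    apply: le_measure; rewrite ?inE; [exact: measurable_itv|exact: mZ|].
    move=> s /=; rewrite in_itv/= => los; apply: nullZ => /=; split.
      by case/andP: los => h _; exact: le_lt_trans h.
    by apply: contrapT => ps; apply: no; exists s.
  by rewrite Z0 lebesgue_measure_itv /= lte_fin lohi -EFinB lee_fin subr_le0 leNgt lohi.
have s0 : 0 < s by exact: le_lt_trans los.
have ps0 : 0 < p s ord_max 0.
  by rewrite lt_neqAle eq_sym (normal_coord_ge0 sol (ltW s0)) andbT; apply/eqP.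
have cp := @clamped_entry_continuous _ _ _ _ _ _ _ sol ord_max s.
have /cvgrPdist_lt := cp; rewrite max_l ?ltW// => /(_ _ ps0) [del /= del0 Hd].
have m : s < Num.min hi (s + del) by rewrite lt_min shi ltrDl.
have [q] := rat_in_itvoo m; rewrite in_itv/= lt_min => /andP[sq /andP[qhi qdel]].
exists q; rewrite (lt_trans los sq) qhi; split=> //.
have := Hd (ratr q); rewrite /ball_ /= distrC ger0_norm ?subr_ge0 ?(ltW sq)//.
rewrite ltrBlDl qdel => /(_ isT); rewrite (max_l (ltW (lt_trans s0 sq))).
by rewrite ltr_norml => /andP[_]; lra.
Qed.

Lemma short_time : exists2 del : R, 0 < del & forall s, 0 <= s -> s <= del ->
  K * (2 * expR (4 * K * s)) * s <= 1 / 4.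
Proof.
pose c := K * (2 * expR (4 * K)).
have c0 : 0 <= c by rewrite !mulr_ge0 ?expR_ge0// ltW.
have q0 : 0 < 1 / 4 :> R by lra.
have [e e0 He] := scaled_le c0 q0.
exists (Num.min 1 e); first by rewrite lt_min ltr01.
move=> s s0; rewrite le_min => /andP[s1 se]; apply: le_trans He.
apply: ler_pM => //; first by rewrite !mulr_ge0 ?expR_ge0// ltW.
rewrite ler_wpM2l ?(ltW K0)// ler_wpM2l// ler_expR ler_piMr//.
by rewrite mulr_ge0// ltW.
Qed.

Hypothesis touch : forall q q' : rat, 0 < (ratr q : R) -> ratr q < (ratr q' : R) ->
  K * (2 * expR (4 * K * (ratr q' - ratr q))) * (ratr q' - ratr q) <= 1 / 4 ->
  ~ [/\ 0 < p (ratr q) ord_max 0, l (ratr q') = l (ratr q) &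
    exists2 r, ratr q <= r <= ratr q' & p r ord_max 0 = 0].

(** Reduces the random left ends of excursions to countably many events. If [l] were constant on
    [[r, al]], rationals [q] just before [al], off the boundary, and [q'] inside the excursion would
    enclose the zero [al] without any increase of [l] between them, which [touch] forbids. *)
Lemma local_grows_before_excursion (al be r : R) : al < be -> p al ord_max 0 = 0 ->
  (forall s, al < s -> s < be -> p s ord_max 0 <> 0) -> 0 <= r -> r < al -> l r < l al.
Proof.
move=> albe pal nz r0 ral; rewrite ltNge; apply/negP => lal.
have al0 : 0 <= al by rewrite (le_trans r0)// ltW.
have [del del0 Hdel] := short_time.
pose lo := Num.max r (al - del / 2).
have lo0 : 0 <= lo by rewrite le_max r0.
have loal : lo < al by rewrite gt_max ral; lra.
have [q [/andP[loq qal] pq]] := rational_off_boundary lo0 loal.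
have m : al < Num.min be (al + del / 2) by rewrite lt_min albe; lra.
have [q'] := rat_in_itvoo m; rewrite in_itv/= lt_min => /andP[alq' /andP[q'be q'del]].
have rq : r < ratr q by apply: le_lt_trans loq; rewrite le_max lexx.
have qdel : al - del / 2 < ratr q by apply: le_lt_trans loq; rewrite le_max lexx orbT.
have q0 : 0 < (ratr q : R) by exact: le_lt_trans rq.
have qq' : ratr q < (ratr q' : R) by exact: lt_trans alq'.
apply: (touch q0 qq').
  by apply: Hdel; [rewrite subr_ge0 ltW|lra].
split=> //; last by exists al => //; rewrite !ltW.
have -> : l (ratr q') = l al.
  apply: (local_constant sol al0 (ltW alq')) => s h1 h2; apply: nz => //.
  exact: le_lt_trans q'be.
have h1 := refl_local_nondecreasing sol r0 (ltW rq).
have h2 := refl_local_nondecreasing sol (ltW q0) (ltW qal).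
by apply/eqP; rewrite eq_le h2 (le_trans lal).
Qed.

End LocalTimeGrowth.

Section AlmostSure.
Context {R : realType} {d : nat} {disp : measure_display} {Omega : measurableType disp}.
Variables (Pr : probability Omega R) (w : R -> Omega -> 'cV[R]_d.+1).
Hypothesis hw : wiener Pr w.
Variables (a : 'cV[R]_d.+1 -> 'cV[R]_d.+1) (K : R).
Hypothesis K0 : 0 < K.
Hypothesis lip : forall x y, halfspace x -> halfspace y -> `|a x - a y| <= K * `|x - y|.
Variables (phi : R -> Omega -> 'cV[R]_d.+1) (L : R -> Omega -> R) (x : 'cV[R]_d.+1).
Hypothesis hphi : forall om,
  reflected_solution a (fun t => w t om) x (fun t => phi t om) (fun t => L t om).

Lemma boundary_time_null_ae : \forall om \ae Pr,
  (@lebesgue_measure R).-negligible [set s | 0 < s /\ phi s om ord_max 0 = 0].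
Proof.
apply: filterS (wiener_left_growth_ae hw ord_max) => om.
apply: negligibleS => s [s0 ps]; split=> //.
exact: (zero_left_growth K0 lip (hphi om) (ltW s0) ps).
Qed.

(** A zero at [t] would entail linear growth of the noise before [t], with a rate depending on the
    outcome; integer rates form a countable union of null sets. This gives [tau < t]. *)
Lemma off_boundary_ae (t : R) : 0 < t -> \forall om \ae Pr, phi t om ord_max 0 <> 0.
Proof.
move=> t0.
have : Pr.-negligible (\bigcup_k [set om | forall r, 0 <= r <= t ->
    w t om ord_max 0 - w r om ord_max 0 <= k%:R * (t - r)]).
  by apply: negligible_bigcup => k; exact: wiener_left_growth_negligible.
apply: negligibleS => om /= /contrapT pt.
have [M HM] := zero_left_growth K0 lip (hphi om) (ltW t0) pt.
exists (Num.truncn `|M|).+1 => //= r /andP[r0 rt].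
apply: le_trans (HM r _) _; first by rewrite r0.
rewrite ler_wpM2r ?subr_ge0//; apply: le_trans (ler_norm M) _.
by rewrite ltW// truncnS_gt.
Qed.

Lemma no_touching_ae : \forall om \ae Pr, forall q q' : rat,
  0 < (ratr q : R) -> ratr q < (ratr q' : R) ->
  K * (2 * expR (4 * K * (ratr q' - ratr q))) * (ratr q' - ratr q) <= 1 / 4 ->
  ~ [/\ 0 < phi (ratr q) om ord_max 0, L (ratr q') om = L (ratr q) om &
    exists2 r, ratr q <= r <= ratr q' & phi r om ord_max 0 = 0].
Proof.
pose rt i : rat := odflt 0 (choice.pickle_inv i).
have : \forall om \ae Pr, forall i j, 0 < (ratr (rt i) : R) ->
  ratr (rt i) < (ratr (rt j) : R) ->
  K * (2 * expR (4 * K * (ratr (rt j) - ratr (rt i)))) * (ratr (rt j) - ratr (rt i)) <= 1 / 4 ->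
  ~ [/\ 0 < phi (ratr (rt i)) om ord_max 0, L (ratr (rt j)) om = L (ratr (rt i)) om &
    exists2 r, ratr (rt i) <= r <= ratr (rt j) & phi r om ord_max 0 = 0].
  apply: ae_foralln => i; apply: ae_foralln => j.
  have [h|h] := pselect ([/\ 0 < (ratr (rt i) : R), ratr (rt i) < (ratr (rt j) : R) &
    K * (2 * expR (4 * K * (ratr (rt j) - ratr (rt i)))) * (ratr (rt j) - ratr (rt i)) <= 1 / 4]);
    last first.
    by apply: aeW => om h1 h2 h3; case: h.
  case: h => h1 h2 h3; apply: negligibleS (touching_negligible hw K0 lip hphi h1 h2 h3).
  by move=> om /= no; apply: contrapT => h; apply: no.
apply: filterS => om H q q'.
by have := H (choice.pickle q) (choice.pickle q'); rewrite /rt !choice.pickleK_inv.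
Qed.

End AlmostSure.

Unset Implicit Arguments.

Theorem corollary1 (R : realType) (d : nat)
    (disp : measure_display) (Omega : measurableType disp)
    (Pr : probability Omega R)
    (w : R -> Omega -> 'cV[R]_d.+1)
    (a : 'cV[R]_d.+1 -> 'cV[R]_d.+1) (Da : 'cV[R]_d.+1 -> 'M[R]_d.+1)
    (phi : R -> 'cV[R]_d.+1 -> Omega -> 'cV[R]_d.+1)
    (L : R -> 'cV[R]_d.+1 -> Omega -> R)
    (E : R -> R -> 'cV[R]_d.+1 -> Omega -> 'M[R]_d.+1)
    (hw : wiener Pr w)
    (ha : C1_bounded a Da)
    (hphi : forall omega x, halfspace x ->
      reflected_solution a (fun t => w t omega) x
        (fun t => phi t x omega) (fun t => L t x omega))
    (hE : forall omega x, halfspace x ->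
      linearized_solution Da (fun t => phi t x omega)
        (fun s t => E s t x omega)) :
  forall (t : R) (x : 'cV[R]_d.+1), 0 <= t -> halfspace_int x ->
    \forall omega \ae Pr,
      let path := fun s => phi s x omega in
      let sigma := hitting_time path in
      let tau := last_hitting_time path t in
      let P := tangent_proj in
      ((t%:E < sigma)%E ->
         is_diff x (fun y => phi t y omega) (mulmx (E 0 t x omega))) /\
      ((sigma <= t%:E)%E ->
         exists2 U : 'M[R]_d.+1,
           ordered_prod_cvg left_of (excursions path t)
             (fun k => P *m E k.1 k.2 x omega *m P) U &
           is_diff x (fun y => phi t y omega)
             (mulmx (E tau t x omega *m P *m U *m E 0 (fine sigma) x omega))).
Proof.
move=> t x t0 hx; have hsx : halfspace x by rewrite /halfspace /= ltW.
have [K K0 [DaK lip]] := C1_bounded_lipschitz ha; have [aD Dac _] := ha.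
have hx' om := hphi om x hsx.
(* The estimate requires a positive time. At time 0 the path is at the interior point [x], so the
   case of a visit before [t] will exclude [t = 0]. *)
have off : \forall om \ae Pr, 0 < t -> phi t x om ord_max 0 <> 0.
  have [t0'|t0'] := ltP 0 t; last by apply: aeW => om.
  by apply: filterS (off_boundary_ae hw K0 lip hx' t0') => om h _.
apply: filterS3 off (boundary_time_null_ae hw K0 lip hx') (no_touching_ae hw K0 lip hx').
move=> om pt null touch; pose path s := phi s x om; rewrite -/path.
have w0 : w 0 om = 0 := wiener0 hw om.
pose sol y (hy : halfspace y) := hphi om y hy.
have solx := hx' om.
have hEx := hE om x hsx.
split=> [tsig|sigt].
  apply: is_diff_mulmx => e e0.
  exact: (@flow_near_before_hit _ _ a Da K K0 aD Dac DaK lip (fun s => w s om)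
    (fun y s => phi s y om) (fun y s => L s y om) w0 sol x hx _ hEx t t0 t e t0 (lexx t) e0
    (fun r => hitting_time_gt tsig)).
have pc := @clamped_entry_continuous _ _ _ _ _ _ _ solx ord_max.
have [s [/andP[s0 st] ps s1 sigE]] := hitting_time_attained pc sigt.
have [r tauE [/andP[sr rt] pr r1]] := last_hitting_time_attained pc s0 st ps.
have path0 : path 0 = x := @flow_start _ _ a (fun s => w s om) (fun y s => phi s y om)
  (fun y s => L s y om) w0 sol x hsx.
have t0' : 0 < t.
  rewrite lt_neqAle t0 andbT; apply/eqP => tE; move: hx; rewrite /halfspace_int /= -path0.
  have sz : s = 0 by apply/eqP; rewrite eq_le s0 tE st.
  by rewrite sz in ps; rewrite ps ltxx.
have rt' : r < t.
  by rewrite lt_neqAle rt andbT; apply/eqP => rE; apply: (pt t0'); rewrite -rE.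
have strict al be : s <= al -> al < be -> be <= t -> path al ord_max 0 = 0 ->
    (forall r, al < r -> r < be -> path r ord_max 0 <> 0) ->
    forall r, 0 <= r -> r < al -> L r x om < L al x om.
  move=> _ albe _ pal nz q; exact: (local_grows_before_excursion K0 solx null touch albe pal nz).
have null' : (@lebesgue_measure R).-negligible [set q | s < q < r /\ path q ord_max 0 = 0].
  by apply: negligibleS null => q /= [/andP[sq _] pq]; split=> //; exact: le_lt_trans sq.
have [U HU] := @excursions_prod_cvg _ _ a Da K K0 DaK (fun s => w s om)
  (fun y s => phi s y om) (fun y s => L s y om) sol x hx _ hEx t s r ps s0 s1 sr r1.
exists U => //; apply: is_diff_mulmx => e e0.
rewrite tauE sigE /=.
exact: (@flow_near_after_hit _ _ a Da K K0 aD Dac DaK lip (fun s => w s om)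
  (fun y s => phi s y om) (fun y s => L s y om) w0 sol x hx _ hEx t t0 s r ps s0 s1 sr rt' pr r1
  strict null' U e HU e0).
Qed.
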